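(* Let $\mathcal{T}$ and $\widetilde{\mathcal{T}}$ be compact nonnegative self-adjoint operators in Hilbert spaces $\mathcal{H}$ and $\widetilde{\mathcal{H}}$ having the spectral asymptotics $$\mathcal{N}(t,\mathcal{T})\sim\frac{\varphi(1/t)\,s(\ln(1/t))}{t^{1/p}},\qquad \mathcal{N}(t,\widetilde{\mathcal{T}})\sim\frac{\widetilde\varphi(1/t)\,\widetilde s(\ln(1/t))}{t^{1/p}},\qquad t\to+0,$$ where $p>0$, $\varphi,\widetilde\varphi$ are slowly varying functions, and $s,\widetilde s$ are continuous periodic functions. Suppose that $$\int_1^\infty\varphi(\tau)\frac{d\tau}{\tau}<\infty,\qquad \int_1^\infty\widetilde\varphi(\tau)\frac{d\tau}{\tau}=\infty,$$ that the periods of $s$ and $\widetilde s$ coincide and equal $T$, and that $$\int_1^\infty\varphi(\sigma)\,m_{\widetilde\varphi}(\sigma)\frac{d\sigma}{\sigma}<\infty,\qquad m_{\widetilde\varphi}(\sigma)=\sup_{\tau>\sigma^2}\frac{\widetilde\varphi(\tau/\sigma)}{\widetilde\varphi(\tau)}.$$ Then, as $t\to+0$, $$\mathcal{N}(t,\mathcal{T}\otimes\widetilde{\mathcal{T}})\sim\frac{h_{\widetilde\varphi,\varphi}(1/t)\,s_\otimes(\ln(1/t))+\widetilde\varphi(1/t)\,\widetilde s^*(\ln(1/t))}{t^{1/p}},$$ where $$s_\otimes(\eta)=\frac{(s\star\widetilde s)(\eta)}{p}+(s\star\widetilde s)'(\eta)=e^{-\eta/p}\frac1T\int_0^T\varrho(\eta-\sigma)\,d\widetilde\varrho(\sigma),\qquad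 \widetilde s^*(\tau)=\sum_n\widetilde s(\tau+\ln\lambda_n)\,\lambda_n^{1/p},$$ $\lambda_n$ are the eigenvalues of $\mathcal{T}$, and $\varrho(\tau)=e^{\tau/p}s(\tau)$, $\widetilde\varrho(\tau)=e^{\tau/p}\widetilde s(\tau)$.
   Context: For a compact nonnegative self-adjoint operator $\mathcal{T}$ in a Hilbert space, $\lambda_n=\lambda_n(\mathcal{T})$ denote its positive eigenvalues arranged in nonincreasing order and repeated according to multiplicity, and $\mathcal{N}(t,\mathcal{T})=\#\{n:\lambda_n(\mathcal{T})>t\}$ for $t>0$. The operator $\mathcal{T}\otimes\widetilde{\mathcal{T}}$ acts in the Hilbert space $\mathcal{H}\otimes\widetilde{\mathcal{H}}$. The relation $f\sim g$ means $f=g\,(1+o(1))$. A positive (measurable) function $\varphi(\tau)$, $\tau>0$, is called slowly varying if $\varphi(c\tau)/\varphi(\tau)\to1$ as $\tau\to+\infty$ for every constant $c>0$. For slowly varying $\varphi,\psi$, $h_{\varphi,\psi}(\tau)=\int_1^{\sqrt\tau}\varphi(\sigma)\psi(\tau/\sigma)\frac{d\sigma}{\sigma}$. For $s,\widetilde s$ with common period $T$, $(s\star\widetilde s)(\eta)=\frac1T\int_0^T s(\eta-\lambda)\widetilde s(\lambda)\,d\lambda$ (this function is continuously differentiable under the standing assumptions). Standing assumptions: slowly varying functions in the spectral asymptotics are $C^2$-smooth with $\tau(\ln\varphi)'(\tau)\to0$ and $\tau^2(\ln\varphi)''(\tau)\to0$ as $\tau\to\infty$; the periodic functions $s,\widetilde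 s$ are continuous, positive (bounded and separated from zero), and $\varrho,\widetilde\varrho$ are monotone. The integral with respect to $d\widetilde\varrho$ is a Lebesgue--Stieltjes integral. *)

(* Defs.v *)
From HB Require Import structures.
From mathcomp Require Import all_boot all_order all_algebra.
From mathcomp Require Import finmap sesquilinear complex.
From mathcomp Require Import all_classical all_reals all_analysis.

Set Implicit Arguments.
Unset Strict Implicit.
Unset Printing Implicit Defensive.

Import Order.TTheory GRing.Theory Num.Theory.
Import numFieldNormedType.Exports.

Local Open Scope classical_set_scope.
Local Open Scope complex_scope.
Local Open Scope ring_scope.

(* Complex Hilbert spaces.  As in MathComp's [{dot _ for _}], the inner product
   is linear in its first argument and antilinear in the second one. *)
HB.mixin Record isHilbert (R : realType) H of CompleteNormedModule R[i] H := {
  inner : {dot H for (@Num.conj R[i])} ;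
  inner_norm : forall x : H, inner x x = `|x| ^+ 2 }.

#[short(type="hilbertType")]
HB.structure Definition Hilbert (R : realType) :=
  { H of isHilbert R H & CompleteNormedModule R[i] H }.

Section Operators.
Variables (R : realType) (H : hilbertType R).
Implicit Type A : {linear H -> H}.

Definition compact_operator A := precompact (A @` [set x : H | `|x| <= 1]).

(* [A] is defined on all of [H], so symmetry is self-adjointness. *)
Definition selfadjoint A := forall x y : H, inner (A x) y = inner x (A y).

Definition nonnegative_operator A := forall x : H, 0 <= inner (A x) x.

Definition eigspace A (mu : R) : set H := [set x | A x = mu%:C *: x].

(* For a linear subspace [E]: [E] has a basis with [k] elements. *)
Definition has_dim (E : set H) (k : nat) :=
  exists e : 'I_k -> H, (forall i, E (e i)) /\
    forall x, E x ->
      exists! c : {ffun 'I_k -> R[i]}, x = \sum_(i < k) c i *: e i.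

(* [lam] lists the positive eigenvalues of [A] in nonincreasing order, repeated
   according to multiplicity; if there are only finitely many of them, the list
   is padded with zeros. *)
Definition is_eigenvalue_seq A (lam : nat -> R) :=
  [/\ nonincreasing_seq lam,
      forall n, 0 <= lam n &
      forall mu, 0 < mu -> exists k : nat,
        ([set n | lam n = mu] #= `I_k)%card /\ has_dim (eigspace A mu) k].

(* Such a sequence exists and is unique when [A] is compact, self-adjoint and
   nonnegative. *)
Definition eigenvalues A : nat -> R :=
  xget (fun=> 0) [set lam | is_eigenvalue_seq A lam].

Definition spectral_count A (t : R) : nat :=
  #|` fset_set [set n | t < eigenvalues A n]|%fset.

End Operators.

Section Tensor.
Variables (R : realType) (H Ht K : hilbertType R).

(* [K], with [tens u v] in the role of [u (x) v], is the Hilbert space tensor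
   product of [H] and [Ht]; this determines [(K, tens)] up to a unique
   isometric isomorphism. *)
Definition is_tensor_product (tens : {bilinear H -> Ht -> K}) :=
  (forall u u' v v',
     inner (tens u v) (tens u' v') = inner u u' * inner v v') /\
  dense [set z : K | exists n (u : 'I_n -> H) (v : 'I_n -> Ht),
                       z = \sum_(i < n) tens (u i) (v i)].

(* [B] is the bounded operator [A (x) At]. *)
Definition is_tensor_operator (tens : {bilinear H -> Ht -> K})
    (A : {linear H -> H}) (At : {linear Ht -> Ht}) (B : {linear K -> K}) :=
  continuous B /\ forall u v, B (tens u v) = tens (A u) (At v).

End Tensor.

Section Functions.
Variable R : realType.
Implicit Types (phi psi s st : R -> R) (p T : R).
Local Notation mu := (@lebesgue_measure R).

Definition slowly_varying phi :=
  [/\ measurable_fun (`]0, +oo[ : set R) phi,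
      forall tau, 0 < tau -> 0 < phi tau &
      forall c, 0 < c -> phi (c * tau) / phi tau @[tau --> +oo] --> (1 : R)].

Definition C2_on_pos phi := forall tau, 0 < tau ->
  [/\ derivable phi tau 1, derivable (derive1 phi) tau 1 &
      {for tau, continuous (derive1n 2 phi)}].

Definition regular_slowly_varying phi :=
  [/\ slowly_varying phi, C2_on_pos phi,
      tau * derive1 (fun x => ln (phi x)) tau @[tau --> +oo] --> (0 : R) &
      tau ^+ 2 * derive1n 2 (fun x => ln (phi x)) tau @[tau --> +oo] --> (0 : R)].

Definition h_conv phi psi (tau : R) : R :=
  \int[mu]_(sigma in `[1, Num.sqrt tau]) (phi sigma * psi (tau / sigma) / sigma).

Definition m_sup phi (sigma : R) : \bar R :=
  ereal_sup [set (phi (tau / sigma) / phi tau)%:E | tau in `]sigma ^+ 2, +oo[].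

Definition pconv T s st (eta : R) : R :=
  T^-1 * \int[mu]_(lambda in `[0, T]) (s (eta - lambda) * st lambda).

Definition exp_weight p s (tau : R) : R := expR (tau / p) * s tau.

Definition s_tensor p T s st (eta : R) : R :=
  pconv T s st eta / p + derive1 (pconv T s st) eta.

Lemma exp_weight_right_continuous p s :
  continuous s -> right_continuous (exp_weight p s).
Proof.
move=> cs x; apply: cvg_at_right_filter; apply: cvgM; last exact: cs.
by apply: continuous_comp; [exact: mulrr_continuous|exact: continuous_expR].
Qed.

(* The function [exp_weight p s] packaged for [lebesgue_stieltjes_measure]. *)
Definition exp_weight_cumulative p s
    (cs : continuous s) (ms : nondecreasing (exp_weight p s)) :
    cumulative R R :=
  HB.pack (exp_weight p s)
    (isCumulative.Build R _ R (exp_weight p s) ms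
       (exp_weight_right_continuous (p := p) cs)).

(* The terms with [lam n = 0] vanish because [0 `^ (1 / p) = 0] for [p != 0]. *)
Definition s_star_series p st (lam : nat -> R) (tau : R) : nat -> R :=
  series (fun n => st (tau + ln (lam n)) * lam n `^ (1 / p)).

Definition s_star p st (lam : nat -> R) (tau : R) : R :=
  limn (s_star_series p st lam tau).

End Functions.

(* Main.v *)
(* The eigenvalues of [A (x) At] are the products [lam_i * mu_j], since the tensor
   products of eigenvectors form a complete orthogonal system.  Put [t = e^-y],
   [u_i = - ln lam_i], [v_j = - ln mu_j], and let [n] and [m] count the [u_i] and
   the [v_j] below a given level.  Splitting the pairs with [u_i + v_j < y] at
   [y / 2] gives
     [N = sum_(u_i < y/2) m (y - u_i) + sum_(v_j < y/2) n (y - v_j)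
          - n (y/2) * m (y/2)].
   In the first sum dominated convergence applies: [m_sup phit] bounds
   [phit (e^(y - u)) / phit (e^y)], and its integrability against [phi] makes the
   dominating series summable; the limit is [s_star].  The second sum is cut into
   blocks [k T <= v_j < (k + 1) T], on which [phi] and [phit] are nearly constant
   and the rest is, by periodicity, a Riemann-Stieltjes sum of [rho] against
   [rhot] over one period; the sum of [phit (e^(k T)) phi (e^(y - k T))] over the
   blocks is [h / T] up to a factor [1 + o(1)].  As the integral of [phit]
   diverges, this sum dominates [phi (e^y)] and [phi (e^(y/2)) phit (e^(y/2))], so
   that finitely many blocks and the product term are negligible.  The derivative
   of the periodic convolution is found by squeezing difference quotients between
   the same Riemann-Stieltjes sums, after an Abel summation. *)
From HB Require Import structures.
Require Import Defs.
From mathcomp Require Import all_boot all_order all_algebra.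
From mathcomp Require Import finmap sesquilinear complex.
From mathcomp Require Import all_classical all_reals all_analysis measurable_realfun.
From mathcomp Require Import ring lra zify.
Import Order.TTheory GRing.Theory Num.Theory.
Import numFieldNormedType.Exports.
Local Open Scope classical_set_scope.
Local Open Scope ring_scope.
Set Implicit Arguments.
Unset Strict Implicit.
Unset Printing Implicit Defensive.

(** * Hilbert spaces *)

(** The claimed equivalent is a sum of two positive terms, of sizes [block_conv] and [phit], neither
    of which is known to dominate. Each error is therefore kept relative to its own term, which
    requires [s_tensor] and [s_star] to be bounded away from zero: [s_star] is at least its first
    term, and [s_tensor] is positive because [rhot T = expR (T / p) * rhot 0] exceeds [rhot 0]. The
    Stieltjes integral enters the estimates only as a number [J y] between all lower and upper
    Riemann-Stieltjes sums. This one squeeze serves the block asymptotics, the derivative of the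
    convolution and the bounds on [s_tensor]. [m_sup phit] is a supremum over an uncountable family,
    possibly infinite at some points, so its values along the eigenvalues are not controlled by its
    integral. Its infima over unit windows of the logarithmic variable are, by comparison with step
    functions. Eigenvalue lists are identified through multiplicities: [mu > 0] occurs as often as
    the dimension of its eigenspace, so any eigensystem, in particular that of tensor products of
    eigenvectors, yields the counting function. *)

Section HilbertBasics.
Variables (R : realType) (H : hilbertType R).
Implicit Types (x y z u v : H) (c d : R[i]).

(** The norm of [H] takes values in [R[i]]; its real part gives access to suprema and linear
    arithmetic over [R]. *)
Definition rnorm x : R := complex.Re `|x|.

Lemma rnormE x : (rnorm x)%:C%C = `|x|.
Proof. by rewrite /rnorm RRe_real// ger0_real. Qed.

Lemma rnorm_ge0 x : 0 <= rnorm x.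
Proof. by rewrite -ler0c rnormE. Qed.

Lemma rnorm0 : rnorm 0 = 0.
Proof. by rewrite /rnorm normr0. Qed.

Lemma rnorm_eq0 x : (rnorm x == 0) = (x == 0).
Proof.
by rewrite -[RHS]normr_eq0 -rnormE -(inj_eq (@complexI R)).
Qed.

Lemma rnormD x y : rnorm (x + y) <= rnorm x + rnorm y.
Proof. by rewrite -lecR rmorphD/= !rnormE ler_normD. Qed.

Lemma rnormN x : rnorm (- x) = rnorm x.
Proof. by rewrite /rnorm normrN. Qed.

Lemma rnormB x y : rnorm (x - y) <= rnorm x + rnorm y.
Proof. by rewrite -(rnormN y) rnormD. Qed.

Lemma rnormBC x y : rnorm (x - y) = rnorm (y - x).
Proof. by rewrite -rnormN opprB. Qed.

Lemma rnormZ c x : (rnorm (c *: x))%:C%C = `|c| * (rnorm x)%:C%C.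
Proof. by rewrite !rnormE normrZ. Qed.

Lemma rnormZr (r : R) x : rnorm (r%:C%C *: x) = `|r| * rnorm x.
Proof.
apply: complexI; rewrite rnormZ rmorphM/=; congr (_ * _).
by rewrite normc_def/= expr0n addr0 sqrtr_sqr.
Qed.

Lemma rnorm_gt0 x : (0 < rnorm x) = (x != 0).
Proof. by rewrite lt_neqAle rnorm_ge0 eq_sym rnorm_eq0 andbT. Qed.

Lemma rnorm_normalize x : x != 0 -> rnorm ((rnorm x)^-1%:C%C *: x) = 1.
Proof.
rewrite -rnorm_gt0 => x0.
by rewrite rnormZr ger0_norm ?invr_ge0 ?rnorm_ge0// mulVf// gt_eqF.
Qed.

Lemma innerC x y : inner x y = (inner y x)^*%C.
Proof. by rewrite hermC mul1r. Qed.

Lemma inner_self x : inner x x = (rnorm x ^+ 2)%:C%C.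
Proof. by rewrite inner_norm -rnormE rmorphXn. Qed.

Lemma innerDl x y z : inner (x + y) z = inner x z + inner y z.
Proof. exact: linearDl. Qed.
Lemma innerBl x y z : inner (x - y) z = inner x z - inner y z.
Proof. exact: linearBl. Qed.
Lemma innerDr x y z : inner x (y + z) = inner x y + inner x z.
Proof. exact: linearDr. Qed.
Lemma innerBr x y z : inner x (y - z) = inner x y - inner x z.
Proof. exact: linearBr. Qed.
Lemma innerZl c x y : inner (c *: x) y = c * inner x y.
Proof. exact: linearZl_LR. Qed.
Lemma innerZr c x y : inner x (c *: y) = c^*%C * inner x y.
Proof. exact: linearZr_LR. Qed.
Lemma inner0l y : inner 0 y = 0. Proof. exact: linear0l. Qed.
Lemma inner0r y : inner y 0 = 0. Proof. exact: linear0r. Qed.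
Lemma inner_suml I (r : seq I) P (F : I -> H) y :
  inner (\sum_(i <- r | P i) F i) y = \sum_(i <- r | P i) inner (F i) y.
Proof.
apply: (big_morph (fun x => inner x y)) => [u v|]; first exact: innerDl.
exact: inner0l.
Qed.
Lemma inner_sumr I (r : seq I) P (F : I -> H) y :
  inner y (\sum_(i <- r | P i) F i) = \sum_(i <- r | P i) inner y (F i).
Proof.
apply: (big_morph (inner y)) => [u v|]; first exact: innerDr.
exact: inner0r.
Qed.

Lemma inner_eq0C x y : inner x y = 0 -> inner y x = 0.
Proof. by rewrite (innerC y x) => ->; rewrite conjc0. Qed.

(** Pythagoras for [x = w + a *: y] with [w] orthogonal to [y]; dropping [inner w w] leaves the
    inequality. *)
Lemma cauchy_schwarz x y : `|inner x y| <= (rnorm x * rnorm y)%:C%C.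
Proof.
have [->|y0] := eqVneq y 0.
  by rewrite inner0r normr0 rnorm0 mulr0 lexx.
have ny0 : 0 < rnorm y by rewrite rnorm_gt0.
rewrite -(@ler_pXn2r _ 2)// ?nnegrE//; last first.
  by rewrite ler0c mulr_ge0// rnorm_ge0.
pose a := inner x y / inner y y; pose w := x - a *: y.
have yy0 : inner y y != 0 by rewrite dnorm_eq0.
have wy : inner w y = 0.
  by rewrite /w innerBl innerZl /a mulrVK ?unitfE// subrr.
have : inner x x = inner w w + `|a| ^+ 2 * inner y y.
  have xE : x = w + a *: y by rewrite /w subrK.
  have yw := inner_eq0C wy; clearbody w; rewrite xE.
  rewrite innerDl !innerDr !innerZl !innerZr wy yw.
  by rewrite !mulr0 addr0 add0r sqr_normc mulrA.
rewrite /a normrM exprMn normfV exprVn !inner_self => e.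
have : `|inner x y| ^+ 2 / (rnorm y ^+ 2)%:C%C <= (rnorm x ^+ 2)%:C%C.
  rewrite e (_ : `|(rnorm y ^+ 2)%:C%C| = (rnorm y ^+ 2)%:C%C); last first.
    by rewrite ger0_norm// ler0c sqr_ge0.
  rewrite (expr2 (_%:C%C)) invfM -!mulrA mulVf ?mulr1 ?lerDr ?ler0c ?sqr_ge0//.
  by rewrite -inner_self.
rewrite ler_pdivrMr ?ltcR ?exprn_gt0// => h.
have -> : (rnorm x * rnorm y)%:C%C ^+ 2 = ((rnorm x * rnorm y) ^+ 2)%:C%C.
  by rewrite rmorphXn.
by rewrite exprMn rmorphM.
Qed.

Lemma inner_le (x y : H) (a b : R) : rnorm x <= a -> rnorm y <= b ->
  `|inner x y| <= (a * b)%:C%C.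
Proof.
move=> xa yb; apply: le_trans (cauchy_schwarz x y) _.
by rewrite lecR ler_pM// rnorm_ge0.
Qed.

Lemma normc_small (c : R[i]) :
  (forall e : R, 0 < e -> `|c| <= e%:C%C) -> c = 0.
Proof.
move=> h; apply/eqP; rewrite -normr_eq0; apply/eqP.
have -> : `|c| = (complex.Re `|c|)%:C%C by rewrite RRe_real// ger0_real.
have c0 : 0 <= complex.Re `|c| by rewrite -ler0c RRe_real// ger0_real.
congr (_%:C)%C; apply/eqP; rewrite eq_le c0 andbT.
apply/ler_addgt0Pr => e e0; rewrite add0r.
by rewrite -lecR RRe_real ?ger0_real// h.
Qed.

Lemma rnorm_small x : (forall e : R, 0 < e -> rnorm x <= e) -> x = 0.
Proof.
move=> h; apply/eqP; rewrite -rnorm_eq0 eq_le rnorm_ge0 andbT.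
by apply/ler_addgt0Pr => e e0; rewrite add0r h.
Qed.

Lemma dense_rnorm (D : set H) : dense D ->
  forall x (e : R), 0 < e -> exists2 y, D y & rnorm (x - y) < e.
Proof.
move=> dD x e e0.
have [|y [By Dy]] := dD (ball x e%:C%C) _ (@ball_open _ _ x e%:C%C).
  by exists x; apply: ballxx; rewrite ltcR.
exists y => //; move: By; rewrite -ball_normE/= -rnormE ltcR//.
Qed.

Lemma continuous_rnorm (B : {linear H -> H}) : continuous B ->
  exists2 C : R, 0 < C & forall x, rnorm (B x) <= C * rnorm x.
Proof.
move=> cB; have := cB 0 (ball (B 0) 1) (nbhsx_ballx _ _ ltr01).
rewrite linear0 => /nbhs_ballP[d d0 hd].
have dr : d = (complex.Re d)%:C%C by rewrite RRe_real// gtr0_real.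
move: hd d0; rewrite {}dr; set r := complex.Re d => hd; rewrite /= ltcR => r0.
have key y : rnorm y < r -> rnorm (B y) <= 1.
  move=> yr; have : ball 0 r%:C%C y.
    by rewrite -ball_normE/= sub0r normrN -rnormE ltcR.
  by move/hd; rewrite -ball_normE /preimage/= sub0r normrN -rnormE ltcR => /ltW.
exists (2 / r); first by rewrite divr_gt0.
move=> x; have [->|x0] := eqVneq x 0; first by rewrite linear0 rnorm0 mulr0.
have nx0 : 0 < rnorm x by rewrite rnorm_gt0.
have k0 : 0 <= r / 2 / rnorm x by rewrite divr_ge0 ?ltW// divr_gt0.
have h : rnorm ((r / 2 / rnorm x)%:C%C *: x) < r.
  have -> : rnorm ((r / 2 / rnorm x)%:C%C *: x) = r / 2.
    by rewrite rnormZr ger0_norm//; field; rewrite gt_eqF.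
  by lra.
have := key _ h; rewrite linearZ/= rnormZr ger0_norm// -ler_pdivlMl ?divr_gt0//.
by rewrite mulr1 invf_div invf_div mulrC -mulrA mulrC.
Qed.

End HilbertBasics.

(** * Spectral theory of compact operators *)

Section CompactSelfadjoint.
Variables (R : realType) (H : hilbertType R) (A : {linear H -> H}).
Hypotheses (Ac : compact_operator A) (Asa : selfadjoint A).
Hypothesis Age0 : nonnegative_operator A.

(** Compactness in the form used below: no subsequence is extracted, but arbitrarily late images
    come arbitrarily close to one point [y], a cluster point of the image filter in the compact
    closure. *)
Lemma compact_operator_cluster (x : nat -> H) :
  (forall n, rnorm (x n) <= 1) ->
  exists y, forall e : R, 0 < e -> forall N, exists2 n, (N <= n)%N &
    rnorm (A (x n) - y) < e.
Proof.
move=> x1; pose K := closure (A @` [set x : H | `|x| <= 1]).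
have cK : compact K by rewrite -precompactE.
pose F : set_system H := (A \o x) @ \oo.
have FK : F K.
  rewrite /F /nbhs/=; near=> n; apply: subset_closure.
  by exists (x n) => //=; rewrite -rnormE lecR.
have [y [_ Fy]] := cK F _ FK.
exists y => e e0 N.
have FN : F [set A (x n) | n in [set n | (N <= n)%N]].
  rewrite /F /nbhs/=; near=> n; exists n => //=.
  by near: n; exists N.
have By : nbhs y (ball y e%:C%C) by apply: nbhsx_ballx; rewrite ltcR.
have [z [[n /= Nn <-]]] := Fy _ _ FN By.
rewrite -ball_normE/= -rnormE ltcR rnormBC => yn.
by exists n.
Unshelve. all: by end_near.
Qed.

Lemma compact_operator_bounded :
  exists2 C : R, 0 < C & forall x, rnorm (A x) <= C * rnorm x.
Proof.
have [C hC] : exists C : R, forall x, rnorm x <= 1 -> rnorm (A x) <= C.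
  apply: contrapT => /forallNP h.
  have : forall n : nat, exists x, rnorm x <= 1 /\ n%:R < rnorm (A x).
    move=> n; have /existsNP[x /not_implyP[x1 /negP]] := h n%:R.
    by rewrite -ltNge; exists x.
  move=> /choice[x hx].
  have [n|y hy] := compact_operator_cluster (x := x).
    by have [] := hx n.
  (* An index this large forces [rnorm (A (x n)) > rnorm y + 1], which contradicts closeness to the
     cluster point. *)
  have [n Nn] := hy 1 ltr01 (Num.truncn (rnorm y + 1)).+1.
  have [_ nA] := hx n.
  have : rnorm (A (x n)) <= rnorm (A (x n) - y) + rnorm y.
    by rewrite -[X in rnorm X <= _](subrK y) rnormD.
  have : rnorm y + 1 < n%:R.
    apply: lt_le_trans (_ : _ < (Num.truncn (rnorm y + 1)).+1%:R) _.
      by rewrite truncnS_gt.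
    by rewrite ler_nat.
  by move=> *; lra.
exists (`|C| + 1); first by rewrite ltr_wpDl.
move=> x; have [->|x0] := eqVneq x 0; first by rewrite linear0 rnorm0 mulr0.
have nx0 : 0 < rnorm x by rewrite rnorm_gt0.
have := hC ((rnorm x)^-1%:C%C *: x).
rewrite rnorm_normalize// linearZ/= rnormZr ger0_norm ?invr_ge0 ?rnorm_ge0//.
move=> /(_ (lexx _)); rewrite ler_pdivrMl// mulrC => h.
apply: (le_trans h); rewrite ler_pM2r//.
by rewrite (le_trans (ler_norm _))// lerDl.
Qed.

Lemma rnormB_sqr (x y : H) :
  rnorm (x - y) ^+ 2 = rnorm x ^+ 2 + rnorm y ^+ 2 - 2 * complex.Re (inner x y).
Proof.
apply: complexI; rewrite -inner_self dnormB !inner_self.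
have -> : (inner x y)^* = (inner x y)^*%C by [].
have -> : inner x y + (inner x y)^*%C = (2 * complex.Re (inner x y))%:C%C.
  by rewrite addcJ rmorphM/= rmorph_nat.
by rewrite -rmorphD -rmorphB.
Qed.

(* The norm [al] of [A] on [S^perp] is approached along [x n]; a cluster point
   [y] of [A (x n)] satisfies [A (A y) = al ^ 2 y], hence [(A + al) y] is an
   eigenvector, nonzero because [A >= 0]. *)
Lemma top_eigenvector (S : set H) (c : R) (x0 : H) :
  (forall s, S s -> exists mu : R, A s = mu%:C%C *: s) ->
  0 <= c -> (forall s, S s -> inner x0 s = 0) ->
  c * rnorm x0 < rnorm (A x0) ->
  exists (w : H) (al : R), [/\ forall s, S s -> inner w s = 0, w != 0,
    c < al & A w = al%:C%C *: w].
Proof.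
move=> Seig c0 x0S x0c.
pose M := [set x : H | forall s, S s -> inner x s = 0].
(* The orthogonal complement of a set of eigenvectors is invariant under a symmetric operator, so
   the search for an eigenvector takes place inside [M]. *)
have MA x : M x -> M (A x).
  move=> Mx s Ss; have [mu e] := Seig s Ss.
  by rewrite Asa e innerZr Mx// mulr0.
have MZ (r : R[i]) x : M x -> M (r *: x).
  by move=> Mx s Ss; rewrite innerZl Mx// mulr0.
have [C C0 hC] := compact_operator_bounded.
pose V := [set rnorm (A x) | x in [set x | M x /\ rnorm x <= 1]].
have V0 : V 0.
  exists 0; rewrite ?linear0 ?rnorm0//; split; rewrite ?rnorm0//.
  by move=> s _; rewrite inner0l.
have supV : has_sup V.
  split; first by exists 0.
  exists C => _ [x [_ x1] <-]; apply: (le_trans (hC x)).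
  by rewrite ler_piMr// ltW.
pose al := sup V.
have alM x : M x -> rnorm (A x) <= al * rnorm x.
  move=> Mx; have [->|xn0] := eqVneq x 0; first by rewrite linear0 rnorm0 mulr0.
  have nx0 : 0 < rnorm x by rewrite rnorm_gt0.
  have : V (rnorm (A ((rnorm x)^-1%:C%C *: x))).
    exists ((rnorm x)^-1%:C%C *: x) => //; split; first exact: MZ.
    by rewrite rnorm_normalize.
  move=> /(sup_upper_bound supV).
  rewrite linearZ/= rnormZr ger0_norm ?invr_ge0 ?rnorm_ge0// -/al.
  by rewrite ler_pdivrMl// mulrC.
have nx0 : 0 < rnorm x0.
  rewrite lt_neqAle rnorm_ge0 eq_sym rnorm_eq0 andbT.
  by apply/negP => /eqP e; move: x0c; rewrite e linear0 rnorm0 mulr0 ltxx.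
have cal : c < al.
  by rewrite -(ltr_pM2r nx0); apply: (lt_le_trans x0c); exact: alM.
have al0 : 0 < al by apply: le_lt_trans cal.
have : forall n : nat, exists x, [/\ M x, rnorm x <= 1 &
    al - n.+1%:R^-1 < rnorm (A x)].
  move=> n; have n0 : 0 < n.+1%:R^-1 :> R by rewrite invr_gt0.
  have [_ [x [Mx x1] <-] h] := sup_adherent n0 supV.
  by exists x.
move=> /choice[x hx].
(* Expanding the square, with [inner (A (A z)) z = rnorm (A z) ^+ 2] by symmetry: a vector that
   almost attains [al] is almost an eigenvector of [A \o A] for [al ^+ 2]. *)
have est z : M z -> rnorm z <= 1 ->
    rnorm (A (A z) - (al ^+ 2)%:C%C *: z) ^+ 2
      <= al ^+ 2 * (al ^+ 2 - rnorm (A z) ^+ 2).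
  move=> Mz z1; rewrite rnormB_sqr rnormZr innerZr conjc_real Asa inner_self.
  rewrite -rmorphM/= exprMn ger0_norm ?sqr_ge0//.
  have h1 : rnorm (A (A z)) ^+ 2 <= al ^+ 2 * rnorm (A z) ^+ 2.
    rewrite -exprMn lerXn2r ?nnegrE ?rnorm_ge0 ?mulr_ge0 ?rnorm_ge0 ?(ltW al0)//.
    by apply: alM; exact: MA.
  have h2 : (al ^+ 2) ^+ 2 * rnorm z ^+ 2 <= (al ^+ 2) ^+ 2.
    by rewrite ler_piMr ?sqr_ge0// expr_le1// rnorm_ge0.
  rewrite mulrBr -expr2; lra.
have [n|y hy] := compact_operator_cluster (x := x); first by have [] := hx n.
have My : M y.
  move=> s Ss; apply: normc_small => e e0.
  have ns : 0 < rnorm s + 1 by rewrite ltr_wpDl// rnorm_ge0.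
  have [n _ hn] := hy (e / (rnorm s + 1)) (divr_gt0 e0 ns) 0%N.
  have [Mxn _ _] := hx n.
  have -> : inner y s = inner (y - A (x n)) s.
    by rewrite innerBl (MA _ Mxn s Ss) subr0.
  rewrite (_ : e = e / (rnorm s + 1) * (rnorm s + 1)); last first.
    by rewrite divfK// gt_eqF.
  by apply: inner_le; [rewrite rnormBC ltW|rewrite lerDl].
have bigN (d : R) : 0 < d -> exists N : nat, forall n, (N <= n)%N -> n.+1%:R^-1 < d.
  move=> d0; exists (Num.truncn d^-1) => n Nn.
  rewrite invf_plt ?posrE//.
  apply: (lt_le_trans (truncnS_gt d^-1)).
  by rewrite ler_nat.
(* [rnorm (A (x n))] exceeds [al - al / 4] and [A (x n)] is within [al / 4] of [y]. *)
have y0 : 0 < rnorm y.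
  have a4 : 0 < al / 4 by rewrite divr_gt0.
  have [N hN] := bigN _ a4.
  have [n Nn hn] := hy _ a4 N.
  have [_ _ h1] := hx n; have := hN _ Nn.
  have : rnorm (A (x n)) <= rnorm (A (x n) - y) + rnorm y.
    by rewrite -[X in rnorm X <= _](subrK y) rnormD.
  move: hn h1 a4; set eta := n.+1%:R^-1.
  generalize al eta (rnorm (A (x n) - y)) (rnorm (A (x n))) (rnorm y).
  by move=> *; lra.
have AAy : A (A y) = (al ^+ 2)%:C%C *: y.
  apply/eqP; rewrite -subr_eq0; apply/eqP; apply: rnorm_small => e e0.
  (* [d * D = e] is shared by the three summands of the decomposition below; the bound on [eta]
     comes from [al ^+ 2 * (al ^+ 2 - (al - eta) ^+ 2) <= 2 * al ^+ 3 * eta]. *)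
  pose D := C ^+ 2 + al ^+ 2 + C.
  have D0 : 0 < D by rewrite /D ltr_wpDl// addr_ge0// sqr_ge0.
  pose d := e / D; have d0 : 0 < d by rewrite divr_gt0.
  have g0 : 0 < d ^+ 2 / (2 * al ^+ 3).
    by rewrite divr_gt0 ?exprn_gt0// mulr_gt0// exprn_gt0.
  have [N1 hN1] := bigN _ g0.
  have [N2 hN2] := bigN _ al0.
  have [n Nn hn] := hy _ d0 (maxn N1 N2).
  have [Mx x1 ax] := hx n.
  have {}hN1 := hN1 n (leq_trans (leq_maxl _ _) Nn).
  have {}hN2 := hN2 n (leq_trans (leq_maxr _ _) Nn).
  move: ax hN1 hN2; set eta := n.+1%:R^-1 => ax hN1 hN2.
  have eta0 : 0 < eta by rewrite invr_gt0.
  have sm : rnorm (A (A (x n)) - (al ^+ 2)%:C%C *: x n) <= d.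
    rewrite -(@ler_pXn2r _ 2) ?nnegrE ?rnorm_ge0 ?(ltW d0)//.
    apply: (le_trans (est _ Mx x1)).
    move: hN1; rewrite ltr_pdivlMr ?mulr_gt0 ?exprn_gt0// => hN1.
    have : (al - eta) ^+ 2 <= rnorm (A (x n)) ^+ 2.
      by rewrite lerXn2r ?nnegrE ?rnorm_ge0 ?subr_ge0 ?(ltW hN2) ?(ltW ax).
    move=> h; apply: le_trans (_ : al ^+ 2 * (al ^+ 2 - (al - eta) ^+ 2) <= _).
      by rewrite ler_pM2l ?exprn_gt0// lerB.
    apply/ltW; apply: le_lt_trans hN1; rewrite -subr_ge0.
    rewrite (_ : _ - _ = al ^+ 2 * eta ^+ 2); last by ring.
    by rewrite mulr_ge0 ?sqr_ge0.
  pose a := A (x n).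
  have -> : A (A y) - (al ^+ 2)%:C%C *: y =
      A (A (y - a)) + A (A a - (al ^+ 2)%:C%C *: x n)
      + (al ^+ 2)%:C%C *: (a - y).
    have -> : A (A (y - a)) = A (A y) - A (A a) by rewrite !linearB.
    have -> : A (A a - (al ^+ 2)%:C%C *: x n) = A (A a) - (al ^+ 2)%:C%C *: a.
      by rewrite linearB linearZ.
    by rewrite scalerBr !addrA !subrK.
  have t1 : rnorm (A (A (y - a))) <= C ^+ 2 * d.
    apply: (le_trans (hC _)); rewrite expr2 -mulrA ler_pM2l//.
    apply: (le_trans (hC _)); rewrite ler_pM2l// rnormBC; exact: ltW.
  have t2 : rnorm (A (A a - (al ^+ 2)%:C%C *: x n)) <= C * d.
    by apply: (le_trans (hC _)); rewrite ler_pM2l.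
  have t3 : rnorm ((al ^+ 2)%:C%C *: (a - y)) <= al ^+ 2 * d.
    rewrite rnormZr ger0_norm ?sqr_ge0// ler_pM2l ?exprn_gt0//; exact: ltW.
  have eD : e = C ^+ 2 * d + C * d + al ^+ 2 * d.
    have dD : d * D = e by rewrite divfK// gt_eqF.
    by rewrite -dD /D; ring.
  rewrite eD; apply: (le_trans (rnormD _ _)); apply: lerD => //.
  by apply: (le_trans (rnormD _ _)); exact: lerD.
exists (A y + al%:C%C *: y), al; split => //.
- by move=> s Ss; rewrite innerDl innerZl (MA _ My)// My// mulr0 addr0.
- apply/eqP => w0.
  have := Age0 y; rewrite (_ : A y = - (al%:C%C *: y)); last first.
    by apply/eqP; rewrite -addr_eq0 w0.
  rewrite -scaleNr innerZl inner_self -rmorphN/= -rmorphM/= ler0c.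
  by rewrite mulNr oppr_ge0 leNgt mulr_gt0// exprn_gt0.
- rewrite linearD/= linearZ/= AAy scalerDr addrC; congr (_ + _).
  by rewrite scalerA -rmorphM/= expr2.
Qed.

End CompactSelfadjoint.

(** * Orthonormal eigenvectors with positive eigenvalues, complete up to the kernel *)

Section Eigensystem.
Variables (R : realType) (K : hilbertType R) (I : choiceType).

(** The index set [D] lets one notion cover finite and infinite spectra, and families indexed by
    [nat], by pairs or by the vectors themselves. Completeness is taken modulo the kernel: a vector
    orthogonal to all [e i] is annihilated by [B]. *)
Record eigensystem (B : {linear K -> K}) (D : set I) (e : I -> K) (a : I -> R) :
    Prop := Eigensystem {
  eigensystem_sa : selfadjoint B;
  eigensystem_norm : forall i, D i -> inner (e i) (e i) = 1;
  eigensystem_orth : forall i j, D i -> D j -> i != j -> inner (e i) (e j) = 0;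
  eigensystem_eig : forall i, D i -> B (e i) = (a i)%:C%C *: e i;
  eigensystem_gt0 : forall i, D i -> 0 < a i;
  eigensystem_fin : forall t : R, 0 < t -> finite_set [set i | D i /\ t < a i];
  eigensystem_total :
    forall x, (forall i, D i -> inner x (e i) = 0) -> B x = 0 }.

Variables (B : {linear K -> K}) (D : set I) (e : I -> K) (a : I -> R).
Hypothesis Ees : eigensystem B D e a.

Lemma inner_eigvec (mu : R) x i : B x = mu%:C%C *: x -> D i -> a i != mu ->
  inner x (e i) = 0.
Proof.
move=> Bx Di aimu; apply/eqP.
have : mu%:C%C * inner x (e i) = (a i)%:C%C * inner x (e i).
  rewrite -innerZl -Bx (eigensystem_sa Ees) (eigensystem_eig Ees)// innerZr.
  by rewrite conjc_real.
move/eqP; rewrite -subr_eq0 -mulrBl -rmorphB mulf_eq0 => /orP[|//].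
by rewrite -[0]/(0%:C%C) (inj_eq (@complexI R)) subr_eq0 eq_sym (negbTE aimu).
Qed.

Lemma finite_eigenvalue_fiber (mu : R) : 0 < mu ->
  finite_set [set i | D i /\ a i = mu].
Proof.
move=> mu0; have m2 : 0 < mu / 2 by rewrite divr_gt0.
apply: sub_finite_set (eigensystem_fin Ees m2) => i /= [Di ->]; split => //.
by rewrite ltr_pdivrMr// ltr_pMr// ltr1n.
Qed.

Section Expansion.
Variable F : {fset I}.
Hypothesis FD : [set` F] `<=` D.
Let k := #|` F|.
Let v (i : 'I_k) : K := e (tnth (in_tuple F) i).

Let vF i : tnth (in_tuple F) i \in F. Proof. exact: mem_tnth. Qed.
Let vD i : D (tnth (in_tuple F) i). Proof. exact/FD/vF. Qed.

Lemma inner_expansion (c : 'I_k -> R[i]) j :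
  inner (\sum_(i < k) c i *: v i) (v j) = c j.
Proof.
rewrite inner_suml (bigD1 j)//= innerZl (eigensystem_norm Ees)// mulr1.
rewrite big1 ?addr0// => i ij; rewrite innerZl (eigensystem_orth Ees) ?mulr0//.
have inj : injective (tnth (in_tuple F)) by apply/tuple_uniqP; exact: fset_uniq.
by rewrite (inj_eq inj).
Qed.

Lemma inner_expansion_notin (c : 'I_k -> R[i]) j : D j -> j \notin F ->
  inner (\sum_(i < k) c i *: v i) (e j) = 0.
Proof.
move=> Dj jF; rewrite inner_suml big1// => i _.
rewrite innerZl (eigensystem_orth Ees) ?mulr0//.
by apply: contra jF => /eqP <-; exact: vF.
Qed.

Lemma mem_expansion j : j \in F -> exists i : 'I_k, j = tnth (in_tuple F) i.
Proof. by move=> jF; apply/tnthP. Qed.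

Lemma residual_orth x i : i \in F ->
  inner (x - \sum_(i < k) inner x (v i) *: v i) (e i) = 0.
Proof.
by move=> /mem_expansion[j ->]; rewrite innerBl inner_expansion subrr.
Qed.

End Expansion.

Definition proj_fset (F : {fset I}) (x : K) : K :=
  \sum_(i < #|` F|) inner x (e (tnth (in_tuple F) i)) *: e (tnth (in_tuple F) i).

(** Subtracting its projection from an eigenvector leaves a vector orthogonal to every [e i]: to
    those in the fiber by construction, to the others because the eigenvalues differ. It lies in the
    kernel and in the eigenspace of [mu > 0], hence is zero. *)
Lemma has_dim_eigspace (mu : R) : 0 < mu ->
  has_dim (eigspace B mu) #|` fset_set [set i | D i /\ a i = mu]|.
Proof.
move=> mu0; set F := fset_set _.
have FE : [set` F] = [set i | D i /\ a i = mu].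
  by rewrite fset_setK//; exact: finite_eigenvalue_fiber.
have FD : [set` F] `<=` D by rewrite FE => i [].
have Fmu i : i \in F -> a i = mu.
  by move=> iF; have : [set` F] i := iF; rewrite FE => -[].
have tF i : tnth (in_tuple F) i \in F by exact: mem_tnth.
have eigE i : i \in F -> eigspace B mu (e i).
  by move=> iF; rewrite /eigspace/= (eigensystem_eig Ees (FD _ iF)) Fmu.
exists (fun i => e (tnth (in_tuple F) i)); split; first by move=> i; exact: eigE.
move=> x Bx; exists [ffun i => inner x (e (tnth (in_tuple F) i))]; split.
  pose y := x - proj_fset F x.
  have By : B y = mu%:C%C *: y.
    rewrite /y linearB/= Bx scalerBr; congr (_ - _).
    rewrite linear_sum/= scaler_sumr; apply: eq_bigr => i _.
    by rewrite linearZ/= eigE// !scalerA mulrC.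
  have y0 : B y = 0.
    apply: (eigensystem_total Ees) => i Di.
    have [iF|iF] := boolP (i \in F); first exact: residual_orth.
    rewrite innerBl inner_expansion_notin// subr0.
    apply: (inner_eigvec Bx) => //; apply: contra iF => /eqP ai.
    by have : [set` F] i by rewrite FE.
  have : y = 0.
    move/eqP: By; rewrite y0 eq_sym scaler_eq0 => /orP[|/eqP//].
    by rewrite -[0]/(0%:C%C) (inj_eq (@complexI R)) gt_eqF.
  move/eqP; rewrite subr_eq0 => /eqP{1}->.
  by apply: eq_bigr => i _; rewrite ffunE.
move=> c xE; apply/ffunP => i; rewrite ffunE [in LHS]xE.
exact: inner_expansion.
Qed.

End Eigensystem.

Section Dimension.
Variables (R : realType) (H : hilbertType R) (E : set H).

(** Each basis is expressed in the other; uniqueness of coordinates makes the product of the two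
    coefficient matrices the identity, which bounds [m] by [n]. *)
Lemma has_dim_le m n : has_dim E m -> has_dim E n -> (m <= n)%N.
Proof.
move=> [e [Ee eP]] [f [Ef fP]].
have /choice[P hP] : forall i : 'I_m, exists c : {ffun 'I_n -> R[i]},
    e i = \sum_(j < n) c j *: f j.
  by move=> i; have [c [h _]] := fP _ (Ee i); exists c.
have /choice[Q hQ] : forall i : 'I_n, exists c : {ffun 'I_m -> R[i]},
    f i = \sum_(j < m) c j *: e j.
  by move=> i; have [c [h _]] := eP _ (Ef i); exists c.
pose MP := \matrix_(i < m, j < n) P i j.
pose MQ := \matrix_(i < n, j < m) Q i j.
apply: (@mulmx1_min _ _ _ MP MQ); apply/matrixP => i l; rewrite !mxE.
have [c [_ uc]] := eP _ (Ee i).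
have c1 : e i = \sum_(j < m) [ffun j => (MP *m MQ) i j] j *: e j.
  rewrite [LHS]hP; under eq_bigr do rewrite hQ scaler_sumr.
  rewrite exchange_big/=; apply: eq_bigr => j _.
  rewrite ffunE mxE scaler_suml; apply: eq_bigr => k _.
  by rewrite !mxE scalerA.
have c2 : e i = \sum_(j < m) [ffun j => (i == j)%:R] j *: e j.
  rewrite (bigD1 i)//= ffunE eqxx scale1r big1 ?addr0// => j ji.
  by rewrite ffunE eq_sym (negbTE ji) scale0r.
have := uc _ c1; rewrite (uc _ c2) => /ffunP/(_ l).
by rewrite !ffunE mxE.
Qed.

Lemma has_dim_uniq m n : has_dim E m -> has_dim E n -> m = n.
Proof. by move=> hm hn; apply/eqP; rewrite eqn_leq !has_dim_le. Qed.

End Dimension.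

Section FiberBijection.
Variables (V : Type) (I : Type) (J : pointedType).
Variables (D : set I) (E : set J) (a : I -> V) (b : J -> V).

(** Bijections chosen fiber by fiber glue together, which turns equality of multiplicities into a
    reindexing that preserves values. *)
Lemma fiber_bij :
  (forall v, [set i | D i /\ a i = v] #= [set j | E j /\ b j = v])%card ->
  exists2 g : I -> J, set_bij D E g & forall i, D i -> b (g i) = a i.
Proof.
move=> h; have /choice[g hg] : forall v, exists g : I -> J,
    set_bij [set i | D i /\ a i = v] [set j | E j /\ b j = v] g.
  by move=> v; exact/card_set_bijP.
have gE i : D i -> E (g (a i) i) /\ b (g (a i) i) = a i.
  by move=> Di; have [+ _ _] := hg (a i); apply.
exists (fun i => g (a i) i); last by move=> i /gE[].
split.
- by move=> i /= /gE[].
- move=> i j /[!inE] Di Dj e; have ab : a i = a j.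
    by have [_ <-] := gE _ Di; rewrite e; have [_ ->] := gE _ Dj.
  have [_ + _] := hg (a i); apply; rewrite ?inE//=; last by rewrite e ab.
- move=> j Ej; have [_ _ sj] := hg (b j).
  have [i [Di ai] <-] := sj j (conj Ej erefl).
  by exists i => //; rewrite ai.
Qed.

End FiberBijection.

(** * Decreasing rearrangement of a family accumulating only at zero *)

Section Sorting.
Variables (R : realType) (I : choiceType) (D : set I) (a : I -> R).
Hypothesis fin : forall t : R, 0 < t -> finite_set [set i | D i /\ t < a i].

Definition count_gt (t : R) : nat := #|` fset_set [set i | D i /\ t < a i]|.

Lemma count_gt_gap (t t' : R) : 0 < t -> t <= t' ->
  (forall i, D i -> t < a i -> t' < a i) -> count_gt t' = count_gt t.
Proof.
move=> t0 tt' gap; congr (#|` fset_set _ |).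
apply/seteqP; split => i /= [Di ai]; split => //; last exact: gap.
exact: le_lt_trans ai.
Qed.

Lemma le_count_gt (t t' : R) : 0 < t -> t <= t' -> (count_gt t' <= count_gt t)%N.
Proof.
move=> t0 tt'; have t'0 : 0 < t' by exact: lt_le_trans tt'.
apply/fsubset_leq_card; rewrite -fset_set_sub; [|exact: fin|exact: fin].
by move=> i /= [Di]; split => //; exact: le_lt_trans tt' _.
Qed.

Lemma gap_above (t : R) : 0 < t ->
  exists2 t', t < t' & forall i, D i -> t < a i -> t' <= a i.
Proof.
move=> t0; pose F := fset_set [set i | D i /\ t < a i].
have FE : [set` F] = [set i | D i /\ t < a i] by rewrite fset_setK//; exact: fin.
exists (\big[Order.min/t + 1]_(i <- F) a i).
  rewrite big_seq; elim/big_ind : _ => [|x y xt yt|i iF].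
  - by rewrite ltrDl.
  - by rewrite lt_min xt.
  - by have : [set` F] i by []; rewrite FE => -[].
move=> i Di ti; apply: ge_bigmin_seq => //.
by have : [set` F] i by rewrite FE.
Qed.

(** Above [mu / 2] there are finitely many values; the largest of them below [mu], or [mu / 2]
    itself, leaves a gap. *)
Lemma gap_below (mu : R) : 0 < mu ->
  exists t, [/\ 0 < t, t < mu & forall i, D i -> t < a i -> mu <= a i].
Proof.
move=> mu0; have m2 : 0 < mu / 2 by rewrite divr_gt0.
pose F := fset_set [set i | D i /\ mu / 2 < a i].
have FE : [set` F] = [set i | D i /\ mu / 2 < a i].
  by rewrite fset_setK//; exact: fin.
pose t := \big[Order.max/mu / 2]_(i <- F | a i < mu) a i.
have tge : mu / 2 <= t by exact: bigmax_ge_id.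
exists t; split.
- exact: lt_le_trans tge.
- apply: bigmax_lt => //; by rewrite ltr_pdivrMr// ltr_pMr// ltr1n.
move=> i Di ti; rewrite leNgt; apply/negP => aimu.
have iF : i \in F.
  have : [set` F] i by rewrite FE; split => //; exact: le_lt_trans ti.
  by [].
have : a i <= t by exact: (@le_bigmax_seq _ _ _ _ (mu / 2) i (fun i => a i < mu) a).
by rewrite leNgt ti.
Qed.

Lemma count_gt_eq0 : exists2 t : R, 0 < t & count_gt t = 0%N.
Proof.
pose F := fset_set [set i | D i /\ 1 < a i].
have FE : [set` F] = [set i | D i /\ 1 < a i] by rewrite fset_setK//; exact: fin.
pose t := \big[Order.max/1]_(i <- F) a i.
have t1 : 1 <= t by exact: bigmax_ge_id.
exists t; first by rewrite (lt_le_trans _ t1).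
rewrite /count_gt (_ : [set _ | _] = set0) ?fset_set0 ?cardfs0//.
apply/seteqP; split => // i [Di ti].
have iF : i \in F.
  have : [set` F] i by rewrite FE; split => //; exact: le_lt_trans ti.
  by [].
have : a i <= t by exact: (@le_bigmax_seq _ _ _ _ 1 i xpredT a).
by rewrite leNgt ti.
Qed.

Lemma card_fiber (t mu : R) : 0 < t -> t < mu ->
  (forall i, D i -> t < a i -> mu <= a i) ->
  ([set i | D i /\ a i = mu] #= `I_(count_gt t - count_gt mu))%card.
Proof.
move=> t0 tmu gap; have mu0 : 0 < mu by exact: lt_trans tmu.
have fmu := fin mu0; have ft := fin t0.
have -> : [set i | D i /\ a i = mu] =
    [set i | D i /\ t < a i] `\` [set i | D i /\ mu < a i].
  apply/seteqP; split => i /=.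
    by move=> [Di ->]; split => //; rewrite ltxx => -[].
  move=> [[Di tai] nai]; split => //; apply/eqP; rewrite eq_le gap// andbT.
  by rewrite leNgt; apply/negP => ?; apply: nai.
rewrite -[X in (X #= _)%card]fset_setK; last exact: finite_setD.
apply/card_eq_fsetP; rewrite fset_setD// cardfsDS//.
rewrite -fset_set_sub//.
by move=> i /= [Di]; split => //; exact: lt_trans tmu _.
Qed.

(** [lam n] is the supremum of the levels exceeded by more than [n] members of the family, with 0
    adjoined to produce the padding. It is a generalized inverse of [count_gt] ([lam_gt]), so the
    indices with [lam n = mu] run from [count_gt mu] to [count_gt t] for any [t] in the gap below
    [mu]. *)
Lemma sorted_values : exists lam : nat -> R,
  [/\ nonincreasing_seq lam, forall n, 0 <= lam n &
      forall mu : R, 0 < mu ->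
        ([set n | lam n = mu] #= [set i | D i /\ a i = mu])%card].
Proof.
pose V n := [set t | t = 0 \/ (0 < t /\ (n < count_gt t)%N)].
have [M M0 cM] := count_gt_eq0.
have supV n : has_sup (V n).
  split; first by exists 0; left.
  exists M => t [->|[t0 nt]]; first exact: ltW.
  rewrite leNgt; apply/negP => Mt; move: nt.
  by rewrite ltnNge (leq_trans (le_count_gt M0 (ltW Mt)))// cM.
pose lam n := sup (V n).
have lam_gt n t : 0 < t -> (t < lam n) = (n < count_gt t)%N.
  move=> t0; apply/idP/idP => [|nt].
    move=> /(sup_gt (proj1 (supV n)))[u [->|[u0 nu]] tu].
      by move: tu; rewrite ltNge ltW.
    exact: (leq_trans nu (le_count_gt t0 (ltW tu))).
  (* The count is constant just to the right of [t], so some level strictly above [t] belongs to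
     [V n]; this makes the inequality [t < lam n] strict. *)
  have [t' tt' gap] := gap_above t0.
  have mid := midf_lt tt'.
  have t2 : 0 < (t + t') / 2 by apply: lt_trans mid.1.
  apply: (lt_le_trans mid.1); apply: sup_upper_bound => //; right; split => //.
  rewrite (count_gt_gap t0) ?(ltW mid.1)// => i Di ti.
  by apply: (lt_le_trans mid.2); exact: gap.
exists lam; split.
- apply/nonincreasing_seqP => n; apply: ge_sup; first by exists 0; left.
  move=> t Vt; apply: sup_upper_bound => //.
  by case: Vt => [->|[t0 nt]]; [left|right; split => //; exact: ltnW].
- by move=> n; apply: sup_upper_bound => //; left.
move=> mu mu0; have [t [t0 tmu gap]] := gap_below mu0.
have h := card_fiber t0 tmu gap.
rewrite (card_eqr h).
have -> : [set n | lam n = mu] = `I_(count_gt t) `\` `I_(count_gt mu).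
  apply/seteqP; split => n /=.
    by move=> e; rewrite -!lam_gt// e ltxx; split.
  move=> [nt /negP nmu]; apply/eqP; rewrite eq_le [_ <= mu]leNgt lam_gt// nmu/=.
  rewrite leNgt; apply/negP => lmu.
  have tl : t < lam n by rewrite lam_gt.
  have mid := midf_lt lmu.
  have u0 : 0 < (lam n + mu) / 2.
    by apply: (lt_trans t0); apply: (lt_trans tl); exact: mid.1.
  have : (n < count_gt ((lam n + mu) / 2))%N.
    rewrite (count_gt_gap t0)// ?(ltW (lt_trans tl mid.1))// => i Di ti.
    by apply: (lt_le_trans mid.2); exact: gap.
  by rewrite -lam_gt// ltNge (ltW mid.1).
have II : `I_(count_gt mu) `<=` `I_(count_gt t).
  by move=> n /= nmu; apply: (leq_trans nmu); exact: le_count_gt (ltW tmu).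
rewrite -[X in (X #= _)%card]fset_setK; last by apply: finite_setD.
apply/card_eq_fsetP; rewrite fset_setD// cardfsDS; last by rewrite -fset_set_sub.
by rewrite !(card_fset_set (card_eqxx _)).
Qed.

End Sorting.

Section Spectrum.
Variables (R : realType) (K : hilbertType R) (I : choiceType).
Variables (B : {linear K -> K}) (D : set I) (e : I -> K) (a : I -> R).
Hypothesis Ees : eigensystem B D e a.

(** The sorted values of an eigensystem are a witness, so the [xget] that defines [eigenvalues] does
    not return its default. *)
Lemma eigenvaluesP : is_eigenvalue_seq B (eigenvalues B).
Proof.
have [lam [l1 l2 l3]] := sorted_values (eigensystem_fin Ees).
suff h : [set lam | is_eigenvalue_seq B lam] lam by exact: (xgetPex _ (ex_intro _ lam h)).
split => // mu mu0; exists #|` fset_set [set i | D i /\ a i = mu]|.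
split; last exact: (has_dim_eigspace Ees mu0).
rewrite (card_eql (l3 mu mu0)).
rewrite -[X in (X #= _)%card]fset_setK; last exact: (finite_eigenvalue_fiber Ees).
exact/card_eq_fsetP.
Qed.

Lemma eigenvalues_ge0 n : 0 <= eigenvalues B n.
Proof. by have [_ h _] := eigenvaluesP. Qed.

Lemma eigenvalues_nonincr : nonincreasing_seq (eigenvalues B).
Proof. by have [] := eigenvaluesP. Qed.

(** Both cardinals are the dimension of the same eigenspace. Hence the eigenvalue list can be read
    off from any eigensystem, however it was obtained. *)
Lemma eigenvalues_fiber (mu : R) : 0 < mu ->
  ([set n | eigenvalues B n = mu] #= [set i | D i /\ a i = mu])%card.
Proof.
move=> mu0; have [_ _ h] := eigenvaluesP; have [k [hk dk]] := h _ mu0.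
have dk' := has_dim_eigspace Ees mu0.
rewrite (card_eql hk) card_eq_sym.
rewrite -[X in (X #= _)%card]fset_setK; last exact: (finite_eigenvalue_fiber Ees).
by apply/card_eq_fsetP; exact: has_dim_uniq dk' dk.
Qed.

Lemma card_eigenvalues_gt (t : R) : 0 < t ->
  ([set n | t < eigenvalues B n] #= [set i | D i /\ t < a i])%card.
Proof.
move=> t0; rewrite card_eq_sym.
have [|g hg _] := @fiber_bij R I nat [set i | D i /\ t < a i]
   [set n | t < eigenvalues B n] a (eigenvalues B); last first.
  by apply/card_set_bijP; exists g.
move=> mu; have [tmu|tmu] := ltP t mu.
  have := eigenvalues_fiber (lt_trans t0 tmu); rewrite card_eq_sym.
  congr (_ #= _)%card; apply/seteqP; split => i /=.
  - by move=> [Di ai]; rewrite ai.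
  - by move=> [[Di _] ai].
  - by move=> ->.
  - by case.
rewrite (_ : [set i | _] = set0); last first.
  by apply/seteqP; split => // i [/= [_ +] ai]; rewrite ai ltNge tmu.
rewrite (_ : [set i | _] = set0)// -subset0 => n [/= + ln].
by rewrite ln ltNge tmu.
Qed.

Lemma finite_eigenvalues_gt (t : R) : 0 < t ->
  finite_set [set n | t < eigenvalues B n].
Proof.
move=> t0; have := card_eigenvalues_gt t0; rewrite card_eq_le => /andP[h _].
exact: card_le_finite h (eigensystem_fin Ees t0).
Qed.

Lemma spectral_countE (t : R) : 0 < t ->
  [set n | t < eigenvalues B n] = `I_(spectral_count B t).
Proof.
move=> t0; set X := [set n | _]; have fX : finite_set X by exact: finite_eigenvalues_gt.
have down m n : (m <= n)%N -> X n -> X m.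
  by move=> mn; rewrite /X/= => /lt_le_trans; apply; exact: eigenvalues_nonincr.
have [N XN] : exists N, X = `I_N.
  have [N nXN] : exists N, ~ X N.
    apply: contrapT => /forallNP h; apply: infinite_nat.
    by apply: sub_finite_set fX => n _; exact: contrapT (h n).
  have exN : exists n, `[< ~ X n >] by exists N; exact/asboolP.
  case: (ex_minnP exN) => M /asboolP nXM Mmin; exists M.
  apply/seteqP; split => n /=.
    by move=> Xn; rewrite ltnNge; apply/negP => Mn; apply: nXM; exact: down Mn Xn.
  move=> nM; apply: contrapT => nXn.
  by have := Mmin n (introT (asboolP _) nXn); rewrite leqNgt nM.
by rewrite XN /spectral_count -/X XN (card_fset_set (card_eqxx _)).
Qed.

Lemma spectral_count_gt (t : R) n : 0 < t ->
  (n < spectral_count B t)%N = (t < eigenvalues B n).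
Proof.
move=> t0; have h := spectral_countE t0.
by apply/idP/idP => [?|?]; [have : [set n | t < eigenvalues B n] n by rewrite h|
  have : `I_(spectral_count B t) n by rewrite -h].
Qed.

Lemma spectral_count_card (t : R) : 0 < t ->
  ([set i | D i /\ t < a i] #= `I_(spectral_count B t))%card.
Proof.
by move=> t0; rewrite -spectral_countE// card_eq_sym card_eigenvalues_gt.
Qed.

Lemma eigensystem_nat : exists e' : nat -> K,
  eigensystem B [set n | 0 < eigenvalues B n] e' (eigenvalues B).
Proof.
(* [fiber_bij] maps into a pointed type, so an empty [I] is treated apart; in that case no
   eigenvalue is positive. *)
case: (pselect (exists i0 : I, True)) => [[i0 _]|noI]; last first.
  have noD n : ~ 0 < eigenvalues B n.
    move=> n0; have := eigenvalues_fiber n0.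
    rewrite (_ : [set i | D i /\ _] = set0); last first.
      by apply/seteqP; split => // i _; case: noI; exists i.
    by rewrite card_eq0 => /eqP/seteqP[/(_ n erefl)].
  exists (fun=> 0); split => //=; try by move=> n /noD.
  - exact: (eigensystem_sa Ees).
  - by move=> n m /noD.
  - by move=> t t0; rewrite (_ : [set _ | _] = set0)// -subset0 => n [/noD].
  - by move=> x _; apply: (eigensystem_total Ees) => i; case: noI; exists i.
pose IP : pointedType := HB.pack_for pointedType I (isPointed.Build I i0).
have [|g [gD ginj gsurj] ga] := @fiber_bij R nat IP
  [set n | 0 < eigenvalues B n] D (eigenvalues B) a.
  move=> mu; have [mu0|mu0] := ltP 0 mu.
    have := eigenvalues_fiber mu0; congr (_ #= _)%card.
    by apply/seteqP; split => n /= [] // ->.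
  rewrite (_ : [set i | _] = set0); last first.
    by apply/seteqP; split => // n [/= + ln]; rewrite ln ltNge mu0.
  rewrite (_ : [set i | _] = set0)// -subset0 => i [Di ai].
  by have := eigensystem_gt0 Ees Di; rewrite ai ltNge mu0.
exists (fun n => e (g n)); split => /=.
- exact: (eigensystem_sa Ees).
- by move=> n n0; apply: (eigensystem_norm Ees); exact: gD.
- move=> n m n0 m0 nm; apply: (eigensystem_orth Ees); [exact: gD|exact: gD|].
  by apply: contra nm => /eqP/ginj ->//; rewrite inE.
- by move=> n n0; rewrite (eigensystem_eig Ees) ?ga//; exact: gD.
- by [].
- by move=> t t0; apply: sub_finite_set (finite_eigenvalues_gt t0) => n [].
- move=> x xo; apply: (eigensystem_total Ees) => i /gsurj[n n0 <-].
  exact: xo.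
Qed.

End Spectrum.

Section CompactEigensystem.
Variables (R : realType) (H : hilbertType R) (A : {linear H -> H}).
Hypotheses (Ac : compact_operator A) (Asa : selfadjoint A).
Hypothesis Age0 : nonnegative_operator A.

Let orthosys : set (set H) := [set S |
  (forall x, S x -> rnorm x = 1 /\
     exists mu : R, 0 < mu /\ A x = mu%:C%C *: x) /\
  (forall x y, S x -> S y -> x != y -> inner x y = 0)].

(** Zorn's lemma gives a maximal orthonormal set of eigenvectors with positive eigenvalues, indexed
    by itself. Were some [x] orthogonal to it with [A x != 0], [top_eigenvector] with [c = 0] would
    supply one more. *)
Lemma compact_eigensystem : exists (D : set H) (a : H -> R), eigensystem A D id a.
Proof.
have [F FP tF|S [[S1 So] Smax]] := @Zorn_bigcup _ orthosys.
  split; first by move=> x [X FX Xx]; have [+ _] := FP _ FX; apply.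
  move=> x y [X FX Xx] [Y FY Yy].
  have [XY|YX] := tF _ _ FX FY.
    by have [_ +] := FP _ FY; apply => //; exact: XY.
  by have [_ +] := FP _ FX; apply => //; exact: YX.
have ex x : exists mu : R, S x -> 0 < mu /\ A x = mu%:C%C *: x.
  have [Sx|nSx] := pselect (S x); last by exists 0.
  by have [_ [mu h]] := S1 _ Sx; exists mu.
have [a ha] := choice ex.
exists S, a; split => //.
- by move=> x Sx; rewrite inner_self; have [-> _] := S1 _ Sx; rewrite expr1n.
- by move=> x Sx; have [] := ha x Sx.
- by move=> x Sx; have [] := ha x Sx.
(* Infinitely many orthonormal eigenvectors with eigenvalues above [t] would have images at mutual
   distance at least [t], while two of these images lie close to a common cluster point. *)
- move=> t t0; apply: contrapT => /infiniteP/pcard_leP[f].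
  have fD n : S (f n) /\ t < a (f n) by exact: (@funS _ _ _ _ f).
  have [n|y hy] := compact_operator_cluster Ac (x := f).
    by have [/S1[-> _]] := fD n.
  have t2 : 0 < t / 2 by rewrite divr_gt0.
  have [n _ hn] := hy _ t2 0%N.
  have [m nm hm] := hy _ t2 n.+1.
  have fnm : f n != f m.
    apply/eqP => /(@inj _ _ _ f); rewrite !inE/= => /(_ I I) e.
    by move: nm; rewrite e ltnn.
  have : rnorm (A (f n) - A (f m)) < t.
    have -> : A (f n) - A (f m) = (A (f n) - y) - (A (f m) - y).
      by rewrite opprB addrA subrK.
    by apply: le_lt_trans (rnormB _ _) _; lra.
  apply/negP; rewrite -leNgt.
  have [Sn tn] := fD n; have [Sm tm] := fD m.
  have [_ An] := ha _ Sn; have [_ Am] := ha _ Sm.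
  have [n1 _] := S1 _ Sn; have [m1 _] := S1 _ Sm.
  rewrite -(@ler_pXn2r _ 2) ?nnegrE ?rnorm_ge0 ?(ltW t0)//.
  rewrite rnormB_sqr An Am !rnormZr innerZl innerZr So// !mulr0 subr0.
  rewrite n1 m1 !mulr1 !real_normK ?num_real//.
  rewrite -[t ^+ 2]addr0 lerD ?sqr_ge0// lerXn2r ?nnegrE ?(ltW t0) ?(ltW tn)//.
  exact: ltW (lt_trans t0 tn).
- move=> x xS; apply/eqP; rewrite -rnorm_eq0; apply/negP => /negP Ax0.
  have Apos : 0 * rnorm x < rnorm (A x).
    by rewrite mul0r lt_neqAle rnorm_ge0 eq_sym Ax0.
  have [|w [al [wS w0 al0 Aw]]] :=
      top_eigenvector Ac Asa Age0 _ (lexx 0) xS Apos.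
    by move=> s /S1[_ [mu [_ ?]]]; exists mu.
  pose u := (rnorm w)^-1%:C%C *: w.
  have uS s : S s -> inner u s = 0 by move=> Ss; rewrite innerZl wS// mulr0.
  have u1 : rnorm u = 1 by exact: rnorm_normalize.
  apply: (Smax (S `|` [set u])).
    split; first by move=> s Ss; left.
    move=> /(_ u (or_intror erefl))/uS; rewrite inner_self u1 expr1n.
    by move/eqP; rewrite oner_eq0.
  split.
    move=> s [/S1//|->]; split => //; exists al; split => //.
    by rewrite /u linearZ/= Aw !scalerA mulrC.
  move=> s s' [Ss|->] [Ss'|->]; [exact: So| | |by rewrite eqxx].
    by move=> _; apply: inner_eq0C; exact: uS.
  by move=> _; exact: uS.
Qed.

End CompactEigensystem.

(** * The spectrum of a tensor product *)

Section ClosedSpan.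
Variables (R : realType) (H : hilbertType R) (A : {linear H -> H}).
Hypotheses (Ac : compact_operator A) (Asa : selfadjoint A).
Hypothesis Age0 : nonnegative_operator A.
Variables (I : choiceType) (D : set I) (e : I -> H) (a : I -> R).
Hypothesis Ees : eigensystem A D e a.

Definition spans (F : {fset I}) (x : H) := exists c : I -> R[i],
  [set` F] `<=` D /\ x = \sum_(i <- F) c i *: e i.

(** [u] is projected on the finitely many eigenvectors with eigenvalue above [t]. If [A] stretched
    the residual by more than [t], [top_eigenvector] with [c = t] would give an eigenvector
    orthogonal to them whose eigenvalue still exceeds [t]; it would be orthogonal to the whole
    system and lie in the kernel, which is impossible. *)
Lemma image_closed_span (u : H) (eps : R) : 0 < eps ->
  exists F x, spans F x /\ rnorm (A u - x) <= eps.
Proof.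
move=> eps0; pose t := eps / (rnorm u + 1).
have u0 : 0 < rnorm u + 1 by rewrite ltr_wpDl// rnorm_ge0.
have t0 : 0 < t by rewrite divr_gt0.
pose F := fset_set [set i | D i /\ t < a i].
have FE : [set` F] = [set i | D i /\ t < a i].
  by rewrite fset_setK//; exact: (eigensystem_fin Ees).
have FD : [set` F] `<=` D by rewrite FE => i [].
pose pu := proj_fset e F u.
have upF i : i \in F -> inner (u - pu) (e i) = 0.
  by move=> iF; exact: (residual_orth Ees).
have nup : rnorm (u - pu) <= rnorm u.
  have [->|up0] := eqVneq (u - pu) 0; first by rewrite rnorm0 rnorm_ge0.
  have up1 : inner (u - pu) pu = 0.
    rewrite {2}/pu /proj_fset inner_sumr big1// => i _.
    by rewrite innerZr upF ?mulr0//; exact: mem_tnth.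
  have : inner (u - pu) (u - pu) = inner (u - pu) u by rewrite innerBr up1 subr0.
  rewrite inner_self => h.
  have := cauchy_schwarz (u - pu) u; rewrite -h ger0_norm ?ler0c ?sqr_ge0//.
  by rewrite lecR expr2 ler_pM2l// rnorm_gt0.
exists F, (A pu); split.
  pose c (i : I) := inner u (e i) * (a i)%:C%C.
  exists c; split => //; rewrite /pu /proj_fset linear_sum/=.
  rewrite (big_tnth _ _ F) /=; apply: eq_bigr => i _.
  rewrite linearZ/= (eigensystem_eig Ees) ?scalerA//.
  by apply: FD; exact: mem_tnth.
rewrite -linearB; apply: le_trans (_ : t * rnorm (u - pu) <= _); last first.
  rewrite /t mulrAC ler_pdivrMr// ler_pM2l//.
  by apply: le_trans nup _; rewrite lerDl.
rewrite leNgt; apply/negP => tup.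
have [||w [al [wF w0 tal Aw]]] :=
    top_eigenvector Ac Asa Age0 (S := e @` [set` F]) _ (ltW t0) _ tup.
- by move=> _ [i /FD Di <-]; exists (a i); exact: (eigensystem_eig Ees).
- by move=> _ [i iF <-]; exact: upF.
have : A w = 0.
  apply: (eigensystem_total Ees) => i Di.
  have [iF|iF] := pselect ([set` F] i); first by apply: wF; exists i.
  apply: (inner_eigvec Ees Aw Di); apply/eqP => aal; apply: iF.
  by rewrite FE; split => //; rewrite aal.
move/eqP; rewrite Aw scaler_eq0 (negbTE w0) orbF.
rewrite -[0]/(0%:C%C) (inj_eq (@complexI R)) gt_eqF//.
exact: lt_trans tal.
Qed.

End ClosedSpan.

Section TensorEigensystem.
Variables (R : realType) (H Ht K : hilbertType R).
Variables (A : {linear H -> H}) (At : {linear Ht -> Ht}) (B : {linear K -> K}).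
Variable tens : {bilinear H -> Ht -> K}.
Hypotheses (Ac : compact_operator A) (Asa : selfadjoint A).
Hypothesis Age0 : nonnegative_operator A.
Hypotheses (Atc : compact_operator At) (Atsa : selfadjoint At).
Hypothesis Atge0 : nonnegative_operator At.
Hypothesis tensP : is_tensor_product tens.
Hypothesis BP : is_tensor_operator tens A At B.

Lemma tensDl u u' v : tens (u + u') v = tens u v + tens u' v.
Proof. exact: linearDl. Qed.
Lemma tensDr u v v' : tens u (v + v') = tens u v + tens u v'.
Proof. exact: linearDr. Qed.
Lemma tensBl u u' v : tens (u - u') v = tens u v - tens u' v.
Proof. exact: linearBl. Qed.
Lemma tensBr u v v' : tens u (v - v') = tens u v - tens u v'.
Proof. exact: linearBr. Qed.
Lemma tensZl c u v : tens (c *: u) v = c *: tens u v.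
Proof. exact: linearZl_LR. Qed.
Lemma tensZr c u v : tens u (c *: v) = c *: tens u v.
Proof. exact: linearZr_LR. Qed.
Lemma tens_suml J (r : seq J) (F : J -> H) v :
  tens (\sum_(j <- r) F j) v = \sum_(j <- r) tens (F j) v.
Proof.
by apply: (big_morph (fun u => tens u v)) => [u u'|]; [exact: tensDl|exact: linear0l].
Qed.
Lemma tens_sumr J (r : seq J) (F : J -> Ht) u :
  tens u (\sum_(j <- r) F j) = \sum_(j <- r) tens u (F j).
Proof.
by apply: (big_morph (tens u)) => [v v'|]; [exact: tensDr|exact: linear0r].
Qed.

Lemma rnorm_tens u v : rnorm (tens u v) = rnorm u * rnorm v.
Proof.
apply/eqP; rewrite -(@eqrXn2 _ 2) ?mulr_ge0 ?rnorm_ge0//; apply/eqP.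
apply: complexI; rewrite -inner_self (proj1 tensP) !inner_self -rmorphM.
by rewrite exprMn.
Qed.

Lemma orth_tens_eq0 (z : K) : (forall u v, inner z (tens u v) = 0) -> z = 0.
Proof.
move=> zo; have zS n (u : 'I_n -> H) (v : 'I_n -> Ht) :
    inner z (\sum_(i < n) tens (u i) (v i)) = 0.
  by rewrite inner_sumr big1.
apply: rnorm_small => eps eps0.
have [_ [n [u [v ->]]] hz] := dense_rnorm (proj2 tensP) z eps0.
set w := \sum_(i < n) _ in hz.
have [->|z0] := eqVneq z 0; first by rewrite rnorm0 ltW.
have := cauchy_schwarz z (z - w).
rewrite innerBr zS subr0 inner_self ger0_norm ?ler0c ?sqr_ge0// lecR.
rewrite expr2 ler_pM2l ?rnorm_gt0// => /le_trans; apply; exact: ltW.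
Qed.

(** Symmetry is an identity on finite sums of elementary tensors and extends by density, since [B]
    is bounded. *)
Lemma tensor_operator_selfadjoint : selfadjoint B.
Proof.
have [Bc Bt] := BP.
have [C C0 hC] := continuous_rnorm Bc.
have BS n (u : 'I_n -> H) (v : 'I_n -> Ht) :
    B (\sum_(i < n) tens (u i) (v i)) = \sum_(i < n) tens (A (u i)) (At (v i)).
  by rewrite linear_sum; apply: eq_bigr => i _; rewrite Bt.
move=> x y; apply/eqP; rewrite -subr_eq0; apply/eqP; apply: normc_small => eps eps0.
(* [d * M] is the sum of the four error bounds [t1] to [t4]. *)
pose M := C * (rnorm x + rnorm y + 1) * 2.
have M0 : 0 < M.
  by rewrite !mulr_gt0// ltr_wpDl// addr_ge0// rnorm_ge0.
pose d := Num.min 1 (eps / M).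
have d0 : 0 < d by rewrite lt_min ltr01 divr_gt0.
have [x' [n [u [v xE]]] hx] := dense_rnorm (proj2 tensP) x d0.
have [y' [m [u' [v' yE]]] hy] := dense_rnorm (proj2 tensP) y d0.
have sa' : inner (B x') y' = inner x' (B y').
  rewrite xE yE !BS !inner_suml; apply: eq_bigr => i _.
  rewrite !inner_sumr; apply: eq_bigr => j _.
  by rewrite !(proj1 tensP) Asa Atsa.
have -> : inner (B x) y - inner x (B y) =
    (inner (B (x - x')) y + inner (B x') (y - y'))
    - (inner (x - x') (B y) + inner x' (B (y - y'))).
  rewrite !linearB/= !innerBl ?innerBr sa' !addrA.
  by rewrite !subrK opprB addrA subrK.
have dx : rnorm (x - x') <= d by exact: ltW.
have dy : rnorm (y - y') <= d by exact: ltW.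
have nx' : rnorm x' <= rnorm x + 1.
  rewrite -[x'](subrK x) addrC; apply: le_trans (rnormD _ _) _.
  by rewrite lerD2l rnormBC (le_trans dx)// ge_min lexx.
have bd (z : K) r : rnorm z <= r -> rnorm (B z) <= C * r.
  by move=> zr; apply: le_trans (hC z) _; rewrite ler_pM2l.
have t1 := inner_le (bd _ _ dx) (lexx (rnorm y)).
have t2 := inner_le (bd _ _ nx') dy.
have t3 := inner_le dx (bd _ _ (lexx (rnorm y))).
have t4 := inner_le nx' (bd _ _ dy).
apply: le_trans (ler_normB _ _) _.
apply: le_trans (lerD (ler_normD _ _) (ler_normD _ _)) _.
apply: le_trans (lerD (lerD t1 t2) (lerD t3 t4)) _.
rewrite -!rmorphD/= lecR.
have : d * M <= eps by rewrite -ler_pdivlMr// ge_min lexx orbT.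
by rewrite /M; move: (rnorm x) (rnorm y) => p q; lra.
Qed.

Variables (D : set nat) (e : nat -> H) (a : nat -> R).
Variables (Dt : set nat) (et : nat -> Ht) (b : nat -> R).
Hypothesis Ees : eigensystem A D e a.
Hypothesis Etes : eigensystem At Dt et b.

Lemma eigensystem_bounded (H' : hilbertType R) (A' : {linear H' -> H'}) D' e' a' :
  eigensystem A' D' e' (a' : nat -> R) ->
  exists2 M : R, 0 < M & forall i, D' i -> a' i <= M.
Proof.
move=> es; have [M M0 cM] := count_gt_eq0 (eigensystem_fin es).
exists M => // i Di; rewrite leNgt; apply/negP => Mi.
move/eqP: cM; rewrite cardfs_eq0 => /eqP F0.
have : [set` fset_set [set i | D' i /\ M < a' i]] i.
  by rewrite fset_setK//; exact: (eigensystem_fin es).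
by rewrite F0.
Qed.

Lemma tensor_eigensystem : eigensystem B [set ij | D ij.1 /\ Dt ij.2]
  (fun ij => tens (e ij.1) (et ij.2)) (fun ij => a ij.1 * b ij.2).
Proof.
have [Bc Bt] := BP; have Bsa := tensor_operator_selfadjoint.
split => //.
- move=> [i j] [/= Di Dj]; rewrite (proj1 tensP).
  by rewrite (eigensystem_norm Ees)// (eigensystem_norm Etes)// mulr1.
- move=> [i j] [k l] [/= Di Dj] [/= Dk Dl] ne; rewrite (proj1 tensP).
  have [ik|ik] := eqVneq i k.
    rewrite [X in _ * X](eigensystem_orth Etes) ?mulr0//.
    by apply: contra ne => /eqP ->; rewrite ik.
  by rewrite (eigensystem_orth Ees)// mul0r.
- move=> [i j] [/= Di Dj]; rewrite Bt (eigensystem_eig Ees)// (eigensystem_eig Etes)//.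
  by rewrite tensZl tensZr scalerA -rmorphM.
- move=> [i j] [/= Di Dj]; apply: mulr_gt0.
    exact: (eigensystem_gt0 Ees).
  exact: (eigensystem_gt0 Etes).
(* With [a <= M] and [b <= N], a product above [t] forces [a i > t / N] and [b j > t / M]. *)
- move=> t t0; have [M M0 aM] := eigensystem_bounded Ees.
  have [N N0 bN] := eigensystem_bounded Etes.
  have tN : 0 < t / N by rewrite divr_gt0.
  have tM : 0 < t / M by rewrite divr_gt0.
  apply: sub_finite_set (finite_setX (eigensystem_fin Ees tN) (eigensystem_fin Etes tM)).
  move=> [i j] /= [[Di Dj] tij].
  have ai := eigensystem_gt0 Ees Di; have bj := eigensystem_gt0 Etes Dj.
  split; split => //; rewrite ltr_pdivrMr//; apply: lt_le_trans tij _.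
    by rewrite ler_pM2l// bN.
  by rewrite mulrC ler_pM2l// aM.
(* Totality: by symmetry it suffices that [z] is orthogonal to [tens (A u) (At v)], and [A u] and
   [At v] are limits of combinations of eigenvectors, to whose tensor products [z] is orthogonal. *)
move=> z zo; apply: orth_tens_eq0 => u v; rewrite Bsa Bt.
have zs F Ft x y : spans D e F x -> spans Dt et Ft y -> inner z (tens x y) = 0.
  move=> [c [FD ->]] [ct [FtD ->]]; rewrite tens_suml inner_sumr big_seq big1// => i iF.
  rewrite tens_sumr inner_sumr big_seq big1// => j jF.
  rewrite tensZl tensZr !innerZr (zo (i, j)) ?mulr0//; split => /=; [exact: FD|exact: FtD].
apply: normc_small => eps eps0.
pose M := (rnorm z + 1) * (rnorm (A u) + rnorm (At v) + 1).
have M0 : 0 < M.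
  by rewrite mulr_gt0// ltr_wpDl// ?addr_ge0// rnorm_ge0.
pose d := Num.min 1 (eps / M).
have d0 : 0 < d by rewrite lt_min ltr01 divr_gt0.
have [F [x [Fx hx]]] := image_closed_span Ac Asa Age0 Ees u d0.
have [Ft [y [Fty hy]]] := image_closed_span Atc Atsa Atge0 Etes v d0.
have -> : inner z (tens (A u) (At v)) =
    inner z (tens (A u - x) (At v) + tens x (At v - y)).
  rewrite tensBl tensBr innerDr !innerBr (zs _ _ _ _ Fx Fty) subr0.
  by rewrite subrK.
have nx : rnorm x <= rnorm (A u) + 1.
  rewrite -[x](subrK (A u)) addrC; apply: le_trans (rnormD _ _) _.
  by rewrite lerD2l rnormBC (le_trans hx)// ge_min lexx.
have nz : rnorm z <= rnorm z + 1 by rewrite lerDl.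
have nt : rnorm (tens (A u - x) (At v) + tens x (At v - y)) <=
    d * rnorm (At v) + (rnorm (A u) + 1) * d.
  apply: le_trans (rnormD _ _) _; rewrite !rnorm_tens lerD//.
    by rewrite ler_wpM2r// rnorm_ge0.
  by rewrite ler_pM// rnorm_ge0.
apply: le_trans (inner_le nz nt) _; rewrite lecR.
have : d * M <= eps by rewrite -ler_pdivlMr// ge_min lexx orbT.
rewrite /M; apply: le_trans; rewrite le_eqVlt; apply/orP; left; apply/eqP.
by ring.
Qed.

End TensorEigensystem.

Theorem spectral_count_tensor (R : realType) (H Ht K : hilbertType R)
  (A : {linear H -> H}) (At : {linear Ht -> Ht})
  (tens : {bilinear H -> Ht -> K}) (B : {linear K -> K}) :
  compact_operator A -> selfadjoint A -> nonnegative_operator A ->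
  compact_operator At -> selfadjoint At -> nonnegative_operator At ->
  is_tensor_product tens -> is_tensor_operator tens A At B ->
  forall t : R, 0 < t ->
  ([set ij : nat * nat | t < eigenvalues A ij.1 * eigenvalues At ij.2]
     #= `I_(spectral_count B t))%card.
Proof.
move=> Ac Asa Age0 Atc Atsa Atge0 tensP BP t t0.
have [D [a es0]] := compact_eigensystem Ac Asa Age0.
have [Dt [b est0]] := compact_eigensystem Atc Atsa Atge0.
have [e es] := eigensystem_nat es0.
have [et est] := eigensystem_nat est0.
have esB := tensor_eigensystem Ac Asa Age0 Atc Atsa Atge0 tensP BP es est.
rewrite -(card_eqr (spectral_count_card esB t0)).
suff -> : [set ij : nat * nat | t < eigenvalues A ij.1 * eigenvalues At ij.2] =
    [set ij | ([set n | 0 < eigenvalues A n] ij.1 /\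
      [set n | 0 < eigenvalues At n] ij.2) /\
      t < eigenvalues A ij.1 * eigenvalues At ij.2] by exact: card_eqxx.
have ga := eigenvalues_ge0 es; have gb := eigenvalues_ge0 est.
apply/seteqP; split => [[i j]|[i j] []//] /= tij; split => //.
have : 0 < eigenvalues A i * eigenvalues At j by exact: lt_trans tij.
by rewrite !lt_neqAle ga gb !andbT !(eq_sym 0) mulf_eq0 negb_or => /andP[/andP[-> ->]].
Qed.

(** * Slow variation and block sums *)

Lemma card_finType (T : finType) : ([set: T] #= `I_#|T|)%card.
Proof.
rewrite card_eq_sym -(_ : [set (enum_rank x : nat) | x in [set: T]] = `I_#|T|).
  by apply: inj_card_eq => x y _ _ /val_inj/enum_rank_inj.
apply/seteqP; split => [_ [x _ <-]|n /= nT]; first exact: ltn_ord.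
by exists (enum_val (Ordinal nT)) => //; rewrite enum_valK.
Qed.

Section PairCount.
Variables (R : realType) (a b : nat -> R) (na nb : R -> nat).
Hypotheses (a_ge0 : forall i, 0 <= a i) (b_ge0 : forall j, 0 <= b j).
Hypothesis naP : forall (t : R) i, 0 < t -> (i < na t)%N = (t < a i).
Hypothesis nbP : forall (t : R) j, 0 < t -> (j < nb t)%N = (t < b j).

(* Pairs with [a i * b j > t] have [a i > sqrt t], or else [a i <= sqrt t < b j]. *)
Lemma pair_count_split (t : R) (N : nat) : 0 < t ->
  ([set ij : nat * nat | t < a ij.1 * b ij.2] #= `I_N)%card ->
  N = (\sum_(i < na (Num.sqrt t)) nb (t / a i) +
       \sum_(j < nb (Num.sqrt t)) (na (t / b j) - na (Num.sqrt t)))%N.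
Proof.
move=> t0 hN; pose r := Num.sqrt t.
have r0 : 0 < r by rewrite sqrtr_gt0.
have rr : r * r = t by rewrite -expr2 sqr_sqrtr// ltW.
pose X := {i : 'I_(na r) & 'I_(nb (t / a i))}.
pose Y := {j : 'I_(nb r) & 'I_(na (t / b j) - na r)}.
(* [Y] lists the pairs with [a i <= r < b j], their first index counted from [na r]. *)
pose F (z : X + Y) : nat * nat := match z with
  | inl x => (tag x : nat, tagged x : nat)
  | inr y => ((na r + tagged y)%N, tag y : nat) end.
have Finj : injective F.
  move=> [[i j]|[j k]] [[i' j']|[j' k']] /= [].
  - move=> /val_inj ii; subst i' => /val_inj ->//.
  - by move=> e _; have := ltn_ord i; rewrite e -ltn_subRL subnn ltn0.
  - by move=> e _; have := ltn_ord i'; rewrite -e -ltn_subRL subnn ltn0.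
  - move=> + /val_inj jj; subst j' => /addnI/val_inj ->//.
have FE : [set F z | z in [set: X + Y]] = [set ij | t < a ij.1 * b ij.2].
  apply/seteqP; split => [_ [[[i j]|[j k]] _ <-]|[i j] /= tij] /=.
  - have ai : r < a i by rewrite -naP// ltn_ord.
    have ai0 : 0 < a i by exact: lt_trans ai.
    have : (j < nb (t / a i))%N by exact: ltn_ord.
    by rewrite nbP ?divr_gt0// ltr_pdivrMr// mulrC.
  - have bj : r < b j by rewrite -nbP// ltn_ord.
    have bj0 : 0 < b j by exact: lt_trans bj.
    have : (na r + k < na (t / b j))%N by rewrite -ltn_subRL ltn_ord.
    by rewrite naP ?divr_gt0// ltr_pdivrMr.
  have ab0 : 0 < a i * b j by exact: lt_trans tij.
  have ai0 : 0 < a i.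
    by rewrite lt_neqAle a_ge0 andbT eq_sym; apply: contraTneq ab0 => ->; rewrite mul0r ltxx.
  have bj0 : 0 < b j.
    by rewrite lt_neqAle b_ge0 andbT eq_sym; apply: contraTneq ab0 => ->; rewrite mulr0 ltxx.
  have [ri|ir] := ltP r (a i).
    have ir : (i < na r)%N by rewrite naP.
    have jt : (j < nb (t / a i))%N by rewrite nbP ?divr_gt0// ltr_pdivrMr// mulrC.
    by exists (inl (Tagged (fun i : 'I__ => 'I_(nb (t / a i))) (i := Ordinal ir) (Ordinal jt))).
  have jr : (j < nb r)%N.
    rewrite nbP// -(ltr_pM2l r0) rr; apply: (lt_le_trans tij).
    by rewrite ler_pM2r.
  have it : (i < na (t / b j))%N by rewrite naP ?divr_gt0// ltr_pdivrMr.
  have nri : (na r <= i)%N by rewrite leqNgt naP// -leNgt.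
  have kt : (i - na r < na (t / b j) - na r)%N by rewrite ltn_sub2r// (leq_ltn_trans nri).
  exists (inr (Tagged (fun j : 'I__ => 'I_(na (t / b j) - na r)) (i := Ordinal jr) (Ordinal kt))) => //=.
  by rewrite subnKC.
have cF : ([set F z | z in [set: X + Y]] #= [set: X + Y])%card.
  by apply: inj_card_eq => z z' _ _; exact: Finj.
move: cF; rewrite FE => cF.
have : ([set: X + Y] #= `I_N)%card by rewrite -(card_eql cF).
have cT : ([set: X + Y] #= `I_#|{: X + Y}|)%card by exact: card_finType.
rewrite (card_eql cT) => /card_eq_II <-.
rewrite card_sum !card_tagged !sumnE !big_map -!enumT !big_enum/=.
by congr (_ + _)%N; apply: eq_bigr => i _; rewrite card_ord.
Qed.

End PairCount.

Section LogSlow.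
Variable R : realType.
Implicit Types f g : R -> R.

(* For [f = phi \o expR] this expresses [tau * (ln phi)' tau --> 0]. *)
Definition log_slow f := (forall x, 0 < f x) /\
  forall eps, 0 < eps -> exists X, forall x y, X <= x -> X <= y ->
    f x <= expR (eps * `|x - y|) * f y.

Lemma log_slow_close f (L d : R) : log_slow f -> 0 <= L -> 0 < d ->
  exists X, forall x y, X <= x -> X <= y -> `|x - y| <= L ->
    `|f x - f y| <= d * f y.
Proof.
move=> [f0 fs] L0 d0.
have ld : 0 < ln (1 + d) by rewrite ln_gt0// ltrDl.
have L1 : 0 < L + 1 by rewrite ltr_wpDl.
(* With this exponent, a displacement of length at most [L] changes [f] by a factor at most
   [1 + d]. *)
have [X hX] := fs (ln (1 + d) / (L + 1)) (divr_gt0 ld L1).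
have key x y : X <= x -> X <= y -> `|x - y| <= L -> f x <= (1 + d) * f y.
  move=> Xx Xy xy; apply: le_trans (hX _ _ Xx Xy) _.
  rewrite ler_pM2r//.
  apply: (@le_trans _ _ (expR (ln (1 + d)))).
    rewrite ler_expR mulrAC ler_pdivrMr// ler_pM2l//.
    by apply: le_trans xy _; rewrite lerDl.
  by rewrite lnK// posrE addr_gt0.
exists X => x y Xx Xy xy; rewrite ler_norml.
have h1 := key _ _ Xx Xy xy.
have h2 : f y <= (1 + d) * f x by apply: key => //; rewrite distrC.
have fx := f0 x; have fy := f0 y.
apply/andP; split; last by lra.
have : d * f y <= d * ((1 + d) * f x) by rewrite ler_pM2l.
by nra.
Qed.

Lemma log_slow_half f (L : R) : log_slow f -> 0 <= L ->
  exists X, forall x y, X <= x -> X <= y -> `|x - y| <= L ->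
    f y / 2 <= f x /\ f x <= 2 * f y.
Proof.
move=> fs L0; have d0 : 0 < 1 / 2 :> R by lra.
have [X hX] := log_slow_close fs L0 d0.
exists X => x y Xx Xy xy; have := hX _ _ Xx Xy xy; have := fs.1 y.
by rewrite ler_norml => y0 /andP[h1 h2]; split; lra.
Qed.

End LogSlow.

Section BlockSums.
Variables (R : realType) (T : R) (f g : R -> R).
Hypotheses (T0 : 0 < T) (fs : log_slow f) (gs : log_slow g).
Hypothesis gdiv : forall B : R, exists K : nat,
  B <= \sum_(0 <= k < K) g (k%:R * T).

Definition nblocks (y : R) : nat := Num.truncn (y / (2 * T)).

(* [k] runs over the blocks [[k T, (k + 1) T]] contained in [[0, y / 2]]; for
   [f = phi \o expR] and [g = phit \o expR], [T * block_conv y] approximates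
   [h_conv phit phi (expR y)]. *)
Definition block_conv (y : R) : R :=
  \sum_(0 <= k < nblocks y) g (k%:R * T) * f (y - k%:R * T).

Let f0 x : 0 < f x. Proof. exact: fs.1. Qed.
Let g0 x : 0 < g x. Proof. exact: gs.1. Qed.

Lemma nblocks_le y : 0 <= y -> (nblocks y)%:R * T <= y / 2.
Proof.
move=> y0; have h : (nblocks y)%:R <= y / (2 * T) :> R.
  by rewrite truncn_le// divr_ge0// mulr_ge0// ltW.
move: h; rewrite ler_pdivlMr ?mulr_gt0// => h.
by rewrite ler_pdivlMr// -mulrA (mulrC T).
Qed.

Lemma nblocks_gt y : y / 2 < (nblocks y)%:R * T + T.
Proof.
have := truncnS_gt (y / (2 * T)); rewrite -/(nblocks y) ltr_pdivrMr ?mulr_gt0//.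
by rewrite -natr1 mulrDl mul1r => h; lra.
Qed.

Lemma nblocks_ge (K : nat) y : 2 * (K%:R * T) <= y -> (K <= nblocks y)%N.
Proof.
move=> Ky; have := nblocks_gt y => h.
have : K%:R * T < ((nblocks y).+1)%:R * T.
  by rewrite -natr1 mulrDl mul1r; lra.
by rewrite ltr_pM2r// ltr_nat ltnS.
Qed.

Lemma ltn_nblocks y k : 0 <= y -> (k < nblocks y)%N -> k%:R * T + T <= y / 2.
Proof.
move=> y0 kM; apply: le_trans (nblocks_le y0).
by rewrite -[X in _ + X]mul1r -mulrDl ler_pM2r// natr1 ler_nat.
Qed.

Lemma block_conv_ge0 y : 0 <= block_conv y.
Proof. by apply: sumr_ge0 => k _; rewrite mulr_ge0// ltW. Qed.

(** For fixed [k] and large [y] the [k]-th summand is at least [g (k%:R * T) * f y / 2], and by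
    divergence finitely many values of [g] add up to any prescribed constant. *)
Lemma block_conv_dom (B : R) :
  exists Y, forall y, Y <= y -> B * f y <= block_conv y.
Proof.
have [K hK] := gdiv (2 * `|B|).
have KT0 : 0 <= K%:R * T by rewrite mulr_ge0// ltW.
have [X hX] := log_slow_half fs KT0.
exists (Num.max (`|X| + K%:R * T) (2 * (K%:R * T))) => y.
rewrite ge_max => /andP[y1 y2].
have KM := nblocks_ge y2.
have Xn : X <= `|X| by exact: ler_norm.
rewrite /block_conv (big_cat_nat (leq0n K) KM)//=.
apply: (@le_trans _ _ (\sum_(0 <= k < K) g (k%:R * T) * (f y / 2))); last first.
  rewrite -[X in X <= _]addr0; apply: lerD; last first.
    by apply: sumr_ge0 => k _; rewrite mulr_ge0// ltW.
  rewrite !big_nat; apply: ler_sum => k /andP[_ kK].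
  have kT0 : 0 <= k%:R * T by rewrite mulr_ge0// ltW.
  have kTK : k%:R * T <= K%:R * T by rewrite ler_pM2r// ler_nat ltnW.
  rewrite ler_pM2l//; apply: (hX _ _ _ _ _).1; [lra|lra|].
  by rewrite addrAC subrr add0r normrN ger0_norm.
rewrite -mulr_suml; have fy := f0 y; have := ler_norm B => Bn.
apply: (@le_trans _ _ (2 * `|B| * (f y / 2))); last by rewrite ler_pM2r// divr_gt0.
rewrite mulrACA mulrCA; apply: (@le_trans _ _ (`|B| * f y)); first by rewrite ler_pM2r.
by lra.
Qed.

(** The last [L] blocks before [y / 2] contribute at least [f (y / 2) * g (y / 2) / 4] each, and [L]
    can be taken as large as desired. *)
Lemma block_conv_dom_half (B : R) :
  exists Y, forall y, Y <= y -> B * (f (y / 2) * g (y / 2)) <= block_conv y.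
Proof.
have [L L4] : exists L : nat, 4 * `|B| <= L%:R.
  by exists (Num.truncn (4 * `|B|)).+1; rewrite ltW// truncnS_gt.
have LT0 : 0 <= L%:R * T by rewrite mulr_ge0// ltW.
have [W WE] : exists W, W = L%:R * T + T by exists (L%:R * T + T).
have Tpos := T0; have W0 : 0 <= W by rewrite WE addr_ge0// ltW.
have [X hX] := log_slow_half fs W0.
have [X' hX'] := log_slow_half gs W0.
exists (2 * (`|X| + `|X'| + W)) => y hy.
have Xn := ler_norm X; have Xn' := ler_norm X'.
have X0 := normr_ge0 X; have X0' := normr_ge0 X'.
have y0 : 0 <= y by lra.
have LM : (L <= nblocks y)%N.
  by apply: nblocks_ge; lra.
rewrite /block_conv (big_cat_nat _ (leq_subr L (nblocks y)))//=.
apply: (@le_trans _ _ (\sum_(nblocks y - L <= k < nblocks y)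
    (f (y / 2) * g (y / 2) / 4))); last first.
  rewrite -[X in X <= _]add0r; apply: lerD.
    by apply: sumr_ge0 => k _; rewrite mulr_ge0// ltW.
  rewrite !big_nat; apply: ler_sum => k /andP[kL kM].
  have h1 := ltn_nblocks y0 kM; have h2 := nblocks_gt y.
  have h3 : (nblocks y)%:R * T - L%:R * T <= k%:R * T.
    by rewrite -mulrBl ler_pM2r// -natrB// ler_nat.
  have e1 : f (y / 2) / 2 <= f (y - k%:R * T).
    apply: (hX _ _ _ _ _).1; rewrite ?ler_norml; lra.
  have e2 : g (y / 2) / 2 <= g (k%:R * T).
    apply: (hX' _ _ _ _ _).1; rewrite ?ler_norml; lra.
  rewrite (_ : _ / 4 = (g (y / 2) / 2) * (f (y / 2) / 2)); last by field.
  by apply: ler_pM => //; rewrite divr_ge0// ltW.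
rewrite sumr_const_nat subKn// -[X in _ <= X]mulr_natr.
have p0 : 0 < f (y / 2) * g (y / 2) by rewrite mulr_gt0.
move: p0 L4; move: (f _ * g _) (L%:R : R) => p l p0 L4.
have := ler_norm B => Bn; nra.
Qed.

(** A summation principle shared by the sum over the second spectrum and by the integral [h_conv].
    Termwise asymptotics are required only from some block on, uniformly in [y]; each earlier block
    is [O (f y)], and it is absorbed, together with [extra], by the two domination lemmas. *)
Lemma block_conv_asymp (q : nat -> R -> R) (extra c : R -> R) (C Cc : R) :
  (forall eps, 0 < eps -> exists K : nat, forall k y, (K <= k)%N ->
     k%:R * T + T <= y / 2 ->
     `|q k y - c y * (g (k%:R * T) * f (y - k%:R * T))|
       <= eps * (g (k%:R * T) * f (y - k%:R * T))) ->
  (forall k : nat, exists C Y : R, forall y, Y <= y -> `|q k y| <= C * f y) ->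
  (forall y, `|c y| <= Cc) ->
  (exists Y, forall y, Y <= y -> `|extra y| <= C * (f y + f (y / 2) * g (y / 2))) ->
  forall eps, 0 < eps -> exists Y, forall y, Y <= y ->
    `|\sum_(0 <= k < nblocks y) q k y + extra y - c y * block_conv y|
      <= eps * block_conv y.
Proof.
move=> hq qf cC [Y0 hex] eps eps0.
have e2 : 0 < eps / 2 by rewrite divr_gt0.
have [K hK] := hq _ e2.
have KT0 : 0 <= K%:R * T by rewrite mulr_ge0// ltW.
have [X hX] := log_slow_half fs KT0.
have Cc0 : 0 <= Cc by apply: le_trans (normr_ge0 _) (cC 0).
have head k : (k < K)%N -> exists D Y : R, forall y, Y <= y ->
    `|q k y - c y * (g (k%:R * T) * f (y - k%:R * T))| <= D * f y.
  move=> kK; have [D [Y hD]] := qf k.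
  exists (D + Cc * (g (k%:R * T) * 2)), (Num.max Y (`|X| + K%:R * T)) => y.
  rewrite ge_max => /andP[yY yX].
  apply: le_trans (ler_normB _ _) _; rewrite mulrDl lerD ?hD//.
  rewrite normrM -mulrA; apply: ler_pM => //.
  rewrite (@ger0_norm _ (_ * _)); last by rewrite mulr_ge0// ltW.
  rewrite -mulrA ler_pM2l//.
  have Xn := ler_norm X.
  have kT0 : 0 <= k%:R * T by rewrite mulr_ge0// ltW.
  have kTK : k%:R * T <= K%:R * T by rewrite ler_pM2r// ler_nat ltnW.
  apply: (hX _ _ _ _ _).2; [lra|lra|].
  by rewrite addrAC subrr add0r normrN ger0_norm.
have [D [Y1 hD]] : exists D Y : R, forall y, Y <= y ->
    `|\sum_(0 <= k < K) (q k y - c y * (g (k%:R * T) * f (y - k%:R * T)))|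
      <= D * f y.
  elim: (K) head => [|K' IH] hd.
    by exists 0, 0 => y _; rewrite big_geq// normr0 mul0r.
  have [k kK'|D [Y hDY]] := IH; first by apply: hd; exact: ltnW.
  have [D' [Y' hDY']] := hd K' (ltnSn K').
  exists (D + D'), (Num.max Y Y') => y; rewrite ge_max => /andP[y1 y2].
  rewrite big_nat_recr//= mulrDl; apply: le_trans (ler_normD _ _) _.
  by apply: lerD; [exact: hDY|exact: hDY'].
(* This constant makes the first [K] blocks and [extra] cost at most [eps / 2] together; the other
   half is spent on the blocks from [K] on. *)
have [Y2 hY2] := block_conv_dom (4 * (`|D| + `|C|) / eps).
have [Y3 hY3] := block_conv_dom_half (4 * (`|D| + `|C|) / eps).
exists (Num.max (Num.max (Num.max Y0 Y1) (Num.max Y2 Y3)) (2 * (K%:R * T))) => y.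
rewrite !ge_max => /andP[/andP[/andP[y0 y1] /andP[y2 y3]] y4].
have y_ge0 : 0 <= y by lra.
have KM := nblocks_ge y4.
pose d k := q k y - c y * (g (k%:R * T) * f (y - k%:R * T)).
have -> : \sum_(0 <= k < nblocks y) q k y + extra y - c y * block_conv y =
    \sum_(0 <= k < K) d k + \sum_(K <= k < nblocks y) d k + extra y.
  rewrite -big_cat_nat//= /block_conv mulr_sumr addrAC -sumrB.
  by rewrite addrC addrC.
have b1 : `|\sum_(K <= k < nblocks y) d k| <= eps / 2 * block_conv y.
  apply: le_trans (ler_norm_sum _ _ _) _.
  rewrite /block_conv (big_cat_nat (leq0n K) KM)//= mulrDr.
  rewrite -[X in X <= _]add0r; apply: lerD.
    by rewrite mulr_ge0 ?(ltW e2)// sumr_ge0// => k _; rewrite mulr_ge0// ltW.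
  rewrite mulr_sumr !big_nat; apply: ler_sum => k /andP[Kk kM].
  by apply: hK => //; exact: ltn_nblocks.
have b2 := hD _ y1; have b3 := hex _ y0.
have b4 := hY2 _ y2; have b5 := hY3 _ y3.
apply: le_trans (ler_normD _ _) _.
apply: le_trans (lerD (ler_normD _ _) (lexx _)) _.
have fy := f0 y; have fg : 0 < f (y / 2) * g (y / 2) by rewrite mulr_gt0.
have key (z : R) : 4 * (`|D| + `|C|) / eps * z <= block_conv y ->
    4 * ((`|D| + `|C|) * z) <= eps * block_conv y.
  move=> h; have : eps * (4 * (`|D| + `|C|) / eps * z) <= eps * block_conv y.
    by rewrite ler_pM2l.
  by apply: le_trans; rewrite le_eqVlt; apply/orP; left; apply/eqP; field; rewrite gt_eqF.
have {}b4 := key _ b4; have {}b5 := key _ b5.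
have c1 : D * f y <= `|D| * f y by rewrite ler_pM2r// ler_norm.
have c2 : C * (f y + f (y / 2) * g (y / 2)) <= `|C| * (f y + f (y / 2) * g (y / 2)).
  by rewrite ler_wpM2r ?ler_norm// addr_ge0// ltW.
have c3 : 0 <= `|D| * (f (y / 2) * g (y / 2)) by rewrite mulr_ge0// ltW.
move: b1 b2 b3 b4 b5 c1 c2 c3.
move: (f (y / 2) * g (y / 2)) (f y) `|D| `|C| => p r DD CC.
move: `|\sum_(0 <= k < K) _| `|\sum_(K <= k < _) _| `|extra y| (block_conv y) => *.
lra.
Qed.

End BlockSums.

(** * Riemann-Stieltjes sums of periodic convolutions *)

Section Periodic.
Variables (R : realType) (T : R) (s : R -> R).
Hypotheses (T0 : 0 < T) (s_cont : continuous s) (sT : periodic s T).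

Lemma periodic_int (k : int) x : s (x + k%:~R * T) = s x.
Proof.
case: k => n; first by rewrite mulr_natl; exact: periodicn.
rewrite NegzE mulrNz mulNr mulr_natl.
by rewrite -[X in _ = s X](subrK (T *+ n.+1) x) (periodicn sT).
Qed.

Lemma periodic_reduce x : exists k : int, 0 <= x + k%:~R * T <= T.
Proof.
exists (- Num.floor (x / T)); rewrite mulrNz mulNr.
have h1 : (Num.floor (x / T))%:~R <= x / T by exact: floor_le.
have h2 : x / T < (Num.floor (x / T) + 1)%:~R by exact: floorD1_gt.
move: h1 h2; rewrite intrD ler_pdivlMr// ltr_pdivrMr// mulrDl mul1r => h1 h2.
by rewrite subr_ge0 h1/= lerBlDl ltW// addrC addrC.
Qed.

Lemma periodic_bounds : (forall x, 0 < s x) ->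
  exists2 c : R, 0 < c & exists S, forall x, c <= s x /\ s x <= S.
Proof.
move=> s0.
have cw : {within `[0, T], continuous s} by apply: continuous_subspaceT.
have [a _ ha] := EVT_min (ltW T0) cw; have [b _ hb] := EVT_max (ltW T0) cw.
exists (s a) => //; exists (s b) => x; have [k hk] := periodic_reduce x.
by rewrite -(periodic_int k x); split; [apply: ha|apply: hb]; rewrite in_itv.
Qed.

(** Shifting both points by the same multiple of [T] brings [x] into [[0, T]], where the first
    points of a sequence of counterexamples would cluster, against continuity at the cluster
    point. *)
Lemma periodic_unif_continuous (eta : R) : 0 < eta -> exists2 d : R, 0 < d &
  forall x y, `|x - y| < d -> `|s x - s y| <= eta.
Proof.
move=> eta0; apply: contrapT => nex.
have : forall n : nat, exists xy : R * R, [/\ 0 <= xy.1 <= T,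
    `|xy.1 - xy.2| < n.+1%:R^-1 & eta < `|s xy.1 - s xy.2|].
  move=> n; apply: contrapT => h; apply: nex; exists n.+1%:R^-1.
    by rewrite invr_gt0.
  move=> x y xy; rewrite leNgt; apply/negP => sxy; apply: h.
  have [k hk] := periodic_reduce x.
  exists (x + k%:~R * T, y + k%:~R * T); split => //=.
    by rewrite opprD addrACA subrr addr0.
  by rewrite !periodic_int.
move=> /choice[z hz].
pose F : set_system R := (fun n => (z n).1) @ \oo.
have FK : F `[0, T]%classic.
  by rewrite /F /nbhs/=; near=> n; rewrite /= in_itv/=; have [] := hz n.
have [c [_ Fc]] : exists c : R, `[0, T]%classic c /\ cluster F c.
  exact: (@segment_compact R 0 T F _ FK).
have e2 : 0 < eta / 2 by rewrite divr_gt0.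
have /cvgrPdist_lt/(_ _ e2)/nbhs_ballP[r /= r0 hr] := @s_cont c.
have r2 : 0 < r / 2 by rewrite divr_gt0.
pose N := Num.truncn (r / 2)^-1.
have FN : F [set (z n).1 | n in [set n | (N <= n)%N]].
  by rewrite /F /nbhs/=; near=> n; exists n => //=; near: n; exists N.
have [_ [[n /= Nn <-]]] := Fc _ _ FN (nbhsx_ballx c (r / 2) r2).
rewrite -ball_normE/= => cz.
have [_ h1 h2] := hz n.
have nr : n.+1%:R^-1 < r / 2.
  rewrite invf_plt ?posrE//; apply: (lt_le_trans (truncnS_gt _)).
  by rewrite ler_nat.
have s1 : `|s c - s (z n).1| < eta / 2.
  by apply: hr; rewrite -ball_normE/=; apply: lt_trans cz _; lra.
have s2 : `|s c - s (z n).2| < eta / 2.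
  apply: hr; rewrite -ball_normE/=.
  rewrite -(subrK (z n).1 c) -addrA; apply: le_lt_trans (ler_normD _ _) _.
  have h3 := lt_trans h1 nr; rewrite [r]splitr; exact: ltrD.
move: h2; apply/negP; rewrite -leNgt.
rewrite -(subrK (s c) (s _)) -addrA; apply: le_trans (ler_normD _ _) _.
rewrite [eta]splitr distrC; apply: ltW; exact: ltrD.
Unshelve. all: by end_near.
Qed.

End Periodic.

Section ExpWeight.
Variables (R : realType) (p T : R) (s : R -> R).
Hypotheses (p0 : 0 < p) (T0 : 0 < T) (s_cont : continuous s) (sT : periodic s T).
Hypothesis s0 : forall x, 0 < s x.
Local Notation rho := (exp_weight p s).

Lemma exp_weight_gt0 x : 0 < rho x.
Proof. by rewrite mulr_gt0// expR_gt0. Qed.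

Lemma exp_weightD x y : rho (x + y) = expR (x / p) * (expR (y / p) * s (x + y)).
Proof. by rewrite /exp_weight mulrDl expRD mulrA. Qed.

Lemma exp_weight_shift (k : int) x :
  rho (x + k%:~R * T) = expR (k%:~R * T / p) * rho x.
Proof. by rewrite /exp_weight mulrDl expRD (periodic_int sT) mulrAC mulrA mulrC mulrA. Qed.

Lemma exp_weight_shiftT x : rho (x + T) = expR (T / p) * rho x.
Proof. by have := exp_weight_shift 1 x; rewrite mul1r. Qed.

(** After division by [expR (y / p)] the function is a decaying exponential times a periodic one:
    uniform continuity of [s] controls one factor and [1 - h / p <= expR (- (h / p))] the other,
    both uniformly in [y]. *)
Lemma exp_weight_mesh (eta : R) : 0 < eta -> exists2 N : nat, (0 < N)%N &
  forall y i, (i < N)%N ->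
    rho (y - i%:R * (T / N%:R)) - rho (y - i.+1%:R * (T / N%:R)) <= eta * expR (y / p).
Proof.
move=> eta0; have e2 : 0 < eta / 2 by rewrite divr_gt0.
have [c c0 [S hS]] := periodic_bounds T0 s_cont sT s0.
have S0 : 0 < S by apply: lt_le_trans (s0 0) (hS 0).2.
have [d d0 hd] := periodic_unif_continuous T0 s_cont sT e2.
(* The second bound makes [h / p * S <= eta / 2], the share of the exponential factor. *)
pose d' := Num.min d (eta / 2 * p / S).
have d'0 : 0 < d' by rewrite lt_min d0 divr_gt0// mulr_gt0.
pose N := (Num.truncn (T / d')).+1.
exists N => // y i iN.
have N0 : 0 < N%:R :> R by rewrite ltr0n.
pose h := T / N%:R.
have h0 : 0 < h by rewrite divr_gt0.
have hd' : h < d'.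
  by rewrite ltr_pdivrMr// mulrC -ltr_pdivrMr// truncnS_gt.
have x0 : 0 <= i%:R * h by rewrite mulr_ge0// ltW.
have -> : i.+1%:R * h = i%:R * h + h by rewrite -natr1 mulrDl mul1r.
move: (i%:R * h) x0 => x x0.
rewrite !exp_weightD -mulrBr mulrC ler_pM2r ?expR_gt0//.
have dd : `|(y - x) - (y - (x + h))| < d.
  have -> : y - x - (y - (x + h)) = h by ring.
  rewrite ger0_norm; last exact: ltW.
  by apply: lt_le_trans hd' _; rewrite ge_min lexx.
have := hd _ _ dd; rewrite ler_norml => /andP[_ h1].
have e1 : expR (- x / p) <= 1 by rewrite -expR0 ler_expR mulNr oppr_le0 divr_ge0// ltW.
have e3 : expR (- (x + h) / p) = expR (- x / p) * expR (- (h / p)).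
  by rewrite -expRD; congr expR; rewrite opprD mulrDl !mulNr.
have e4 : 1 - h / p <= expR (- (h / p)) by exact: expR_ge1Dx.
have hp : h / p * S <= eta / 2.
  rewrite mulrAC ler_pdivrMr// -ler_pdivlMr//.
  by apply: ltW; apply: lt_le_trans hd' _; rewrite ge_min lexx orbT.
have sy := (hS (y - (x + h))).2; have sy0 := s0 (y - (x + h)).
rewrite e3; have ex0 := expR_gt0 (- x / p).
have hp0 : 0 < h / p by rewrite divr_gt0.
move: (s (y - x)) (s (y - (x + h))) (expR (- x / p)) (expR (- (h / p))) h1 e1 e4 sy sy0 ex0.
move: (h / p) hp hp0 => z hp hp0 a b ex eh h1 e1 e4 sy sy0 ex0.
have -> : ex * a - ex * eh * b = ex * (a - eh * b) by ring.
have w1 : (1 - eh) * b <= z * b by rewrite ler_pM2r//; lra.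
have w2 : z * b <= z * S by rewrite ler_pM2l.
have w : a - eh * b <= eta by lra.
apply: (@le_trans _ _ (ex * eta)); first by rewrite ler_pM2l.
by rewrite ler_piMl// ltW.
Qed.

End ExpWeight.

Section RiemannStieltjes.
Variables (R : realType) (p T : R) (s st : R -> R).
Local Notation rho := (exp_weight p s).
Local Notation rhot := (exp_weight p st).

(** A Riemann-Stieltjes sum for the integral of [rho (y - x)] against [d rhot (x)] over [[0, T]]. As
    [rho] is nondecreasing, the left nodes give an upper sum and the right nodes, in [rs_lower], a
    lower one. *)
Definition rs_upper (N : nat) (y : R) : R := \sum_(0 <= i < N)
  rho (y - i%:R * (T / N%:R)) * (rhot (i.+1%:R * (T / N%:R)) - rhot (i%:R * (T / N%:R))).

Definition rs_lower (N : nat) (y : R) : R := \sum_(0 <= i < N)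
  rho (y - i.+1%:R * (T / N%:R)) *
    (rhot (i.+1%:R * (T / N%:R)) - rhot (i%:R * (T / N%:R))).

Hypotheses (p0 : 0 < p) (T0 : 0 < T) (s_cont : continuous s) (sT : periodic s T).
Hypothesis s0 : forall x, 0 < s x.
Hypothesis rhot_mono : nondecreasing rhot.

Lemma rs_increment_ge0 N i :
  0 <= rhot (i.+1%:R * (T / N%:R)) - rhot (i%:R * (T / N%:R)).
Proof.
by rewrite subr_ge0; apply: rhot_mono; rewrite ler_wpM2r ?ler_nat// divr_ge0// ltW.
Qed.

Lemma rs_increment_sum N : (0 < N)%N ->
  \sum_(0 <= i < N) (rhot (i.+1%:R * (T / N%:R)) - rhot (i%:R * (T / N%:R)))
  = rhot T - rhot 0.
Proof.
move=> N0; rewrite telescope_sumr// mul0r mulrC divfK//.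
by rewrite pnatr_eq0 -lt0n.
Qed.

(** The mesh bound is the same for all subintervals, and the increments of [rhot] telescope to
    [rhot T - rhot 0]. *)
Lemma rs_gap (eta : R) : 0 < eta -> exists2 N : nat, (0 < N)%N &
  forall y, rs_upper N y - rs_lower N y <= eta * expR (y / p).
Proof.
move=> eta0; have D0 : 0 <= rhot T - rhot 0.
  by rewrite subr_ge0; apply: rhot_mono; exact: ltW.
have D1 : 0 < rhot T - rhot 0 + 1 by rewrite ltr_wpDl.
have [N N0 hN] := exp_weight_mesh p0 T0 s_cont sT s0 (divr_gt0 eta0 D1).
exists N => // y; rewrite /rs_upper /rs_lower -sumrB.
apply: (@le_trans _ _ (\sum_(0 <= i < N) (eta / (rhot T - rhot 0 + 1) * expR (y / p))
    * (rhot (i.+1%:R * (T / N%:R)) - rhot (i%:R * (T / N%:R))))).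
  rewrite !big_nat; apply: ler_sum => i /andP[_ iN].
  by rewrite -mulrBl ler_wpM2r ?rs_increment_ge0// hN.
rewrite -mulr_sumr rs_increment_sum// mulrAC ler_pM2r ?expR_gt0//.
by rewrite mulrAC ler_pdivrMr// ler_pM2l// lerDl.
Qed.

End RiemannStieltjes.

Lemma big_nat_blocks (V : nmodType) (F : nat -> V) (c : nat -> nat) N :
  {homo c : i j / (i <= j)%N} ->
  \sum_(c 0%N <= j < c N) F j =
  \sum_(0 <= i < N) \sum_(c i <= j < c i.+1) F j.
Proof.
move=> cm; elim: N => [|N IH]; first by rewrite !big_geq.
by rewrite big_nat_recr//= -IH -big_cat_nat// cm.
Qed.

(** * The sum over the second spectrum *)

(** The spectral asymptotics at [t = expR (- x)]: the factor [t ^ (- 1 / p)] and the periodic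
    function merge into [exp_weight p s x], and [f] stands for [phi \o expR]. *)
Definition count_equiv (R : realType) (p : R) (f s : R -> R) (n : R -> nat) :=
  forall eps : R, 0 < eps -> exists X, forall x, X <= x ->
    `|(n x)%:R - f x * exp_weight p s x| <= eps * (f x * exp_weight p s x).

Section CountLocal.
Variables (R : realType) (p S : R) (f s : R -> R) (n : R -> nat).
Hypotheses (p0 : 0 < p) (fs : log_slow f).
Hypotheses (s_gt0 : forall x, 0 < s x) (sS : forall x, s x <= S).
Hypothesis nf : count_equiv p f s n.

Let S0 : 0 < S. Proof. exact: lt_le_trans (s_gt0 0) (sS 0). Qed.

Lemma exp_weight_le L x z : `|x| <= L ->
  exp_weight p s (z + x) <= expR (L / p) * S * expR (z / p).
Proof.
move=> xL; rewrite exp_weightD mulrC ler_pM2r ?expR_gt0//.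
apply: ler_pM => //; rewrite ?expR_ge0 ?(ltW (s_gt0 _))// ler_expR ler_pM2r ?invr_gt0//.
by apply: le_trans xL; exact: ler_norm.
Qed.

(** On a window of bounded length [f] is frozen at [z] while the weight keeps its argument. The
    error is measured against [f z * expR (z / p)], which is comparable because [s] is bounded. *)
Lemma count_local (d L : R) : 0 < d -> 0 <= L -> exists Z, forall z x, Z <= z -> `|x| <= L ->
  `|(n (z + x))%:R - f z * exp_weight p s (z + x)| <= d * (f z * expR (z / p)).
Proof.
move=> d0 L0; pose W := expR (L / p) * S.
have W0 : 0 < W by rewrite mulr_gt0 ?expR_gt0.
(* The relative error of the asymptotics costs [2 * eps * W] and freezing [f] costs [eps * W],
   whence the factor 3. *)
pose eps := Num.min 1 (d / (3 * W)).
have eps0 : 0 < eps by rewrite lt_min ltr01 divr_gt0// mulr_gt0.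
have [X hX] := nf eps0; have [X' hX'] := log_slow_close fs L0 eps0.
exists (`|X| + `|X'| + L) => z x Zz xL.
have h1 := ler_norm X; have h2 := ler_norm X'.
have h3 := normr_ge0 X; have h4 := normr_ge0 X'.
have /andP[h5 h6] : - L <= x <= L by rewrite -ler_norml.
have nzx : X <= z + x by lra.
have n1 := hX _ nzx.
have f1 : `|f (z + x) - f z| <= eps * f z.
  by apply: hX'; [lra|lra|rewrite addrC addKr].
have r1 := exp_weight_le z xL; have r0 : 0 < exp_weight p s (z + x).
  exact: exp_weight_gt0.
have fz := fs.1 z; have fzx := fs.1 (z + x).
have e1 : eps <= 1 by rewrite ge_min lexx.
have e2 : eps <= d / (3 * W) by rewrite ge_min lexx orbT.
have W3 : 0 < 3 * W by rewrite pmulr_rgt0.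
rewrite ler_pdivlMr// in e2.
have -> : (n (z + x))%:R - f z * exp_weight p s (z + x) =
  ((n (z + x))%:R - f (z + x) * exp_weight p s (z + x)) +
   (f (z + x) - f z) * exp_weight p s (z + x) by ring.
apply: le_trans (ler_normD _ _) _; rewrite normrM (ger0_norm (ltW r0)).
have f2 : f (z + x) <= 2 * f z.
  have /andP[_ f1'] : - (eps * f z) <= f (z + x) - f z <= eps * f z by rewrite -ler_norml.
  have : eps * f z <= f z by rewrite ler_piMl// ltW.
  by lra.
move: n1 f1 r1 r0 fz fzx e1 e2 f2 W0 eps0 (expR_gt0 (z / p)); rewrite -/W.
clearbody eps W.
move: (f z) (eps) (exp_weight p s _) (expR _) (W) (f (z + x)) `|f _ - _| `|_ - _ * _|.
move=> F e r E w G B A n1 f1 r1 r0 F0 G0 e1 e2 f2 w0 e0 E0.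
have t1 : e * (G * r) <= e * (2 * F * (w * E)).
  by rewrite ler_pM2l// ler_pM// ltW.
have t2 : B * r <= e * F * (w * E).
  apply: (@le_trans _ _ (e * F * r)); first by rewrite ler_pM2r.
  by rewrite ler_pM2l// mulr_gt0.
have t3 : e * (3 * w) * (F * E) <= d * (F * E) by rewrite ler_pM2r// mulr_gt0.
have t4 : e * (3 * w) * (F * E) = e * (2 * F * (w * E)) + e * F * (w * E) by ring.
by rewrite t4 in t3; lra.
Qed.

Lemma count_shift (c : R) : exists C Z, 0 < C /\ forall z, Z <= z ->
  (n (z + c))%:R <= C * (f z * expR (z / p)).
Proof.
have [Z hZ] := count_local ltr01 (normr_ge0 c).
exists (1 + expR (`|c| / p) * S), Z; split.
  by rewrite addr_gt0// mulr_gt0 ?expR_gt0.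
move=> z Zz; have := hZ _ _ Zz (lexx _); have := exp_weight_le z (lexx `|c|).
rewrite ler_norml => h /andP[_ h1].
have : f z * exp_weight p s (z + c) <= f z * (expR (`|c| / p) * S * expR (z / p)).
  by rewrite ler_pM2l ?(fs.1).
by rewrite mulrDl mul1r; move: h1; lra.
Qed.

End CountLocal.

Section SecondSum.
Variables (R : realType) (p T S St : R) (f g s st J : R -> R) (v : nat -> R) (n m : R -> nat).
Hypotheses (p0 : 0 < p) (T0 : 0 < T) (fs : log_slow f) (gs : log_slow g).
Hypothesis gdiv : forall B : R, exists K : nat,
  B <= \sum_(0 <= k < K) g (k%:R * T).
Hypotheses (s_cont : continuous s).
Hypotheses (sT : periodic s T) (stT : periodic st T).
Hypotheses (s_gt0 : forall x, 0 < s x) (sS : forall x, s x <= S).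
Hypotheses (st_gt0 : forall x, 0 < st x) (stS : forall x, st x <= St).
Hypotheses (rhot_mono : nondecreasing (exp_weight p st)).
Hypothesis nf : count_equiv p f s n.
Hypothesis mg : count_equiv p g st m.
Hypothesis n_mono : {homo n : x y / x <= y >-> (x <= y)%N}.
Hypothesis mP : forall x j, (j < m x)%N = (v j < x).
(** [J] is abstract here: lying between all lower and upper sums, whose gaps become arbitrarily
    small, determines it. *)
Hypothesis JE : forall N y, (0 < N)%N ->
  rs_lower p T s st N y <= J y <= rs_upper p T s st N y.

Lemma m_mono : {homo m : x y / x <= y >-> (x <= y)%N}.
Proof.
move=> x y xy; rewrite leqNgt; apply/negP; rewrite mP => vx.
by have := ltnn (m y); rewrite mP (lt_le_trans _ xy)// -mP.
Qed.

Lemma sum_count_le (a b y : R) :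
  \sum_(m a <= j < m b) (n (y - v j))%:R <= (n (y - a))%:R * (m b)%:R :> R.
Proof.
apply: (@le_trans _ _ (\sum_(m a <= j < m b) (n (y - a))%:R)).
  rewrite !big_nat; apply: ler_sum => j /andP[aj _].
  rewrite ler_nat n_mono// lerD2l lerN2.
  by rewrite leNgt -mP -leqNgt.
by rewrite sumr_const_nat -[X in X <= _]mulr_natr ler_wpM2l// ler_nat leq_subr.
Qed.

Let block (k : nat) (y : R) : R :=
  \sum_(m (k%:R * T) <= j < m (k%:R * T + T)) (n (y - v j))%:R.

(** On each subinterval [n (y - v j)] lies between its values at the two ends, and the number of
    [v j] there is an increment of [m]. *)
Lemma block_bounds N k y : (0 < N)%N ->
  \sum_(0 <= i < N) (n (y - k%:R * T - i.+1%:R * (T / N%:R)))%:R *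
    ((m (k%:R * T + i.+1%:R * (T / N%:R)))%:R - (m (k%:R * T + i%:R * (T / N%:R)))%:R)
  <= block k y <=
  \sum_(0 <= i < N) (n (y - k%:R * T - i%:R * (T / N%:R)))%:R *
    ((m (k%:R * T + i.+1%:R * (T / N%:R)))%:R - (m (k%:R * T + i%:R * (T / N%:R)))%:R).
Proof.
move=> N0; pose c (i : nat) := m (k%:R * T + i%:R * (T / N%:R)).
have h0 : 0 < T / N%:R by rewrite divr_gt0// ltr0n.
have cm : {homo c : i j / (i <= j)%N}.
  by move=> i j ij; apply: m_mono; rewrite lerD2l ler_pM2r// ler_nat.
have -> : block k y = \sum_(0 <= i < N) \sum_(c i <= j < c i.+1) (n (y - v j))%:R.
  rewrite -big_nat_blocks// /c mul0r addr0 (mulrC N%:R) divfK//.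
  by rewrite pnatr_eq0 -lt0n.
apply/andP; split; rewrite !big_nat; apply: ler_sum => i _.
  rewrite -natrB; last exact: cm.
  rewrite mulr_natr -sumr_const_nat !big_nat; apply: ler_sum => j /andP[_].
  by rewrite mP => jc; rewrite ler_nat n_mono// -addrA -opprD lerD2l lerN2 ltW.
rewrite -natrB; last exact: cm.
rewrite mulr_natr -sumr_const_nat !big_nat; apply: ler_sum => j /andP[+ _].
by rewrite leqNgt mP -leNgt => jc; rewrite ler_nat n_mono// -addrA -opprD lerD2l lerN2.
Qed.

(* On a block [f] and [g] are nearly constant, and by periodicity the rest is a
   Riemann-Stieltjes sum of [rho] against [rhot] over one period. *)
Lemma block_asymp (eps : R) : 0 < eps -> exists K : nat, forall k y, (K <= k)%N ->
  k%:R * T + T <= y / 2 ->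
  `|expR (- y / p) * block k y - expR (- y / p) * J y * (g (k%:R * T) * f (y - k%:R * T))|
    <= eps * (g (k%:R * T) * f (y - k%:R * T)).
Proof.
move=> eps0; have e2 : 0 < eps / 2 by rewrite divr_gt0.
have [N N0 hN] := rs_gap p0 T0 s_cont sT s_gt0 rhot_mono e2.
have [D DE] : exists D, D = exp_weight p st T - exp_weight p st 0 by eexists.
have D0 : 0 <= D by rewrite DE subr_ge0; apply: rhot_mono; exact: ltW.
have [W W0 hW] : exists2 W : R, 0 < W & forall y i, (i <= N)%N ->
    expR (- y / p) * exp_weight p s (y - i%:R * (T / N%:R)) <= W.
  have S0 : 0 < S by exact: lt_le_trans (s_gt0 0) (sS 0).
  exists (expR (T / p) * S); first by rewrite mulr_gt0 ?expR_gt0.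
  move=> y i iN.
  have xT : `|- (i%:R * (T / N%:R))| <= T.
    rewrite normrN ger0_norm ?mulr_ge0 ?divr_ge0 ?(ltW T0)//.
    by rewrite mulrCA ler_piMr ?(ltW T0)// ler_pdivrMr ?ltr0n// mul1r ler_nat.
  have := exp_weight_le p0 s_gt0 sS y xT => h.
  have := ler_wpM2l (expR_ge0 (- y / p)) h; move/le_trans; apply.
  by rewrite mulrCA -expRD mulNr addNr expR0 mulr1.
(* [d * Q] covers the errors accumulated over the [N] products in [sumE]; [d <= 1] lets [d * d] be
   absorbed into [d]. *)
pose Q := 2 * N%:R * W + D + 2 * N%:R + 1.
have Q0 : 0 < Q.
  by rewrite ltr_wpDl// !addr_ge0// !mulr_ge0 ?ler0n// ltW.
pose d := Num.min 1 (eps / 2 / Q).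
have d0 : 0 < d by rewrite lt_min ltr01 divr_gt0.
have d1 : d <= 1 by rewrite ge_min lexx.
have dQ : d * Q <= eps / 2 by rewrite -ler_pdivlMr// ge_min lexx orbT.
have [Z hZ] := count_local p0 fs s_gt0 sS nf d0 (ltW T0).
have [Z' hZ'] := count_local p0 gs st_gt0 stS mg d0 (ltW T0).
exists (Num.truncn ((`|Z| + `|Z'|) / T)).+1 => k y Kk ky.
have kZ : `|Z| + `|Z'| <= k%:R * T.
  rewrite -ler_pdivrMr//; apply: le_trans (ltW (truncnS_gt _)) _.
  by rewrite ler_nat.
have z1 := ler_norm Z; have z2 := ler_norm Z'.
have z3 := normr_ge0 Z; have z4 := normr_ge0 Z'.
have Tpos := T0.
pose x (i : nat) := i%:R * (T / N%:R).
have xT i : (i <= N)%N -> `|x i| <= T.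
  move=> iN; rewrite ger0_norm ?mulr_ge0 ?divr_ge0 ?(ltW T0)//.
  by rewrite /x mulrCA ler_piMr ?(ltW T0)// ler_pdivrMr ?ltr0n// mul1r ler_nat.
pose z := y - k%:R * T; pose G := g (k%:R * T); pose F := f z.
have F0 : 0 < F by exact: fs.1.
have G0 : 0 < G by exact: gs.1.
pose a i := expR (- y / p) * exp_weight p s (y - x i).
(* [X i] and [Y i] are the counts at the nodes, rescaled by [expR (- z / p)] and
   [expR (- (k%:R * T) / p)]. By periodicity the shift by [k%:R * T] only produces an exponential
   factor, so they approximate [F * a i] and [G * b i], where [b] is independent of [k]. *)
pose X i := expR (- z / p) * (n (z - x i))%:R.
have Xa i : (i <= N)%N -> `|X i - F * a i| <= d * F.
  move=> iN; have := hZ z (- x i); rewrite normrN => /(_ _ (xT _ iN)).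
  have -> : Z <= z by rewrite /z; lra.
  move=> /(_ isT)/(ler_wpM2l (expR_ge0 (- z / p))).
  rewrite -{1}(ger0_norm (expR_ge0 (- z / p))) -normrM mulrBr.
  have -> : expR (- z / p) * (d * (f z * expR (z / p))) = d * F.
    by rewrite mulrCA (mulrCA _ (f z)) -expRD mulNr addNr expR0 mulr1.
  have -> : expR (- z / p) * (f z * exp_weight p s (z - x i)) = F * a i; last by [].
  rewrite mulrCA; congr (_ * _).
  have -> : z - x i = y - x i + (- (k%:Z))%:~R * T.
    by rewrite /z mulrNz mulNr addrAC.
  rewrite exp_weight_shift// mulrA -expRD /a; congr (expR _ * _).
  by rewrite /z mulrNz -mulrDl; congr (_ / _); rewrite mulNr opprB addrAC subrr add0r.
pose b i := exp_weight p st (x i).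
pose Y i := expR (- (k%:R * T) / p) * (m (k%:R * T + x i))%:R.
have Yb i : (i <= N)%N -> `|Y i - G * b i| <= d * G.
  move=> iN; have := hZ' (k%:R * T) (x i) _ (xT _ iN).
  have -> : Z' <= k%:R * T by lra.
  move=> /(_ isT)/(ler_wpM2l (expR_ge0 (- (k%:R * T) / p))).
  rewrite -{1}(ger0_norm (expR_ge0 (- (k%:R * T) / p))) -normrM mulrBr.
  have -> : expR (- (k%:R * T) / p) * (d * (g (k%:R * T) * expR (k%:R * T / p))) = d * G.
    by rewrite mulrCA (mulrCA _ (g _)) -expRD mulNr addNr expR0 mulr1.
  have -> : expR (- (k%:R * T) / p) * (g (k%:R * T) * exp_weight p st (k%:R * T + x i)) = G * b i; last by [].
  rewrite mulrCA; congr (_ * _).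
  rewrite addrC (exp_weight_shift _ stT k) mulrA -expRD -mulrDl.
  by rewrite addNr mul0r expR0 mul1r.
have a0 i : 0 <= a i by rewrite mulr_ge0 ?expR_ge0// ltW// exp_weight_gt0.
have aW i : (i <= N)%N -> a i <= W by exact: hW.
have b0 i : 0 <= b i.+1 - b i by exact: rs_increment_ge0.
have bD : \sum_(0 <= i < N) (b i.+1 - b i) = D by rewrite DE; exact: rs_increment_sum.
have Y0 i : 0 <= Y i.+1 - Y i.
  rewrite -mulrBr mulr_ge0 ?expR_ge0// subr_ge0 ler_nat m_mono// lerD2l.
  by rewrite ler_wpM2r ?ler_nat// divr_ge0// ltW.
have eyz : expR (- y / p) = expR (- z / p) * expR (- (k%:R * T) / p).
  have -> : - y = - z - k%:R * T by rewrite /z opprB addrAC subrr sub0r.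
  by rewrite mulrDl expRD.
have /andP[bl bu] := block_bounds k y N0.
have U : expR (- y / p) * block k y <= \sum_(0 <= i < N) X i * (Y i.+1 - Y i).
  apply: le_trans (ler_wpM2l (expR_ge0 _) bu) _.
  rewrite mulr_sumr; apply: ler_sum => i _.
  by rewrite eyz -mulrBr mulrACA.
have L : \sum_(0 <= i < N) X i.+1 * (Y i.+1 - Y i) <= expR (- y / p) * block k y.
  apply: le_trans _ (ler_wpM2l (expR_ge0 _) bl).
  rewrite mulr_sumr; apply: ler_sum => i _.
  by rewrite eyz -mulrBr mulrACA.
have sumc (c : R) : \sum_(0 <= i < N) c = N%:R * c.
  by rewrite sumr_const_nat subn0 -[LHS]mulr_natl.
have termE i j : (i < N)%N -> (j <= N)%N ->
    `|X j * (Y i.+1 - Y i) - F * G * (a j * (b i.+1 - b i))|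
      <= F * G * (2 * d * W + d * (b i.+1 - b i) + 2 * d).
  move=> iN jN; clear kZ z1 z2 z3 z4 ky D0 DE bD U L eps0 e2 Q0 dQ eyz bl bu.
  have hx := Xa _ jN; have hy1 := Yb _ iN; have hy0 := Yb _ (ltnW iN).
  have ha := a0 j; have hW' := aW _ jN; have hb := b0 i; have hY := Y0 i.
  have hyd : `|(Y i.+1 - Y i) - G * (b i.+1 - b i)| <= 2 * d * G.
    have -> : Y i.+1 - Y i - G * (b i.+1 - b i) =
      (Y i.+1 - G * b i.+1) - (Y i - G * b i) by ring.
    by apply: le_trans (ler_normB _ _) _; lra.
  move: hx hyd ha hW' hb hY; move: (X j) (Y i.+1 - Y i) (a j) (b i.+1 - b i).
  move=> xx yy aa bb hx hyd ha hW' hb hY.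
  have -> : xx * yy - F * G * (aa * bb) =
     (xx - F * aa) * yy + F * aa * (yy - G * bb) by ring.
  apply: le_trans (ler_normD _ _) _; rewrite !normrM (ger0_norm hY).
  rewrite (ger0_norm ha) (ger0_norm (ltW F0)).
  have yyb : yy <= G * bb + 2 * d * G.
    by move: hyd; rewrite ler_norml => /andP[_]; lra.
  have t1 : `|xx - F * aa| * yy <= d * F * (G * bb + 2 * d * G).
    by apply: ler_pM.
  have t2 : F * aa * `|yy - G * bb| <= F * W * (2 * d * G).
    by apply: ler_pM => //; [rewrite mulr_ge0// ltW|rewrite ler_pM2l].
  have t3 : F * G * (2 * d * d) <= F * G * (2 * d).
    rewrite ler_pM2l ?mulr_gt0// ler_piMr// mulr_ge0// ltW//.
  by move: t1 t2 t3; rewrite (_ : d * F * _ = F * G * (d * bb) + F * G * (2 * d * d));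
    [move=> t1 t2 t3|ring]; apply: le_trans (lerD t1 t2) _; lra.
have sumE (c : nat -> nat) : (forall i, (i < N)%N -> (c i <= N)%N) ->
    `|\sum_(0 <= i < N) X (c i) * (Y i.+1 - Y i)
      - F * G * \sum_(0 <= i < N) a (c i) * (b i.+1 - b i)| <= F * G * (eps / 2).
  move=> cN; rewrite mulr_sumr -sumrB.
  apply: le_trans (ler_norm_sum _ _ _) _.
  apply: (@le_trans _ _ (\sum_(0 <= i < N)
     F * G * (2 * d * W + d * (b i.+1 - b i) + 2 * d))).
    by rewrite !big_nat; apply: ler_sum => i /andP[_ iN]; apply: termE => //; exact: cN.
  rewrite -mulr_sumr ler_pM2l ?mulr_gt0//.
  rewrite big_split big_split/= !sumc -mulr_sumr bD.
  apply: le_trans dQ; rewrite /Q.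
  have -> : d * (2 * N%:R * W + D + 2 * N%:R + 1) =
     N%:R * (2 * d * W) + d * D + N%:R * (2 * d) + d by ring.
  by rewrite lerDl ltW.
have UE : \sum_(0 <= i < N) a i * (b i.+1 - b i) = expR (- y / p) * rs_upper p T s st N y.
  by rewrite mulr_sumr; apply: eq_bigr => i _; rewrite mulrA.
have LE : \sum_(0 <= i < N) a i.+1 * (b i.+1 - b i) = expR (- y / p) * rs_lower p T s st N y.
  by rewrite mulr_sumr; apply: eq_bigr => i _; rewrite mulrA.
have hU := sumE id (fun i iN => ltnW iN); have hL := sumE succn (fun i iN => iN).
move: hU hL; rewrite UE LE => hU hL.
have ey := expR_gt0 (- y / p).
have gap : expR (- y / p) * rs_upper p T s st N y - expR (- y / p) * rs_lower p T s st N y <= eps / 2.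
  rewrite -mulrBr; apply: le_trans (ler_wpM2l (ltW ey) (hN y)) _.
  by rewrite mulrCA -expRD mulNr addNr expR0 mulr1.
have /andP[Jl Ju] := JE y N0.
have {}Jl : expR (- y / p) * rs_lower p T s st N y <= expR (- y / p) * J y by rewrite ler_pM2l.
have {}Ju : expR (- y / p) * J y <= expR (- y / p) * rs_upper p T s st N y by rewrite ler_pM2l.
have FG0 : 0 < F * G by rewrite mulr_gt0.
rewrite -/z -/G -/F (mulrC G F) ler_norml.
move: hU hL; rewrite !ler_norml => /andP[_ hU] /andP[hL _].
move: gap Jl Ju U L hU hL; move: (expR _ * rs_upper _ _ _ _ _ _) (expR _ * rs_lower _ _ _ _ _ _).
move: (expR _ * J y) (expR _ * block k y) => j q u l gap jl ju qU qL hU hL.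
clear kZ z1 z2 z3 z4 ky D0 DE bD e2 Q0 dQ eyz bl bu F0 G0 d0 d1 W0 ey Tpos.
have k1 : F * G * u <= F * G * (j + eps / 2) by rewrite ler_pM2l//; lra.
have k2 : F * G * (j - eps / 2) <= F * G * l by rewrite ler_pM2l//; lra.
by apply/andP; split; lra.
Qed.

Definition second_sum (y : R) : R := \sum_(0 <= j < m (y / 2)) (n (y - v j))%:R.

Let Ey (y : R) : expR (y / p) = expR (y / 2 / p) * expR (y / 2 / p).
Proof. by rewrite -expRD -mulrDl -splitr. Qed.

(** The two factors [expR (y / 2 / p)] multiply to [expR (y / p)]. The shift by [T] serves the
    incomplete block before [y / 2], where [y - v j] may reach [y / 2 + T]. *)
Lemma half_count_le : exists C Y : R, 0 < C /\ forall y, Y <= y ->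
  (n (y / 2 + T))%:R * (m (y / 2))%:R <= C * expR (y / p) * (f (y / 2) * g (y / 2)).
Proof.
have [C [Z [C0 hC]]] := count_shift p0 fs s_gt0 sS nf T.
have [C' [Z' [C'0 hC']]] := count_shift p0 gs st_gt0 stS mg 0.
exists (C * C'), (2 * (`|Z| + `|Z'|)); split; first exact: mulr_gt0.
move=> y hy.
have z1 := ler_norm Z; have z2 := ler_norm Z'.
have z3 := normr_ge0 Z; have z4 := normr_ge0 Z'.
have h1 : (n (y / 2 + T))%:R <= C * (f (y / 2) * expR (y / 2 / p)) by apply: hC; lra.
have h2 : (m (y / 2))%:R <= C' * (g (y / 2) * expR (y / 2 / p)).
  by have := hC' (y / 2); rewrite addr0; apply; lra.
apply: le_trans (ler_pM _ _ h1 h2) _ => //.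
by rewrite le_eqVlt; apply/orP; left; apply/eqP; rewrite (Ey y); ring.
Qed.

Lemma second_sum_asymp (eps : R) : 0 < eps -> exists Y, forall y, Y <= y ->
  `|expR (- y / p) * second_sum y - expR (- y / p) * J y * block_conv T f g y|
    <= eps * block_conv T f g y.
Proof.
move=> eps0.
pose q k y := expR (- y / p) * block k y.
(* [extra] collects the indices with [v j < 0], that is the eigenvalues above 1, and the incomplete
   block that ends at [y / 2]. *)
pose extra y := expR (- y / p) * (\sum_(0 <= j < m 0) (n (y - v j))%:R +
   \sum_(m ((nblocks T y)%:R * T) <= j < m (y / 2)) (n (y - v j))%:R).
have expK y : expR (- y / p) * expR (y / p) = 1.
  by rewrite -expRD mulNr addNr expR0.
have cN : {homo (fun i : nat => m (i%:R * T)) : i j / (i <= j)%N}.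
  by move=> i j ij; apply: m_mono; rewrite ler_pM2r// ler_nat.
have split y : 0 <= y -> expR (- y / p) * second_sum y =
    \sum_(0 <= k < nblocks T y) q k y + extra y.
  move=> y0; rewrite -mulr_sumr -mulrDr; congr (_ * _).
  have hM := nblocks_le T0 y0.
  rewrite /second_sum (@big_cat_nat _ _ _ (m 0))//=; last by apply: m_mono; rewrite divr_ge0.
  rewrite addrCA; congr (_ + _).
  rewrite (@big_cat_nat _ _ _ (m ((nblocks T y)%:R * T)))//=; last first.
    exact: m_mono.
    by apply: m_mono; rewrite mulr_ge0// ltW.
  congr (_ + _); have := big_nat_blocks (fun j => (n (y - v j))%:R : R) (nblocks T y) cN.
  rewrite mul0r => ->; apply: eq_bigr => k _.
  by rewrite /block -natr1 mulrDl mul1r.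
have [S0 _] : 0 < S /\ True by split => //; exact: lt_le_trans (s_gt0 0) (sS 0).
have qb k : exists C Y : R, forall y, Y <= y -> `|q k y| <= C * f y.
  have [C [Z [C0 hC]]] := count_shift p0 fs s_gt0 sS nf (- (k%:R * T)).
  exists (C * (m (k%:R * T + T))%:R), Z => y Zy.
  have b0 : 0 <= block k y by apply: sumr_ge0.
  rewrite ger0_norm; last by rewrite mulr_ge0// expR_ge0.
  rewrite /q; have := sum_count_le (k%:R * T) (k%:R * T + T) y => h1.
  have h2 := hC _ Zy.
  apply: le_trans (ler_wpM2l (expR_ge0 _) h1) _.
  apply: le_trans (ler_wpM2l (expR_ge0 _) (ler_wpM2r (ler0n _ _) h2)) _.
  rewrite le_eqVlt; apply/orP; left; apply/eqP.
  rewrite -[RHS]mul1r -(expK y); ring.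
have [C1 [Y1 [C10 hC1]]] := half_count_le.
have [C2 [Y2 hC2]] : exists C Y : R, forall y, Y <= y ->
   expR (- y / p) * \sum_(0 <= j < m 0) (n (y - v j))%:R <= C * f y.
  elim: (m 0) => [|M [C [Y hC]]].
    by exists 0, 0 => y _; rewrite big_geq// mulr0 mul0r.
  have [C' [Z [C'0 hC']]] := count_shift p0 fs s_gt0 sS nf (- v M).
  exists (C + C'), (Num.max Y Z) => y; rewrite ge_max => /andP[yY yZ].
  rewrite big_nat_recr//= mulrDr mulrDl lerD ?hC//.
  apply: le_trans (ler_wpM2l (expR_ge0 _) (hC' _ yZ)) _.
  by rewrite mulrCA (mulrCA _ (f y)) expK mulr1.
(* The sums with [N = 1] already bound [J]. *)
have [Cc hCc] : exists Cc, forall y, `|expR (- y / p) * J y| <= Cc.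
  exists (expR (T / p) * S * (exp_weight p st T - exp_weight p st 0)) => y.
  have /andP[l u] := @JE 1 y isT.
  move: l u; rewrite /rs_lower /rs_upper !big_nat1 !mul0r !divr1 !mul1r subr0 => l u.
  have D0 : 0 <= exp_weight p st T - exp_weight p st 0.
    by rewrite subr_ge0; apply: rhot_mono; exact: ltW.
  have r0 := exp_weight_gt0 p s_gt0 (y - T).
  have J0 : 0 <= J y by apply: le_trans l; rewrite mulr_ge0// ltW.
  rewrite ger0_norm ?mulr_ge0 ?expR_ge0//.
  apply: le_trans (ler_wpM2l (expR_ge0 _) u) _; rewrite mulrA ler_wpM2r//.
  have T0' : `|0 : R| <= T by rewrite normr0 ltW.
  have := exp_weight_le p0 s_gt0 sS y T0'; rewrite addr0.
  move=> /(ler_wpM2l (expR_ge0 (- y / p))); move/le_trans; apply.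
  have eK := expK y.
  by rewrite (mulrCA (expR (- y / p))) [X in _ * X <= _]eK mulr1 lexx.
have [|Y hY] := @block_conv_asymp R T f g T0 fs gs gdiv q extra
   (fun y => expR (- y / p) * J y) (`|C1| + `|C2|) Cc (fun e e0 => block_asymp e0)
   qb hCc _ eps eps0.
  exists (Num.max (Num.max Y1 Y2) 0) => y; rewrite !ge_max => /andP[/andP[y1 y2] y0].
  have h1 := hC1 _ y1; have h2 := hC2 _ y2.
  have fy := fs.1 y; have fg : 0 < f (y / 2) * g (y / 2).
    by rewrite mulr_gt0 ?(fs.1) ?(gs.1).
  rewrite /extra ger0_norm; last first.
    by rewrite mulr_ge0 ?expR_ge0// addr_ge0// sumr_ge0.
  have h3 : \sum_(m ((nblocks T y)%:R * T) <= j < m (y / 2)) (n (y - v j))%:R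
      <= (n (y / 2 + T))%:R * (m (y / 2))%:R :> R.
    apply: le_trans (sum_count_le _ _ _) _; rewrite ler_wpM2r// ler_nat n_mono//.
    by have := nblocks_gt T0 y; lra.
  have h4 : expR (- y / p) * ((n (y / 2 + T))%:R * (m (y / 2))%:R) <= C1 * (f (y / 2) * g (y / 2)).
    apply: le_trans (ler_wpM2l (expR_ge0 _) h1) _.
    rewrite le_eqVlt; apply/orP; left; apply/eqP.
    rewrite -[RHS]mul1r -(expK y); ring.
  have h5 := ler_wpM2l (expR_ge0 (- y / p)) h3.
  have e1 : C1 * (f (y / 2) * g (y / 2)) <= `|C1| * (f (y / 2) * g (y / 2)).
    by rewrite ler_pM2r// ler_norm.
  have e2 : C2 * f y <= `|C2| * f y by rewrite ler_pM2r// ler_norm.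
  have e3 : 0 <= `|C2| * (f (y / 2) * g (y / 2)) by rewrite mulr_ge0// ltW.
  have e4 : 0 <= `|C1| * f y by rewrite mulr_ge0// ltW.
  rewrite mulrDr; move: h2 h4 h5 e1 e2 e3 e4.
  move: (f (y / 2) * g (y / 2)) (f y) `|C1| `|C2| => P F c1 c2.
  by move=> *; lra.
exists (Num.max Y 0) => y; rewrite ge_max => /andP[yY y0].
by rewrite split//; exact: hY.
Qed.

Lemma half_product_small (eps : R) : 0 < eps -> exists Y, forall y, Y <= y ->
  expR (- y / p) * ((n (y / 2))%:R * (m (y / 2))%:R) <= eps * block_conv T f g y.
Proof.
move=> eps0; have [C [Y [C0 hC]]] := half_count_le.
have [Y' hY'] := block_conv_dom_half T0 fs gs (C / eps).
exists (Num.max Y Y') => y; rewrite ge_max => /andP[yY yY'].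
have h1 := hC _ yY; have h2 := hY' _ yY'.
have h3 : C * (f (y / 2) * g (y / 2)) <= eps * block_conv T f g y.
  rewrite -ler_pdivrMl//; apply: le_trans h2.
  by rewrite le_eqVlt; apply/orP; left; apply/eqP; ring.
apply: le_trans h3.
apply: (@le_trans _ _ (expR (- y / p) * ((n (y / 2 + T))%:R * (m (y / 2))%:R))).
  by rewrite ler_pM2l ?expR_gt0// ler_wpM2r// ler_nat n_mono// lerDl ltW.
apply: le_trans (ler_wpM2l (expR_ge0 _) h1) _.
have -> : expR (- y / p) * (C * expR (y / p) * (f (y / 2) * g (y / 2))) =
    expR (- y / p) * expR (y / p) * (C * (f (y / 2) * g (y / 2))) by ring.
by rewrite -expRD mulNr addNr expR0 mul1r.
Qed.

End SecondSum.

(** * The derivative of the periodic convolution *)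

Section IntervalFunctional.
Variables (R : realType) (T : R) (Phi lo hi : R -> R -> R).
Hypotheses (T0 : 0 <= T).
Hypothesis PhiD : forall a b c, 0 <= a -> a <= b -> b <= c -> Phi a c = Phi a b + Phi b c.
Hypothesis Phi0 : Phi 0 0 = 0.
Hypothesis Phi_lo : forall a b, 0 <= a -> a <= b -> b <= T -> lo a b <= Phi a b.
Hypothesis Phi_hi : forall a b, 0 <= a -> a <= b -> b <= T -> Phi a b <= hi a b.

(** Stated for an additive functional of intervals, so as to serve both the Stieltjes integral and
    the difference quotients of [exp_conv]. *)
Lemma interval_functional_sum N : (0 < N)%N ->
  \sum_(0 <= i < N) lo (i%:R * (T / N%:R)) (i.+1%:R * (T / N%:R)) <= Phi 0 T <=
  \sum_(0 <= i < N) hi (i%:R * (T / N%:R)) (i.+1%:R * (T / N%:R)).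
Proof.
move=> N0; have h0 : 0 <= T / N%:R by rewrite divr_ge0.
have pos i : 0 <= i%:R * (T / N%:R) by rewrite mulr_ge0.
have step i : i%:R * (T / N%:R) <= i.+1%:R * (T / N%:R) by rewrite ler_wpM2r// ler_nat.
have NT : N%:R * (T / N%:R) = T by rewrite mulrC divfK// pnatr_eq0 -lt0n.
have -> : Phi 0 T = \sum_(0 <= i < N) Phi (i%:R * (T / N%:R)) (i.+1%:R * (T / N%:R)).
  have key n : Phi 0 (n%:R * (T / N%:R)) =
      \sum_(0 <= i < n) Phi (i%:R * (T / N%:R)) (i.+1%:R * (T / N%:R)).
    elim: n => [|n IH]; first by rewrite big_geq// mul0r.
    by rewrite big_nat_recr//= -IH -PhiD.
  by rewrite -key NT.
have bT i : (i < N)%N -> i.+1%:R * (T / N%:R) <= T.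
  by move=> iN; rewrite -[leRHS]NT ler_wpM2r// ler_nat.
by apply/andP; split; rewrite !big_nat; apply: ler_sum => i /andP[_ iN];
  [apply: Phi_lo|apply: Phi_hi] => //; exact: bT.
Qed.

End IntervalFunctional.

Lemma lebesgue_stieltjes_measure_itvoc (R : realType) (f : cumulative R R) (a b : R) :
  a <= b -> lebesgue_stieltjes_measure f `]a, b]%classic = (f b - f a)%:E.
Proof.
move=> ab; rewrite /lebesgue_stieltjes_measure/= /measure_extension/=.
rewrite measurable_mu_extE; last exact: is_ocitv.
exact: wlength_itv_bnd.
Qed.

(** * The Stieltjes integral as a limit of Riemann-Stieltjes sums *)

Section Stieltjes.
Variables (R : realType) (p T : R) (s st : R -> R).
Hypotheses (T0 : 0 < T) (s_cont : continuous s) (st_cont : continuous st).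
Hypotheses (s_gt0 : forall x, 0 < s x).
Hypothesis rho_mono : nondecreasing (exp_weight p s).
Hypothesis rhot_mono : nondecreasing (exp_weight p st).
Local Notation rho := (exp_weight p s).
Local Notation rhot := (exp_weight p st).
Local Notation nu := (lebesgue_stieltjes_measure (exp_weight_cumulative st_cont rhot_mono)).

Lemma exp_weight_continuous (q : R) (r : R -> R) : continuous r -> continuous (exp_weight q r).
Proof.
move=> cr x; apply: cvgM; last exact: cr.
by apply: continuous_comp; [exact: mulrr_continuous|exact: continuous_expR].
Qed.

Lemma stieltjes_itv a b : a <= b -> nu `]a, b]%classic = (rhot b - rhot a)%:E.
Proof. exact: lebesgue_stieltjes_measure_itvoc. Qed.

(** [rhot] is continuous, so points carry no mass; this lets [[0, T]] be replaced by []0, T]], which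
    splits into half-open intervals. *)
Lemma stieltjes_set1 a : nu [set a] = 0%E.
Proof.
apply/eqP; rewrite eq_le measure_ge0 andbT.
apply/lee_addgt0Pr => e e0; rewrite add0e.
have /cvgrPdist_lt/(_ _ e0)/nbhs_ballP[r /= r0 hr] := @exp_weight_continuous p st st_cont a.
have r2 : 0 < r / 2 by rewrite divr_gt0.
have ar : a - r / 2 <= a by rewrite gerBl ltW.
have sub : [set a] `<=` `]a - r / 2, a]%classic.
  by move=> x -> /=; rewrite in_itv/= lexx andbT ltrBlDr ltrDl.
apply: le_trans (le_measure _ _ _ sub) _; rewrite ?inE.
- exact: measurable_set1.
- exact: measurable_itv.
rewrite [X in (X <= _)%E]stieltjes_itv// lee_fin.
have : ball a r (a - r / 2).
  by rewrite -ball_normE/= opprB addrC subrK ger0_norm ?(ltW r2)// ltr_pdivrMr// ltr_pMr// ltr1n.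
by move/hr => h; apply: le_trans (ltW h); exact: ler_norm.
Qed.

Lemma integrable_exp_weight_itv y a b : nu.-integrable `]a, b]%classic (EFin \o (fun x => rho (y - x))).
Proof.
have [ab|ba] := leP a b; last first.
  by rewrite set_itv_ge ?bnd_simp ?(ltW ba) -?leNgt ?(ltW ba)//; exact: integrable_set0.
apply: measurable_bounded_integrable.
- exact: measurable_itv.
- by rewrite [X in (X < _)%E]stieltjes_itv// ltry.
- have mf : measurable_fun [set: R] (fun x => rho (y - x)).
    apply: measurable_realfun.continuous_measurable_fun => x.
    apply: (@continuous_comp _ _ _ (fun x => y - x) rho).
      by apply: cvgB; [exact: cvg_cst|exact: cvg_id].
    exact: exp_weight_continuous.
  exact: measurable_funTS mf.
exists (rho (y - a)); split; first exact: num_real.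
move=> M hM x /=; rewrite in_itv/= => /andP[ax xb].
rewrite ger0_norm; last by rewrite ltW// exp_weight_gt0.
by apply: le_trans (ltW hM); apply: rho_mono; rewrite lerD2l lerN2 ltW.
Qed.

Lemma integrable_cst_itv c a b : nu.-integrable `]a, b]%classic (EFin \o (fun=> c : R)).
Proof.
have [ab|ba] := leP a b; last first.
  by rewrite set_itv_ge ?bnd_simp ?(ltW ba) -?leNgt ?(ltW ba)//; exact: integrable_set0.
apply: measurable_bounded_integrable.
- exact: measurable_itv.
- by rewrite [X in (X < _)%E]stieltjes_itv// ltry.
- exact: measurable_cst.
- by exists `|c|; split; [exact: num_real|move=> M hM x _; exact: ltW].
Qed.

Definition stieltjes_conv (y : R) : R := \int[nu]_(x in `[0, T]) rho (y - x).

Let oc y a b : R := \int[nu]_(x in `]a, b]) rho (y - x).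

Lemma disjoint_oc (a b c : R) : [disjoint `]a, b]%classic & `]b, c]%classic].
Proof.
apply/disj_setPS => x [] /=; rewrite !in_itv/= => /andP[_ xb] /andP[bx _].
by move: (lt_le_trans bx xb); rewrite ltxx.
Qed.

Lemma stieltjes_convE y : stieltjes_conv y = oc y 0 T.
Proof.
have U : `[0, T]%classic = [set 0] `|` `]0, T]%classic :> set R.
  by rewrite setU1itv// bnd_simp ltW.
rewrite /stieltjes_conv /oc U Rintegral_setU.
- rewrite [X in X + _](_ : _ = 0) ?add0r// /Rintegral.
  rewrite null_set_integral; [by []|exact: measurable_set1| |exact: stieltjes_set1].
  exact: measurable_fun_set1.
- exact: measurable_set1.
- exact: measurable_itv.
- rewrite -U; apply: integrableS (integrable_exp_weight_itv y (-1) T).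
  + exact: measurable_itv.
  + exact: measurable_itv.
  + by apply: subset_itvr; rewrite bnd_simp ltrN10.
- apply/disj_setPS => x [/= -> ]; rewrite in_itv/= ltxx//.
Qed.

Lemma stieltjes_rs N y : (0 < N)%N ->
  rs_lower p T s st N y <= stieltjes_conv y <= rs_upper p T s st N y.
Proof.
move=> N0; rewrite stieltjes_convE.
have ocD a b c : 0 <= a -> a <= b -> b <= c -> oc y a c = oc y a b + oc y b c.
  move=> _ ab bc; have U : `]a, c]%classic = `]a, b]%classic `|` `]b, c]%classic :> set R.
    by rewrite -itv_bndbnd_setU ?bnd_simp.
  rewrite /oc U Rintegral_setU; [by []|exact: measurable_itv|exact: measurable_itv| |].
    by rewrite -U; exact: integrable_exp_weight_itv.
  exact: disjoint_oc.
apply: (@interval_functional_sum R T (oc y)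
  (fun a b => rho (y - b) * (rhot b - rhot a)) (fun a b => rho (y - a) * (rhot b - rhot a))) => //.
- exact: ltW.
- by rewrite /oc set_itv_ge ?bnd_simp// Rintegral_set0.
- move=> a b _ ab _.
  apply: (@le_trans _ _ (\int[nu]_(x in `]a, b]) rho (y - b))).
    rewrite Rintegral_cst; last exact: measurable_itv.
    by rewrite [X in fine X]stieltjes_itv.
  apply: le_Rintegral; [exact: measurable_itv| | |].
    exact: integrable_cst_itv.
    exact: integrable_exp_weight_itv.
  move=> x /=; rewrite in_itv/= => /andP[ax xb].
  by apply: rho_mono; rewrite lerD2l lerN2.
- move=> a b _ ab _.
  apply: (@le_trans _ _ (\int[nu]_(x in `]a, b]) rho (y - a))); last first.
    rewrite Rintegral_cst; last exact: measurable_itv.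
    by rewrite [X in fine X]stieltjes_itv.
  apply: le_Rintegral; [exact: measurable_itv| | |].
    exact: integrable_exp_weight_itv.
    exact: integrable_cst_itv.
  move=> x /=; rewrite in_itv/= => /andP[ax xb].
  by apply: rho_mono; rewrite lerD2l lerN2 ltW.
Qed.

End Stieltjes.

Section Primitive.
Variable R : realType.
Local Notation mu := (@lebesgue_measure R).

Lemma continuous_integrable_itv (f : R -> R) a b : continuous f ->
  mu.-integrable `[a, b] (EFin \o f).
Proof.
move=> cf; apply: continuous_compact_integrable; first exact: segment_compact.
exact: continuous_subspaceT.
Qed.

(** The primitive is an integral from [A], hence a primitive on a bounded interval; the derivative
    of [exp_conv] at a point involves only such an interval. *)
Lemma continuous_primitive (f : R -> R) (A B : R) : continuous f ->
  exists F : R -> R, forall x, A < x < B -> is_derive x 1 F (f x).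
Proof.
move=> cf; exists (fun x => \int[mu]_(t in `[A, x]) f t) => x /andP[Ax xB].
have [d e] := @continuous_FTC1_closed R f A x B xB (continuous_integrable_itv A B cf) Ax (cf x).
by apply: DeriveDef; [exact: d|rewrite -derive1E; exact: e].
Qed.

Lemma Rintegral_primitive (f F : R -> R) (a b : R) : a <= b -> continuous f ->
  (forall x, a <= x <= b -> is_derive x 1 F (f x)) ->
  \int[mu]_(x in `[a, b]) f x = F b - F a.
Proof.
rewrite le_eqVlt => /predU1P[-> _ _|ab cf dF].
  by rewrite set_itv1 Rintegral_set1 subrr.
have cF x : a <= x <= b -> {for x, continuous F}.
  by move=> /dF d; apply: differentiable_continuous; exact/derivable1_diffP.
rewrite /Rintegral (@continuous_FTC2 R f F a b)//.
- exact: continuous_subspaceT.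
- split.
  + by move=> x; rewrite in_itv/= => /andP[ax xb]; have [] := dF x; rewrite ?(ltW ax) ?(ltW xb).
  + by apply: cvg_at_right_filter; apply: cF; rewrite lexx ltW.
  + by apply: cvg_at_left_filter; apply: cF; rewrite lexx ltW.
- move=> x; rewrite in_itv/= => /andP[ax xb]; rewrite derive1E.
  have abx : a <= x <= b by rewrite (ltW ax) (ltW xb).
  exact: (@derive_val _ _ _ _ _ _ _ (dF _ abx)).
Qed.

End Primitive.

Section PeriodicConvolution.
Variables (R : realType) (p T : R) (s st J : R -> R).
Hypotheses (p0 : 0 < p) (T0 : 0 < T) (s_cont : continuous s) (st_cont : continuous st).
Hypotheses (sT : periodic s T) (stT : periodic st T).
Hypothesis s_gt0 : forall x, 0 < s x.
Hypothesis rho_mono : nondecreasing (exp_weight p s).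
Hypothesis rhot_mono : nondecreasing (exp_weight p st).
Hypothesis JE : forall N y, (0 < N)%N ->
  rs_lower p T s st N y <= J y <= rs_upper p T s st N y.
Local Notation rho := (exp_weight p s).
Local Notation rhot := (exp_weight p st).
Local Notation mu := (@lebesgue_measure R).

Lemma rs_approx (d : R) : 0 < d -> exists2 N : nat, (0 < N)%N &
  forall y, `|J y - rs_upper p T s st N y| <= d * expR (y / p).
Proof.
move=> d0; have [N N0 hN] := rs_gap p0 T0 s_cont sT s_gt0 rhot_mono d0.
exists N => // y; have /andP[l u] := JE y N0; have := hN y.
by rewrite ler_norml; move: (rs_upper _ _ _ _ _ _) (rs_lower _ _ _ _ _ _) l u => U L l u h; lra.
Qed.

Let rho_cont : continuous rho. Proof. exact: exp_weight_continuous. Qed.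
Let rhot_cont : continuous rhot. Proof. exact: exp_weight_continuous. Qed.

Lemma cvg_sum_nat (U : Type) (F : set_system U) (FF : Filter F)
    (G : nat -> U -> R) (l : nat -> R) (N : nat) :
  (forall i, G i x @[x --> F] --> l i) ->
  \sum_(0 <= i < N) G i x @[x --> F] --> \sum_(0 <= i < N) l i.
Proof.
move=> h; elim: N => [|N IH].
  rewrite big_geq// (_ : (fun x => _) = fun=> 0); first exact: cvg_cst.
  by apply/funext => x; rewrite big_geq.
rewrite big_nat_recr//= (_ : (fun x => _) = fun x => \sum_(0 <= i < N) G i x + G N x).
  by apply: cvgD.
by apply/funext => x; rewrite big_nat_recr.
Qed.

Lemma rs_upper_continuous N : continuous (rs_upper p T s st N).
Proof.
move=> y; apply: cvg_sum_nat => i; apply: cvgM; last exact: cvg_cst.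
apply: (@continuous_comp _ _ _ (fun y => y - i%:R * (T / N%:R)) rho); last exact: rho_cont.
by apply: cvgB; [exact: cvg_id|exact: cvg_cst].
Qed.

(** On the half-line up to [y + 1], [J] is a uniform limit of the continuous functions
    [rs_upper]. *)
Lemma stieltjes_limit_continuous : continuous J.
Proof.
move=> y; apply/cvgrPdist_le => e e0.
pose M := expR ((y + 1) / p); have M0 : 0 < M by exact: expR_gt0.
have d0 : 0 < e / (3 * M) by rewrite divr_gt0// mulr_gt0.
have [N N0 hN] := rs_approx d0.
have e3 : 0 < e / 3 by rewrite divr_gt0.
have /cvgrPdist_le/(_ _ e3) hU := @rs_upper_continuous N y.
near=> z.
have hz : `|rs_upper p T s st N y - rs_upper p T s st N z| <= e / 3.
  by near: z; exact: hU.
have zy : z <= y + 1.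
  apply: ltW; near: z; apply: lt_nbhsl.
  by rewrite ltrDl.
have b1 x : x <= y + 1 -> `|J x - rs_upper p T s st N x| <= e / 3.
  move=> xy; apply: le_trans (hN x) _.
  apply: (@le_trans _ _ (e / (3 * M) * M)); last first.
    by rewrite le_eqVlt; apply/orP; left; apply/eqP; field; rewrite gt_eqF.
  by rewrite ler_pM2l// ler_expR ler_pM2r ?invr_gt0.
have b2 := b1 _ zy; have yy : y <= y + 1 by rewrite lerDl.
have b3 := b1 _ yy.
move: hz b2 b3; rewrite !ler_norml => /andP[h1 h2] /andP[h3 h4] /andP[h5 h6].
by apply/andP; split; lra.
Unshelve. all: by end_near.
Qed.

(** The convolution of the weighted functions. The two exponentials multiply to [expR (y / p)], so
    it differs from [pconv] only by an explicit factor, while [rho] and [rhot] are monotone, which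
    [s] and [st] are not assumed to be. *)
Definition exp_conv (y : R) : R := \int[mu]_(l in `[0, T]) (rho (y - l) * rhot l).

Lemma pconv_exp y : pconv T s st y = T^-1 * (expR (- y / p) * exp_conv y).
Proof.
rewrite /pconv; congr (_ * _); rewrite /exp_conv -RintegralZl.
- apply: eq_Rintegral => l _; rewrite /exp_weight.
  have -> : expR (- y / p) * (expR ((y - l) / p) * s (y - l) * (expR (l / p) * st l)) =
    expR (- y / p) * expR ((y - l) / p) * expR (l / p) * (s (y - l) * st l) by ring.
  by rewrite -!expRD -!mulrDl addrA addNr sub0r addNr mul0r expR0 mul1r.
- exact: measurable_itv.
apply: continuous_integrable_itv => l; apply: cvgM; last exact: rhot_cont.
apply: (@continuous_comp _ _ _ (fun l => y - l) rho); last exact: rho_cont.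
by apply: cvgB; [exact: cvg_cst|exact: cvg_id].
Qed.

(* Abel summation; the boundary terms [rho (y - x) * rhot x] at [x = 0, T] agree. *)
Lemma rs_abel (N : nat) y : (0 < N)%N ->
  (\sum_(0 <= i < N) rhot (i.+1%:R * (T / N%:R)) *
     (rho (y - i%:R * (T / N%:R)) - rho (y - i.+1%:R * (T / N%:R)))
     = rs_upper p T s st N y) /\
  (\sum_(0 <= i < N) rhot (i%:R * (T / N%:R)) *
     (rho (y - i%:R * (T / N%:R)) - rho (y - i.+1%:R * (T / N%:R)))
     = rs_lower p T s st N y).
Proof.
move=> N0; pose B i := rho (y - i%:R * (T / N%:R)) * rhot (i%:R * (T / N%:R)).
have BN : \sum_(0 <= i < N) (B i.+1 - B i) = 0.
  rewrite telescope_sumr// /B mul0r subr0 (mulrC N%:R) divfK ?pnatr_eq0 -?lt0n//.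
  have e1 : rho y = expR (T / p) * rho (y - T).
    by rewrite -{1}(subrK T y); exact: exp_weight_shiftT.
  have e2 : rhot T = expR (T / p) * rhot 0.
    by rewrite -{1}(add0r T); exact: exp_weight_shiftT.
  by rewrite e1 e2; ring.
split; apply/eqP; rewrite -subr_eq0 -sumrB.
  rewrite -oppr_eq0 -sumrN -[X in _ == X]BN; apply/eqP; apply: eq_bigr => i _.
  by rewrite /B; ring.
rewrite -oppr_eq0 -sumrN -[X in _ == X]BN; apply/eqP; apply: eq_bigr => i _.
by rewrite /B; ring.
Qed.

Let comp_cont (f : R -> R) (c : R) : continuous f -> continuous (fun l => f (c - l)).
Proof.
move=> cf l; apply: (@continuous_comp _ _ _ (fun l => c - l) f); last exact: cf.
by apply: cvgB; [exact: cvg_cst|exact: cvg_id].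
Qed.

(* [rhot] is replaced by its values at the ends of each subinterval; the
   increments of [rho] over [h] integrate to difference quotients of [P]. *)
Lemma exp_conv_quotient_bounds (P : R -> R) (L y h : R) (N : nat) : (0 < N)%N ->
  h != 0 -> `|y| + `|h| + T < L ->
  (forall x, - L < x < L -> is_derive x 1 P (rho x)) ->
  \sum_(0 <= i < N) rhot (i%:R * (T / N%:R)) *
    ((P (y - i%:R * (T / N%:R) + h) - P (y - i%:R * (T / N%:R))) / h -
     (P (y - i.+1%:R * (T / N%:R) + h) - P (y - i.+1%:R * (T / N%:R))) / h)
   <= (exp_conv (y + h) - exp_conv y) / h <=
  \sum_(0 <= i < N) rhot (i.+1%:R * (T / N%:R)) *
    ((P (y - i%:R * (T / N%:R) + h) - P (y - i%:R * (T / N%:R))) / h -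
     (P (y - i.+1%:R * (T / N%:R) + h) - P (y - i.+1%:R * (T / N%:R))) / h).
Proof.
move=> N0 h0 yhL dP.
pose k l := (rho (y + h - l) - rho (y - l)) / h.
have k0 l : 0 <= k l.
  rewrite /k; have [hp|hn] := ltP 0 h.
    by rewrite divr_ge0 ?(ltW hp)// subr_ge0; apply: rho_mono; rewrite lerB// lerDl ltW.
  rewrite mulr_le0 ?invr_le0// subr_le0; apply: rho_mono.
  by rewrite lerB// gerDl.
have ck : continuous k.
  by move=> l; apply: cvgM; [apply: cvgB; exact: comp_cont|exact: cvg_cst].
have ckr : continuous (fun l => rhot l * k l).
  by move=> l; apply: cvgM; [exact: rhot_cont|exact: ck].
pose E l := (P (y - l + h) - P (y - l)) / h.
have intk a b : 0 <= a -> a <= b -> b <= T -> \int[mu]_(l in `[a, b]) k l = E a - E b.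
  move=> a0 ab bT.
  have dE l : a <= l <= b -> is_derive l 1 (fun l => - E l) (k l); last first.
    by rewrite (Rintegral_primitive ab ck dE) opprK addrC.
  move=> /andP[al lb].
  have l1 : - L < y - l + h < L.
    have := ler_norm y; have := ler_norm h; have := ler_norm (- y); have := ler_norm (- h).
    by rewrite !normrN => *; apply/andP; split; lra.
  have l2 : - L < y - l < L.
    have := ler_norm y; have := normr_ge0 h; have := ler_norm (- y).
    by rewrite !normrN => *; apply/andP; split; lra.
  have d1 := dP _ l1; have d2 := dP _ l2.
  have i2 c : is_derive (l : R) (1 : R) (fun l : R => c - l) (-1).
    have -> : (fun l : R => c - l) = cst c - id by apply/funext.
    by apply: is_derive_eq; rewrite sub0r.
  have i1 : is_derive (l : R) (1 : R) (fun l : R => y - l + h) (-1).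
    by have -> : (fun l => y - l + h) = (fun l => y + h - l) by apply/funext => x; ring.
  have c1 : is_derive l 1 (fun l => P (y - l + h)) (rho (y - l + h) * (-1)).
    exact: (@is_derive1_comp R P (fun l => y - l + h)).
  have c2 : is_derive l 1 (fun l => P (y - l)) (rho (y - l) * (-1)).
    exact: (@is_derive1_comp R P (fun l => y - l)).
  have -> : (fun l => - E l) = (- h^-1) \*: ((fun l => P (y - l + h)) - (fun l => P (y - l))).
    by apply/funext => x; rewrite /E /= scaleNr -[_ *: _]mulrC.
  have c3 := is_deriveB c1 c2.
  by apply: is_derive_eq; rewrite /k /GRing.scale/= (addrAC y h); field.
have qE : (exp_conv (y + h) - exp_conv y) / h = \int[mu]_(l in `[0, T]) (rhot l * k l).
  have c1 c : continuous (fun l => rho (c - l) * rhot l).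
    by move=> l; apply: cvgM; [exact: comp_cont|exact: rhot_cont].
  rewrite /exp_conv -RintegralB; last 3 first.
  - exact: measurable_itv.
  - exact: (continuous_integrable_itv 0 T (c1 (y + h))).
  - exact: (continuous_integrable_itv 0 T (c1 y)).
  rewrite -RintegralZr.
  - by apply: eq_Rintegral => l _; rewrite /k; ring.
  - exact: measurable_itv.
  apply: (@continuous_integrable_itv R (fun l => rho (y + h - l) * rhot l - rho (y - l) * rhot l)).
  by move=> l; apply: cvgB; exact: c1.
rewrite qE.
pose Phi a b := \int[mu]_(l in `[a, b]) (rhot l * k l).
have int_rk c a b : mu.-integrable `[a, b] (EFin \o (fun l => c * k l)).
  apply: continuous_integrable_itv => l.
  by apply: cvgM; [exact: cvg_cst|exact: ck].
have int_rk' a b : mu.-integrable `[a, b] (EFin \o (fun l => rhot l * k l)).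
  exact: continuous_integrable_itv.
apply: (@interval_functional_sum R T Phi (fun a b => rhot a * (E a - E b))
   (fun a b => rhot b * (E a - E b))) => //.
- exact: ltW.
- move=> a b c _ ab bc; apply/eqP; rewrite addrC -subr_eq; apply/eqP.
  rewrite /Phi Rintegral_itvB ?bnd_simp//.
  rewrite Rintegral_itv_obnd_cbnd//.
  apply: integrableS (int_rk' b c); [exact: measurable_itv|exact: measurable_itv|].
  by apply: subset_itvr; rewrite bnd_simp.
- by rewrite /Phi set_itv1 Rintegral_set1.
- move=> a b a0 ab bT; rewrite -intk// -RintegralZl; last 2 first.
  + exact: measurable_itv.
  + exact: continuous_integrable_itv.
  apply: le_Rintegral; [exact: measurable_itv|exact: int_rk|exact: int_rk'|].
  move=> l /=; rewrite in_itv/= => /andP[al lb].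
  by rewrite ler_wpM2r//; exact: rhot_mono.
- move=> a b a0 ab bT; rewrite -intk// -RintegralZl; last 2 first.
  + exact: measurable_itv.
  + exact: continuous_integrable_itv.
  apply: le_Rintegral; [exact: measurable_itv|exact: int_rk'|exact: int_rk|].
  move=> l /=; rewrite in_itv/= => /andP[al lb].
  by rewrite ler_wpM2r//; exact: rhot_mono.
Qed.

(** As [h] tends to 0 the bounds on the difference quotient tend to Abel-summed expressions equal to
    [rs_lower] and [rs_upper] at [y]. These enclose [J y] and are arbitrarily close to each
    other. *)
Lemma exp_conv_is_derive y : is_derive (y : R) (1 : R) exp_conv (J y).
Proof.
(* [P] must be a primitive at all points [y - x + h] with [0 <= x <= T] and [h] of absolute value
   below 1. *)
pose L := `|y| + 1 + T + 1.
have [P dP] := @continuous_primitive R rho (- L) L rho_cont.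
have [y0 T1] := (normr_ge0 y, T0).
suff lim : h^-1 *: (exp_conv (h *: (1 : R) + y) - exp_conv y) @[h --> 0^'] --> J y.
  apply: DeriveDef; first by apply/cvg_ex; exists (J y).
  exact: cvg_lim.
apply/cvgrPdist_le => e e0.
pose M := expR (y / p); have M0 : 0 < M by exact: expR_gt0.
have d0 : 0 < e / (2 * M) by rewrite divr_gt0// mulr_gt0.
have [N N0 hN] := rs_gap p0 T0 s_cont sT s_gt0 rhot_mono d0.
have {}hN : rs_upper p T s st N y - rs_lower p T s st N y <= e / 2.
  apply: le_trans (hN y) _.
  by rewrite le_eqVlt; apply/orP; left; apply/eqP; rewrite -/M; field; rewrite gt_eqF.
have h0 : 0 < T / N%:R by rewrite divr_gt0// ltr0n.
pose D i h := (P (y - i%:R * (T / N%:R) + h) - P (y - i%:R * (T / N%:R))) / h.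
have Dlim i : (i <= N)%N -> D i h @[h --> 0^'] --> rho (y - i%:R * (T / N%:R)).
  move=> iN; rewrite /D; set x := y - _.
  have x0 : 0 <= i%:R * (T / N%:R) by rewrite mulr_ge0// ltW.
  have xT : i%:R * (T / N%:R) <= T.
    by rewrite mulrCA ler_piMr ?(ltW T0)// ler_pdivrMr ?ltr0n// mul1r ler_nat.
  have xL : - L < x < L.
    have := ler_norm y; have := ler_norm (- y); rewrite normrN => ? ?.
    by apply/andP; split; rewrite /x /L; lra.
  have dPx := dP _ xL; have dv := @derive_val _ _ _ _ _ _ _ dPx.
  have := @ex_derive _ _ _ _ _ _ _ dPx; rewrite /derivable -/(derive _ _ _) => cv.
  have : h^-1 *: (P (h *: (1 : R) + x) - P x) @[h --> 0^'] --> rho x by rewrite -dv.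
  apply: cvg_trans; apply: near_eq_cvg; near=> h => /=.
  by rewrite [_ *: _]mulrC /GRing.scale/= mulr1 (addrC h).
have Elim (w : nat -> R) : 
    \sum_(0 <= i < N) w i * (D i h - D i.+1 h) @[h --> 0^'] -->
    \sum_(0 <= i < N) w i * (rho (y - i%:R * (T / N%:R)) - rho (y - i.+1%:R * (T / N%:R))).
  (* Terms from [N] on are set to 0: [cvg_sum_nat] asks for a limit at every index, while [Dlim]
     holds for [i <= N]. *)
  rewrite big_nat (_ : (fun h => _) = fun h => \sum_(0 <= i < N)
      if (i < N)%N then w i * (D i h - D i.+1 h) else 0); last first.
    by apply/funext => h; rewrite big_nat [RHS]big_nat; apply: eq_bigr => i /= ->.
  rewrite (eq_bigr (fun i => if (i < N)%N then w i * (rho (y - i%:R * (T / N%:R)) - rho (y - i.+1%:R * (T / N%:R))) else 0)); last by move=> i /= ->.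
  rewrite -big_nat; apply: cvg_sum_nat => i; case: ifP => iN; last exact: cvg_cst.
  by apply: cvgM; [exact: cvg_cst|apply: cvgB; apply: Dlim; lia].
have [abu abl] := rs_abel y N0.
have e2 : 0 < e / 2 by rewrite divr_gt0.
have := Elim (fun i => rhot (i.+1%:R * (T / N%:R))); rewrite abu => /cvgrPdist_le/(_ _ e2) nu.
have := Elim (fun i => rhot (i%:R * (T / N%:R))); rewrite abl => /cvgrPdist_le/(_ _ e2) nl.
have /andP[Jl Ju] := JE y N0.
near=> h.
have hn0 : h != 0 by near: h; exact: nbhs_dnbhs_neq.
have hn1 : `|h| < 1 by near: h; exact: dnbhs0_lt.
have yhL : `|y| + `|h| + T < L by rewrite /L; lra.
have /andP[Ql Qu] := exp_conv_quotient_bounds N0 hn0 yhL dP.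
have hu : `|rs_upper p T s st N y - \sum_(0 <= i < N) rhot (i.+1%:R * (T / N%:R)) * (D i h - D i.+1 h)| <= e / 2.
  by near: h; exact: nu.
have hl : `|rs_lower p T s st N y - \sum_(0 <= i < N) rhot (i%:R * (T / N%:R)) * (D i h - D i.+1 h)| <= e / 2.
  by near: h; exact: nl.
have -> : h^-1 *: (exp_conv (h *: (1 : R) + y) - exp_conv y) = (exp_conv (y + h) - exp_conv y) / h.
  by rewrite [LHS]mulrC /GRing.scale/= mulr1 (addrC h).
move: Ql Qu hu hl hN Jl Ju.
rewrite -[X in X <= _]/(\sum_(0 <= i < N) rhot (i%:R * (T / N%:R)) * (D i h - D i.+1 h)).
rewrite -[X in _ <= X -> `|_ - _| <= _ -> _]/(\sum_(0 <= i < N) rhot (i.+1%:R * (T / N%:R)) * (D i h - D i.+1 h)).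
move: (rs_upper _ _ _ _ _ _) (rs_lower _ _ _ _ _ _) (J y) (_ / h) (\sum_(_ <= _ < _) _) (\sum_(_ <= _ < _) _) => U L' j q a b.
rewrite !ler_norml => h1 h2 /andP[h3 h4] /andP[h5 h6] h7 h8 h9.
by apply/andP; split; lra.
Unshelve. all: by end_near.
Qed.

Lemma is_derive_expR_div y :
  is_derive (y : R) (1 : R) (fun y : R => expR (- y / p)) (expR (- y / p) * (- p^-1)).
Proof.
have dn : is_derive y 1 (fun y : R => - y / p) (- p^-1).
  have -> : (fun y : R => - y / p) = (- p^-1) \*: id.
    by apply/funext => x; rewrite /= [RHS]mulNr -mulrN mulrC.
  by apply: is_derive_eq; rewrite [LHS]mulr1.
exact: (@is_derive1_comp R expR (fun y : R => - y / p)).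
Qed.

Lemma pconv_is_derive y :
  is_derive (y : R) (1 : R) (pconv T s st) (T^-1 * (expR (- y / p) * (J y - exp_conv y / p))).
Proof.
have -> : pconv T s st = T^-1 \*: ((fun y => expR (- y / p)) * exp_conv).
  by apply/funext => x; rewrite pconv_exp.
have de := is_derive_expR_div y.
have dc := exp_conv_is_derive y.
have d := is_deriveM de dc.
by apply: is_derive_eq; rewrite /GRing.scale/=; ring.
Qed.

Lemma exp_conv_continuous : continuous exp_conv.
Proof.
move=> y; apply: differentiable_continuous; apply/derivable1_diffP.
exact: (@ex_derive _ _ _ _ _ _ _ (exp_conv_is_derive y)).
Qed.

Lemma derive1_pconv y :
  derive1 (pconv T s st) y = T^-1 * (expR (- y / p) * (J y - exp_conv y / p)).
Proof. by rewrite derive1E (@derive_val _ _ _ _ _ _ _ (pconv_is_derive y)). Qed.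

Lemma derive1_pconv_continuous : continuous (derive1 (pconv T s st)).
Proof.
rewrite (funext derive1_pconv) => y.
apply: cvgM; first exact: cvg_cst.
apply: cvgM.
  have : {for y, continuous (fun y : R => expR (- y / p))}.
    apply: differentiable_continuous; apply/derivable1_diffP.
    exact: (@ex_derive _ _ _ _ _ _ _ (is_derive_expR_div y)).
  exact.
apply: cvgB; first exact: stieltjes_limit_continuous.
by apply: cvgM; [exact: exp_conv_continuous|exact: cvg_cst].
Qed.

(** The term [- exp_conv y / p] that comes from differentiating the exponential cancels [pconv / p],
    leaving [J] alone. *)
Lemma s_tensorE y : s_tensor p T s st y = expR (- y / p) * (T^-1 * J y).
Proof. by rewrite /s_tensor derive1_pconv pconv_exp; ring. Qed.

End PeriodicConvolution.

(** * The sum over the first spectrum *)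

(** Once a partial sum is within [d] of the supremum, later nonnegative terms cannot add more than
    [d]. *)
Lemma bounded_series_tail (R : realType) (c : nat -> R) (k0 : nat) (B : R) :
  (forall i, (k0 <= i)%N -> 0 <= c i) ->
  (forall I : nat, \sum_(k0 <= i < I) c i <= B) ->
  forall d : R, 0 < d -> exists2 I : nat, (k0 <= I)%N &
    forall I1 I2, (I <= I1)%N -> \sum_(I1 <= i < I2) c i <= d.
Proof.
move=> c0 cB d d0; pose V := [set \sum_(k0 <= i < I) c i | I in [set: nat]].
have supV : has_sup V.
  split; first by exists 0; exists k0 => //; rewrite big_geq.
  by exists B => _ [I _ <-].
have [_ [J _ <-] hJ] := sup_adherent d0 supV.
exists (maxn k0 J); first exact: leq_maxl.
move=> I1 I2; rewrite geq_max => /andP[k1 J1].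
have [I21|I12] := leqP I2 I1; first by rewrite big_geq// ltW.
have hs : \sum_(k0 <= i < I2) c i <= sup V by apply: sup_upper_bound => //; exists I2.
have Jk : (\sum_(k0 <= i < J) c i <= \sum_(k0 <= i < I1) c i).
  have [kJ|Jk] := leqP k0 J.
    rewrite (big_cat_nat kJ J1)//= lerDl big_nat sumr_ge0// => i /andP[Ji _].
    by apply: c0; exact: leq_trans Ji.
  rewrite big_geq ?(ltnW Jk)// big_nat sumr_ge0// => i /andP[ki _]; exact: c0.
have : \sum_(k0 <= i < I2) c i = \sum_(k0 <= i < I1) c i + \sum_(I1 <= i < I2) c i.
  by rewrite -big_cat_nat// ltnW.
by move: hs Jk hJ; lra.
Qed.

Section WeightedSum.
Variables (R : realType) (p C C0 B : R) (f D : R -> R) (u w : nat -> R) (n : R -> nat) (k0 : nat).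
Hypotheses (p0 : 0 < p) (C0_ge0 : 0 <= C0).
Hypothesis nP : forall x i, (i < n x)%N = (u i < x).
Hypothesis D_ge0 : forall k : nat, (k0 <= k)%N -> 0 <= D k%:R.
Hypothesis n_le : forall k : nat, (k0 <= k)%N ->
  (n k.+1%:R)%:R <= C * (f k%:R * expR (k%:R / p)).
Hypothesis w_le : forall (k : nat) i, (k0 <= k)%N -> k%:R <= u i < k.+1%:R ->
  w i <= C0 * D k%:R.
Hypothesis fD : forall K : nat, \sum_(k0 <= k < K) f k%:R * D k%:R <= B.

(** The indices are grouped by the unit interval containing [u i]. Such a group has at most
    [C * (f k%:R * expR (k%:R / p))] members, each contributing at most
    [C0 * D k%:R * expR (- k%:R / p)]; the exponentials cancel. *)
Lemma weighted_sum_bounded (I : nat) : (forall i, 0 <= w i) -> 0 <= C -> 0 <= B ->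
  \sum_(n k0%:R <= i < I) w i * expR (- u i / p) <= C * C0 * B.
Proof.
move=> w0 C_ge0 B_ge0.
have nm : {homo (fun k : nat => n (k0 + k)%:R) : i j / (i <= j)%N}.
  move=> i j ij; rewrite leqNgt; apply/negP; rewrite nP => h.
  have : (n (k0 + j)%:R < n (k0 + j)%:R)%N.
    by rewrite {1}nP (lt_le_trans _ (_ : (k0 + i)%:R <= _))// ?ler_nat ?leq_add2l// -nP.
  by rewrite ltnn.
have [K hK] : exists K, (I <= n (k0 + K)%:R)%N.
  case: I => [|I]; first by exists 0%N.
  exists (Num.truncn (u I)).+1; rewrite nP.
  apply: lt_le_trans (truncnS_gt _) _; rewrite ler_nat leq_addl//.
have [In|nI] := leqP I (n k0%:R).
  by rewrite big_geq// !mulr_ge0.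
apply: (@le_trans _ _ (\sum_(n k0%:R <= i < n (k0 + K)%:R) w i * expR (- u i / p))).
  rewrite (big_cat_nat (ltnW nI) hK)//= lerDl sumr_ge0// => i _.
  by rewrite mulr_ge0 ?expR_ge0.
have := big_nat_blocks (fun i => w i * expR (- u i / p) : R) K nm.
rewrite addn0 => ->.
apply: (@le_trans _ _ (\sum_(0 <= k < K) C * C0 * (f (k0 + k)%:R * D (k0 + k)%:R))).
  apply: ler_sum => k _; set kk := (k0 + k)%N; rewrite addnS -/kk.
  have kk0 : (k0 <= kk)%N by exact: leq_addr.
  apply: (@le_trans _ _ (\sum_(n kk%:R <= i < n kk.+1%:R) C0 * D kk%:R * expR (- kk%:R / p))).
    rewrite !big_nat; apply: ler_sum => i /andP[ni in1].
    have u1 : kk%:R <= u i by rewrite leNgt -nP -leqNgt.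
    have u2 : u i < kk.+1%:R by rewrite -nP.
    apply: ler_pM; rewrite ?expR_ge0//; first by apply: w_le => //; rewrite u1 u2.
    by rewrite ler_expR ler_pM2r ?invr_gt0// lerN2.
  rewrite sumr_const_nat -[X in X <= _]mulr_natl.
  have CD : 0 <= C0 * D kk%:R * expR (- kk%:R / p).
    by rewrite !mulr_ge0 ?expR_ge0 ?D_ge0.
  have h1 : (n kk.+1%:R - n kk%:R)%:R <= C * (f kk%:R * expR (kk%:R / p)) :> R.
    by apply: le_trans (n_le kk0); rewrite ler_nat leq_subr.
  apply: le_trans (ler_wpM2r CD h1) _.
  have -> : C * (f kk%:R * expR (kk%:R / p)) * (C0 * D kk%:R * expR (- kk%:R / p)) =
    expR (- kk%:R / p) * expR (kk%:R / p) * (C * C0 * (f kk%:R * D kk%:R)) by ring.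
  by rewrite -expRD mulNr addNr expR0 mul1r.
rewrite -mulr_sumr ler_wpM2l ?mulr_ge0//.
have := fD (k0 + K); rewrite -{1}[k0]add0n big_addn addKn.
by under eq_bigr do rewrite addnC.
Qed.

End WeightedSum.

Section FirstSum.
Variables (R : realType) (p St B B' : R) (g st : R -> R) (u G : nat -> R) (n m : R -> nat) (I0 : nat).
Variable sst : R -> R.
Hypotheses (p0 : 0 < p) (gs : log_slow g).
Hypotheses (st_gt0 : forall x, 0 < st x) (stS : forall x, st x <= St).
Hypothesis mg : count_equiv p g st m.
Hypothesis nP : forall x i, (i < n x)%N = (u i < x).
Hypothesis G_ge0 : forall i, 0 <= G i.
Hypothesis gG : forall i y, (I0 <= i)%N -> 2 * u i < y -> g (y - u i) <= G i * g y.
Hypothesis sumG : forall I : nat, \sum_(I0 <= i < I) G i * expR (- u i / p) <= B.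
Hypothesis sum1 : forall I : nat, \sum_(0 <= i < I) expR (- u i / p) <= B'.
Hypothesis sst_ge : forall y (I : nat),
  \sum_(0 <= i < I) st (y - u i) * expR (- u i / p) <= sst y.
Hypothesis sst_le : forall y (I : nat) (d : R),
  (forall I' : nat, \sum_(I <= i < I') st (y - u i) * expR (- u i / p) <= d) ->
  sst y <= \sum_(0 <= i < I) st (y - u i) * expR (- u i / p) + d.

Definition first_sum (y : R) : R := \sum_(0 <= i < n (y / 2)) (m (y - u i))%:R.

(* Dominated convergence, with [G i * expR (- u i / p)] as dominating series. *)
Lemma first_sum_asymp (eps : R) : 0 < eps -> exists Y, forall y, Y <= y ->
  `|expR (- y / p) * first_sum y - g y * sst y| <= eps * g y.
Proof.
move=> eps0.
have St0 : 0 < St by apply: lt_le_trans (st_gt0 0) (stS 0).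
have expK y : expR (- y / p) * expR (y / p) = 1 by rewrite -expRD mulNr addNr expR0.
have eyu y i : expR ((y - u i) / p) = expR (y / p) * expR (- u i / p).
  by rewrite mulrDl expRD.
have [C [Z [Cp hC]]] := count_shift p0 gs st_gt0 stS mg 0.
have d1 : 0 < eps / (3 * C) by rewrite divr_gt0// mulr_gt0.
have d2 : 0 < eps / (3 * St) by rewrite divr_gt0// mulr_gt0.
have [I1 I01 t1] := @bounded_series_tail R (fun i => G i * expR (- u i / p)) I0 B
  (fun i _ => mulr_ge0 (G_ge0 i) (expR_ge0 _)) sumG _ d1.
have [I2 _ t2] := @bounded_series_tail R (fun i => expR (- u i / p)) 0 B'
  (fun i _ => expR_ge0 _) sum1 _ d2.
(* From [n Z] on, [u i >= Z]; together with [2 * u i < y] this puts [y - u i] beyond [Z] as well,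
   where the bound [hC] on [m] holds. *)
pose I := maxn (maxn I1 I2) (n Z).
have I1I : (I1 <= I)%N by rewrite /I -maxnA leq_maxl.
have I2I : (I2 <= I)%N by rewrite /I (maxnC I1) -maxnA leq_maxl.
have nZI : (n Z <= I)%N by exact: leq_maxr.
clearbody I.
have tailS y I' : \sum_(I <= i < I') st (y - u i) * expR (- u i / p) <= eps / 3.
  apply: (@le_trans _ _ (\sum_(I <= i < I') St * expR (- u i / p))).
    by apply: ler_sum => i _; rewrite ler_pM2r ?expR_gt0.
  rewrite -mulr_sumr; apply: le_trans (ler_wpM2l (ltW St0) (t2 I I' I2I)) _.
  by rewrite le_eqVlt; apply/orP; left; apply/eqP; field; rewrite gt_eqF.
have [Y1 hY1] : exists Y, forall y, Y <= y ->
    `|\sum_(0 <= i < I) (expR (- y / p) * (m (y - u i))%:R -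
       g y * (st (y - u i) * expR (- u i / p)))| <= eps / 3 * g y.
  (* The number [I] of head terms is fixed, so the local asymptotics of [m] can be applied to each
     of them with an equal share of the error. *)
  have e3 : 0 < eps / 3 / (I%:R + 1) by rewrite !divr_gt0// ltr_wpDl.
  have : exists Y, forall y, Y <= y ->
    `|\sum_(0 <= i < I) (expR (- y / p) * (m (y - u i))%:R -
       g y * (st (y - u i) * expR (- u i / p)))| <= eps / 3 / (I%:R + 1) * I%:R * g y.
    move: (eps / 3 / (I%:R + 1)) e3 => e e0.
    elim: (I) => [|M [Y hY]].
      by exists 0 => y _; rewrite big_geq// normr0 mulr0 mul0r.
    have [Y' hY'] := count_local p0 gs st_gt0 stS mg e0 (normr_ge0 (u M)).
    exists (Num.max Y Y') => y; rewrite ge_max => /andP[yY yY'].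
    rewrite big_nat_recr//=; apply: le_trans (ler_normD _ _) _.
    rewrite -natr1 mulrDr mulr1 mulrDl lerD ?hY//.
    have := hY' y (- u M) yY'; rewrite normrN => /(_ (lexx _)).
    move=> /(ler_wpM2l (expR_ge0 (- y / p))).
    have -> : expR (- y / p) * (e * (g y * expR (y / p))) = expR (- y / p) * expR (y / p) * (e * g y) by ring.
    rewrite expK mul1r -{1}(ger0_norm (expR_ge0 (- y / p))) -normrM mulrBr.
    rewrite exp_weightD.
    have -> : expR (- y / p) * (g y * (expR (y / p) * (expR (- u M / p) * st (y - u M)))) =
      expR (- y / p) * expR (y / p) * (g y * (st (y - u M) * expR (- u M / p))) by ring.
    by rewrite expK mul1r.
  move=> [Y hY]; exists Y => y yY; apply: le_trans (hY _ yY) _.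
  rewrite ler_pM2r ?(gs.1)// mulrAC ler_pdivrMr ?ltr_wpDl//.
  by rewrite ler_pM2l ?divr_gt0// lerDl.
have [Y2 hY2] : exists Y, forall y, Y <= y -> (I <= n (y / 2))%N.
  case: (I) => [|M]; first by exists 0.
  exists (2 * (u M + 1)) => y hy; rewrite nP.
  by rewrite ltr_pdivlMr//; move: hy; lra.
exists (Num.max Y1 Y2) => y; rewrite ge_max => /andP[y1 y2].
have gy := gs.1 y.
have tailM : expR (- y / p) * \sum_(I <= i < n (y / 2)) (m (y - u i))%:R <= eps / 3 * g y.
  rewrite mulr_sumr.
  apply: (@le_trans _ _ (\sum_(I <= i < n (y / 2)) C * g y * (G i * expR (- u i / p)))).
    rewrite !big_nat; apply: ler_sum => i /andP[Ii iny].
    have uy : u i < y / 2 by rewrite -nP.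
    have uZ : Z <= u i by rewrite leNgt -nP -leqNgt (leq_trans nZI).
    have uy2 : 2 * u i < y by move: uy; lra.
    have h : (m (y - u i))%:R <= C * (g (y - u i) * expR ((y - u i) / p)).
      by have := hC (y - u i); rewrite addr0; apply; lra.
    have hg := gG (leq_trans I01 (leq_trans I1I Ii)) uy2.
    apply: le_trans (ler_wpM2l (expR_ge0 _) h) _; rewrite eyu.
    have -> : expR (- y / p) * (C * (g (y - u i) * (expR (y / p) * expR (- u i / p)))) =
      expR (- y / p) * expR (y / p) * (C * expR (- u i / p) * g (y - u i)) by ring.
    rewrite expK mul1r.
    apply: le_trans (ler_wpM2l _ hg) _; first by rewrite mulr_ge0 ?expR_ge0// ltW.
    by rewrite le_eqVlt; apply/orP; left; apply/eqP; ring.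
  rewrite -mulr_sumr; apply: le_trans (ler_wpM2l _ (t1 I (n (y / 2)) I1I)) _.
    by rewrite mulr_ge0// ltW.
  by rewrite le_eqVlt; apply/orP; left; apply/eqP; field; rewrite gt_eqF.
have tail0 : 0 <= expR (- y / p) * \sum_(I <= i < n (y / 2)) (m (y - u i))%:R.
  by rewrite mulr_ge0 ?expR_ge0// sumr_ge0.
have hd := hY1 _ y1.
have sg := sst_ge y I; have sl := sst_le (tailS y).
rewrite /first_sum (big_cat_nat (leq0n I) (hY2 _ y2))//= mulrDr.
move: hd; rewrite sumrB -!mulr_sumr => hd.
move: tailM tail0 hd sg sl.
move: (\sum_(0 <= i < I) _) (expR _ * \sum_(I <= i < _) _) (expR _ * \sum_(0 <= i < I) _).
move=> S t h tm t0; rewrite !ler_norml => /andP[h1 h2] sg sl.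
have k1 : g y * S <= g y * sst y by rewrite ler_pM2l.
have k2 : g y * sst y <= g y * (S + eps / 3) by rewrite ler_pM2l.
by apply/andP; split; lra.
Qed.

End FirstSum.

(** * Integrals of slowly varying functions *)

Section SlowlyVarying.
Variables (R : realType) (phi : R -> R).
Hypothesis phi_sv : regular_slowly_varying phi.

Let phi0 tau : 0 < tau -> 0 < phi tau.
Proof. by case: phi_sv => -[_ + _] _ _ _; exact. Qed.

Lemma slowly_varying_continuous : {in [set` `]0, +oo[], continuous phi}.
Proof.
case: phi_sv => _ C2 _ _ tau; rewrite inE/= in_itv/= andbT => /C2[d _ _].
by apply: differentiable_continuous; exact/derivable1_diffP.
Qed.

Lemma slowly_varying_exp_continuous : continuous (phi \o expR).
Proof.
move=> x; apply: continuous_comp; first exact: continuous_expR.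
by apply: slowly_varying_continuous; rewrite inE/= in_itv/= expR_gt0.
Qed.

(** In [x = ln tau] the derivative of [ln (phi (expR x))] is [tau * (ln phi)' tau], which tends to
    0; the mean value theorem gives the rest. *)
Lemma slowly_varying_log_slow : log_slow (phi \o expR).
Proof.
split=> [x|eps eps0]; first by rewrite phi0// expR_gt0.
case: (phi_sv) => _ C2 + _ => /cvgrPdist_le/(_ _ eps0)[X [_ hX]].
have dF (x : R) : is_derive (x : R) (1 : R) (fun x : R => ln (phi (expR x)))
    (expR x * derive1 (fun x => ln (phi x)) (expR x)).
  have e0 := expR_gt0 x; have [d _ _] := C2 _ e0.
  have d1 : is_derive (expR x) 1 phi (derive1 phi (expR x)).
    by apply: DeriveDef => //; rewrite derive1E.
  have d2 := is_derive1_ln (phi0 e0).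
  have d3 := is_derive1_comp d2 d1.
  have d4 : is_derive (expR x) 1 (fun x => ln (phi x)) (derive1 (fun x => ln (phi x)) (expR x)).
    by apply: DeriveDef; [exact: (@ex_derive _ _ _ _ _ _ _ d3)|rewrite derive1E].
  have d5 := is_derive_expR x.
  have := is_derive1_comp d4 d5; rewrite mulrC; exact.
exists (ln (Num.max X 1) + 1) => x y hx hy.
have key a b : ln (Num.max X 1) + 1 <= a -> a <= b ->
    `|ln (phi (expR b)) - ln (phi (expR a))| <= eps * (b - a).
  move=> Xa ab.
  have [c] := MVT_segment ab (fun x _ => dF x)
    (continuous_subspaceT (fun x => differentiable_continuous
      ((derivable1_diffP _ _).1 (@ex_derive _ _ _ _ _ _ _ (dF x))))).
  rewrite in_itv/= => /andP[ac cb] ->.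
  rewrite normrM (ger0_norm (_ : 0 <= b - a)) ?subr_ge0//.
  rewrite ler_wpM2r ?subr_ge0//.
  have := hX (expR c); rewrite sub0r normrN; apply.
  have mx : 0 < Num.max X 1 by rewrite lt_max ltr01 orbT.
  apply: (@le_lt_trans _ _ (Num.max X 1)); first by rewrite le_max lexx.
  by rewrite -ltr_ln ?posrE ?expR_gt0// expRK; lra.
have key2 : `|ln (phi (expR x)) - ln (phi (expR y))| <= eps * `|x - y|.
  have [xy|yx] := leP x y.
    by rewrite distrC; apply: le_trans (key _ _ hx xy) _; rewrite distrC ler_wpM2l ?(ltW eps0)// ler_norm.
  by apply: le_trans (key _ _ hy (ltW yx)) _; rewrite ler_wpM2l ?(ltW eps0)// ler_norm.
have px : 0 < phi (expR x) by rewrite phi0// expR_gt0.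
have py : 0 < phi (expR y) by rewrite phi0// expR_gt0.
rewrite /= -{1}[phi (expR x)]lnK ?posrE// -{1}[phi (expR y)]lnK ?posrE//.
rewrite -expRD ler_expR; have := le_trans (ler_norm _) key2; lra.
Qed.

End SlowlyVarying.

(* The integral of a nonnegative function is a supremum over the simple functions
   below it, hence monotone even without measurability. *)
Lemma ge0_le_integral_nonmeasurable d (T : measurableType d) (R : realType)
    (mu : {measure set T -> \bar R}) (D : set T) (f1 f2 : T -> \bar R) :
  (forall x, D x -> (0 <= f1 x)%E) -> (forall x, D x -> (f1 x <= f2 x)%E) ->
  (\int[mu]_(x in D) f1 x <= \int[mu]_(x in D) f2 x)%E.
Proof.
move=> f10 f12.
rewrite !ge0_integralE//; last by move=> x Dx; exact: le_trans (f10 _ Dx) (f12 _ Dx).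
apply: ereal_sup_le => _ [h hf <-]; exists h => // x; apply: le_trans (hf x) _.
by rewrite /patch; case: ifPn => // /set_mem; exact: f12.
Qed.

Section ExpSubstitution.
Variable R : realType.
Local Notation mu := (@lebesgue_measure R).

Lemma integral_exp_substitution (G : R -> R) (a b : R) : a <= b ->
  {in [set` `]0, +oo[], continuous G} ->
  (\int[mu]_(x in `[expR a, expR b]) (G x / x)%:E = \int[mu]_(x in `[a, b]) (G (expR x))%:E)%E.
Proof.
move=> ab cG.
have dexp : derive1 (@expR R) = expR by apply/funext => x; rewrite derive1E; exact: derive_val.
rewrite (@integration_by_substitution_increasing R expR (fun x => G x / x) a b ab).
- apply: eq_integral => x _; congr (_%:E).
  by rewrite dexp /= /GRing.mul/=  divfK// gt_eqF// expR_gt0.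
- by move=> x y _ _; rewrite ltr_expR.
- by rewrite dexp => x _; exact: continuous_expR.
- rewrite dexp; apply/cvg_ex; exists (expR a); apply: cvg_at_right_filter; exact: continuous_expR.
- rewrite dexp; apply/cvg_ex; exists (expR b); apply: cvg_at_left_filter; exact: continuous_expR.
- split; first by move=> x _; exact: derivable_expR.
    apply: cvg_at_right_filter; exact: continuous_expR.
  apply: cvg_at_left_filter; exact: continuous_expR.
- apply: continuous_in_subspaceT => x; rewrite inE/= in_itv/= => /andP[ax _].
  have x0 : 0 < x by apply: lt_le_trans ax; exact: expR_gt0.
  apply: cvgM; first by apply: cG; rewrite inE/= in_itv/= x0.
  by apply: cvgV => //; rewrite gt_eqF.
Qed.

End ExpSubstitution.

Section IntegralSums.
Variables (R : realType) (phi : R -> R).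
Hypothesis phi_sv : regular_slowly_varying phi.
Local Notation mu := (@lebesgue_measure R).
Local Notation f := (phi \o expR).

Let f_slow : log_slow f. Proof. exact: slowly_varying_log_slow. Qed.

(** The step function equal to [c k] on the [k]-th window lies below [h]. In the applications [h]
    contains [m_sup phit], which is thus used only through lower bounds on windows. *)
Lemma step_sum_le_integral (h : R -> \bar R) (c : nat -> R) (k0 K : nat) : (0 < k0)%N ->
  (forall x, 1 <= x -> (0 <= h x)%E) -> (forall k, 0 <= c k) ->
  (forall k x, (k0 <= k)%N -> expR (k%:R - 1) <= x < expR k%:R -> ((c k)%:E <= h x)%E) ->
  ((\sum_(k0 <= k < K) c k * (expR k%:R - expR (k%:R - 1)))%:E <=
     \int[mu]_(x in `[1%R, +oo[) h x)%E.
Proof.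
move=> k01 h0 c0 ch.
pose I k := `[expR (k%:R - 1 : R), expR k%:R[%classic.
pose w k (x : R) : \bar R := ((c k)%:E * (\1_(I k) x)%:E)%E.
have mI k : measurable (I k) by exact: measurable_itv.
have m1 k (D : set R) : measurable_fun D (fun x => (\1_(I k) x : R)%:E).
  by apply/measurable_EFinP; exact: measurable_indic.
have mw k (D : set R) : measurable_fun D (w k) by exact: measurable_funeM.
have w0 k x : (0 <= w k x)%E by rewrite mule_ge0// lee_fin// c0.
have I1 k : (k0 <= k)%N -> I k `<=` `[1, +oo[.
  move=> k0k x /=; rewrite !in_itv/= andbT => /andP[kx _].
  rewrite bnd_simp in kx; apply: le_trans kx.
  by rewrite -[leLHS]expR0 ler_expR subr_ge0 ler1n (leq_trans k01).
have -> : (\sum_(k0 <= k < K) c k * (expR k%:R - expR (k%:R - 1)))%:E =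
    (\int[mu]_(x in `[1%R, +oo[) (\sum_(k0 <= k < K) w k x))%E.
  rewrite ge0_integral_sum//; last by move=> k; exact: mw.
  rewrite -sumEFin [LHS]big_nat [RHS]big_nat; apply: eq_bigr => k /andP[k0k _].
  rewrite ge0_integralZl_EFin//; last exact: m1.
  rewrite integral_indic; [|exact: measurable_itv|exact: mI].
  rewrite setIidl; last exact: I1.
  rewrite EFinM; congr (_ * _)%E; rewrite [RHS]lebesgue_measure_itv/= lte_fin ltr_expR.
  by rewrite ltrBlDr ltrDl ltr01 EFinB.
apply: ge0_le_integral_nonmeasurable => x /=; rewrite in_itv/= andbT => x1.
  by rewrite big_nat; apply: sume_ge0 => k _; exact: w0.
have [[k [k0k kK xk]]|none] := pselect (exists k, [/\ (k0 <= k)%N, (k < K)%N & I k x]).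
  rewrite (bigD1_seq k)/= ?mem_index_iota ?k0k ?iota_uniq// [X in (_ + X)%E]big1_seq ?adde0.
    rewrite /w indicE mem_set// mule1; exact: ch.
  move=> i /andP[ik _]; rewrite /w indicE memNset ?mule0// /I/= in_itv/= => /andP[i1 i2].
  move: xk; rewrite /I /= in_itv/= => /andP[x2 x3].
  have := le_lt_trans i1 x3; have := le_lt_trans x2 i2; rewrite !ltr_expR !ltrBlDr !natr1 !ltr_nat => ? ?.
  by move/eqP: ik; apply; apply/eqP; rewrite eqn_leq; apply/andP; split; rewrite -ltnS.
rewrite big_nat big1 ?h0// => k /andP[k0k kK].
by rewrite /w indicE memNset ?mule0// => xk; apply: none; exists k.
Qed.

(** In the logarithmic variable this is [[k - 1, k[], to the left of the values in [[k, k + 1[] to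
    which it is applied in [inf_weight_ratio]. *)
Definition window (k : nat) : set R := `[expR (k%:R - 1 : R), expR k%:R[%classic.

(** On window [k] the density [phi x / x] is at least [f k%:R / 2 * expR (- k%:R)], and the window
    has length [expR k%:R * (1 - expR (-1))], so each summand is a constant multiple of the integral
    of a lower step. *)
Lemma weighted_block_sum_bounded (w : R -> \bar R) (d : nat -> R) :
  (forall x, 1 <= x -> (0 <= w x)%E) -> (forall k, 0 <= d k) ->
  (\int[mu]_(x in `[1%R, +oo[) ((phi x / x)%:E * w x) < +oo)%E ->
  exists k1 : nat, forall k0, (k1 <= k0)%N -> 
  (forall k x, (k0 <= k)%N -> window k x -> ((d k)%:E <= w x)%E) ->
  exists2 B : R, 0 <= B & forall K, \sum_(k0 <= k < K) f k%:R * d k <= B.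
Proof.
move=> w0 d0 fin.
have [X hX] := log_slow_half f_slow (ler01 : 0 <= 1 :> R).
(* One more than [k >= X] would require, because the window reaches down to [k - 1]. *)
exists (Num.truncn `|X|).+2 => k0 k10 dw.
have phi0 x : 0 < x -> 0 < phi x by case: phi_sv => -[_ + _] _ _ _; exact.
pose h x := ((phi x / x)%:E * w x)%E.
have h0 x : 1 <= x -> (0 <= h x)%E.
  move=> x1; have x0 : 0 < x by exact: lt_le_trans x1.
  by rewrite mule_ge0 ?w0// lee_fin divr_ge0// ltW// phi0.
pose c k := f k%:R / 2 * expR (- k%:R) * d k.
have c0 k : 0 <= c k by rewrite !mulr_ge0 ?expR_ge0 ?invr_ge0// ltW// (f_slow.1 _).
have k0X : `|X| + 1 <= k0%:R.
  have : ((Num.truncn `|X|).+2)%:R <= k0%:R :> R by rewrite ler_nat.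
  by rewrite -natr1; have := truncnS_gt `|X|; lra.
have ch k x : (k0 <= k)%N -> expR (k%:R - 1) <= x < expR k%:R -> ((c k)%:E <= h x)%E.
  move=> k0k /andP[x1 x2].
  have x0 : 0 < x by apply: lt_le_trans x1; exact: expR_gt0.
  rewrite /h /c EFinM; apply: lee_pmul.
  - by rewrite lee_fin !mulr_ge0 ?expR_ge0 ?invr_ge0// ltW// (f_slow.1 _).
  - by rewrite lee_fin.
  - rewrite lee_fin; apply: ler_pM.
    + by rewrite mulr_ge0 ?invr_ge0// ltW// (f_slow.1 _).
    + exact: expR_ge0.
    + rewrite -[X in _ <= phi X]lnK ?posrE//.
      have l1 : k%:R - 1 <= ln x by rewrite -ler_expR lnK.
      have l2 : ln x <= k%:R by rewrite -ler_expR lnK// ltW.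
      have k0k' : k0%:R <= k%:R :> R by rewrite ler_nat.
      have := ler_norm X => Xn.
      apply: (hX (ln x) k%:R _ _ _).1; [lra|lra|].
      by rewrite ler_norml; apply/andP; split; lra.
    + by rewrite expRN lef_pV2 ?posrE ?expR_gt0// ltW.
  - by apply: dw => //; rewrite /window/= in_itv/= x1 x2.
have k0_gt0 : (0 < k0)%N by exact: leq_trans k10.
have step K := step_sum_le_integral K k0_gt0 h0 c0 ch.
have hfin : (\int[mu]_(x in `[1%R, +oo[) h x \is a fin_num)%E.
  rewrite ge0_fin_numE//; apply: integral_ge0 => x /=; rewrite in_itv/= andbT; exact: h0.
have e1 : 0 < (1 - expR (-1)) / 2 :> R by rewrite divr_gt0// subr_gt0 -expR0 ltr_expR.
exists (fine (\int[mu]_(x in `[1%R, +oo[) h x)%E / ((1 - expR (-1)) / 2)).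
  rewrite divr_ge0 ?(ltW e1)// fine_ge0//; apply: integral_ge0 => x /=; rewrite in_itv/= andbT; exact: h0.
move=> K; rewrite ler_pdivlMr// mulr_suml.
have := step K; rewrite -(fineK hfin) lee_fin => s; apply: le_trans s.
rewrite le_eqVlt; apply/orP; left; apply/eqP; apply: eq_bigr => k _.
have -> : expR (k%:R - 1) = expR k%:R * expR (- 1) :> R by rewrite -expRD.
rewrite /c.
have -> : f k%:R / 2 * expR (- k%:R) * d k * (expR k%:R - expR k%:R * expR (-1)) =
  (expR (- k%:R) * expR k%:R) * (f k%:R / 2 * d k * (1 - expR (-1))) by ring.
rewrite -expRD addNr expR0; by field.
Qed.

End IntegralSums.

(** * Window infima of the supremum of ratios *)

Section SupWeight.
Variables (R : realType) (phi phit : R -> R).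
Hypotheses (phi_sv : regular_slowly_varying phi) (phit_sv : regular_slowly_varying phit).
Local Notation mu := (@lebesgue_measure R).
Local Notation g := (phit \o expR).
Hypothesis m_int : (\int[mu]_(sigma in `[1%R, +oo[)
  ((phi sigma / sigma)%:E * m_sup phit sigma) < +oo)%E.

Let phi0 x : 0 < x -> 0 < phi x.
Proof. by case: phi_sv => -[_ + _] _ _ _; exact. Qed.

Let phit0 x : 0 < x -> 0 < phit x.
Proof. by case: phit_sv => -[_ + _] _ _ _; exact. Qed.

Lemma m_sup_ge x y : 2 * x < y -> ((g (y - x) / g y)%:E <= m_sup phit (expR x))%E.
Proof.
move=> xy; apply: ereal_sup_ubound => /=; exists (expR y).
  by rewrite in_itv/= andbT -expRM_natr ltr_expR mulrC.
by rewrite /= expRD expRN.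
Qed.

Lemma m_sup_ge0 sigma : 0 < sigma -> (0 <= m_sup phit sigma)%E.
Proof.
move=> s0; rewrite -(lnK s0).
apply: le_trans (m_sup_ge (y := 2 * ln sigma + 1) _); last by rewrite ltrDl.
by rewrite lee_fin divr_ge0// ltW// phit0// expR_gt0.
Qed.

(* An infimum over a window, unlike a value at a point, is controlled by the
   integral of [m_sup phit] without any regularity of [m_sup phit]. *)
Definition window_inf (k : nat) : \bar R := ereal_inf [set m_sup phit x | x in @window R k].

Definition inf_weight (k : nat) : R := fine (window_inf k).

Lemma window_gt0 k (x : R) : window k x -> 0 < x.
Proof. by rewrite /window/= in_itv/= => /andP[h _]; apply: lt_le_trans h; exact: expR_gt0. Qed.

Lemma window_inf_ge0 k : (0 <= window_inf k)%E.
Proof. by apply: le_ereal_inf_tmp => _ [x /window_gt0 x0 <-]; exact: m_sup_ge0. Qed.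

Lemma window_inf_le k x : window k x -> (window_inf k <= m_sup phit x)%E.
Proof. by move=> wx; apply: ereal_inf_lbound; exists x. Qed.

(** If [m_sup phit] were infinite on a whole window, one step of integral [M + 1] would fit below
    the integrand, whose integral is [M]. *)
Lemma window_inf_fin k : (0 < k)%N -> window_inf k \is a fin_num.
Proof.
move=> k0; rewrite ge0_fin_numE ?window_inf_ge0// ltey; apply/eqP => infE.
pose h x := ((phi x / x)%:E * m_sup phit x)%E.
have h0 x : 1 <= x -> (0 <= h x)%E.
  move=> x1; have x0 : 0 < x by exact: lt_le_trans x1.
  by rewrite mule_ge0 ?m_sup_ge0// lee_fin divr_ge0// ltW// phi0.
have len : 0 < expR k%:R - expR (k%:R - 1) :> R.
  by rewrite subr_gt0 ltr_expR ltrBlDr ltrDl.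
have hfin : (\int[mu]_(x in `[1%R, +oo[) h x \is a fin_num)%E.
  rewrite ge0_fin_numE//; apply: integral_ge0 => x /=; rewrite in_itv/= andbT; exact: h0.
pose M := fine (\int[mu]_(x in `[1%R, +oo[) h x)%E.
have M0 : 0 <= M.
  by rewrite fine_ge0//; apply: integral_ge0 => x /=; rewrite in_itv/= andbT; exact: h0.
pose c i := if i == k then (M + 1) / (expR k%:R - expR (k%:R - 1)) else 0.
have c0 i : 0 <= c i.
  by rewrite /c; case: ifP => // _; rewrite divr_ge0 ?(ltW len)// addr_ge0.
have ch i x : (k <= i)%N -> expR (i%:R - 1) <= x < expR i%:R -> ((c i)%:E <= h x)%E.
  move=> ki ix; have wx : window i x by rewrite /window/= in_itv.
  have x0 := window_gt0 wx.
  rewrite /c; case: eqP => [ik|_]; last first.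
    by rewrite mule_ge0 ?m_sup_ge0// lee_fin divr_ge0// ltW// phi0.
  have : (+oo <= m_sup phit x)%E by rewrite -infE -ik; exact: window_inf_le.
  rewrite /h leye_eq => /eqP ->; rewrite gt0_muley ?leey// lte_fin divr_gt0//.
  exact: phi0.
have := step_sum_le_integral k.+1 k0 h0 c0 ch.
rewrite big_nat1 /c eqxx divfK ?gt_eqF// -(fineK hfin) lee_fin -/M.
by rewrite leNgt ltrDl ltr01.
Qed.

Lemma inf_weight_ge0 k : 0 <= inf_weight k.
Proof. by rewrite fine_ge0// window_inf_ge0. Qed.

Lemma inf_weight_le k x : (0 < k)%N -> window k x -> ((inf_weight k)%:E <= m_sup phit x)%E.
Proof. by move=> k0 wx; rewrite /inf_weight fineK ?window_inf_fin//; exact: window_inf_le. Qed.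

(** Every [x] in window [k] has [ln x < k <= z], so [2 * ln x < y] follows from [2 * z < y] and the
    ratio at [x] is bounded by [m_sup phit x]. Passing from [y - ln x] to [y - z], at distance at
    most 2, costs the factor 2. As [x] is arbitrary, the infimum bounds the ratio at [z]. *)
Lemma inf_weight_ratio : exists k1 : nat, forall (k : nat) z y, (k1 <= k)%N ->
  k%:R <= z < k.+1%:R -> 2 * z < y -> g (y - z) <= 2 * inf_weight k * g y.
Proof.
have [X hX] := log_slow_half (slowly_varying_log_slow phit_sv) (ler0n R 2).
exists (Num.truncn `|X|).+1 => k z y k1k /andP[kz zk] zy.
have kX : `|X| <= k%:R.
  have : ((Num.truncn `|X|).+1)%:R <= k%:R :> R by rewrite ler_nat.
  by have := truncnS_gt `|X|; lra.
have k0 : (0 < k)%N by exact: leq_trans k1k.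
have gy : 0 < g y by rewrite /= phit0// expR_gt0.
rewrite -ler_pdivrMr// -ler_pdivrMl//.
rewrite -lee_fin /inf_weight fineK ?window_inf_fin//.
apply: le_ereal_inf_tmp => _ [x wx <-]; have x0 := window_gt0 wx.
rewrite -(lnK x0); have : window k x by [].
rewrite /window/= in_itv/= => /andP[x1 x2].
have l1 : k%:R - 1 <= ln x by rewrite -ler_expR lnK.
have l2 : ln x < k%:R by rewrite -ltr_expR lnK.
apply: le_trans (m_sup_ge (y := y) _); last by lra.
rewrite lee_fin mulrA ler_pM2r ?invr_gt0//.
have := ler_norm X; move: zk; rewrite -natr1 => zk Xn.
have z1 : X <= y - ln x by lra.
have z2 : X <= y - z by lra.
have z3 : `|(y - ln x) - (y - z)| <= 2 by rewrite ler_norml; apply/andP; split; lra.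
by rewrite mulrC; exact: (hX _ _ z1 z2 z3).1.
Qed.

End SupWeight.

Section ExpIntegral.
Variables (R : realType) (phi phit : R -> R).
Hypotheses (phi_sv : regular_slowly_varying phi) (phit_sv : regular_slowly_varying phit).
Local Notation mu := (@lebesgue_measure R).
Local Notation f := (phi \o expR).
Local Notation g := (phit \o expR).

Lemma h_conv_exp y : 0 <= y ->
  h_conv phit phi (expR y) = \int[mu]_(x in `[0, y / 2]) (g x * f (y - x)).
Proof.
move=> y0.
have sq : Num.sqrt (expR y) = expR (y / 2).
  have -> : expR y = expR (y / 2) ^+ 2 by rewrite -expRM_natr divfK.
  by rewrite sqrtr_sqr ger0_norm ?expR_ge0.
rewrite /h_conv /Rintegral sq -{1}expR0.
rewrite (@integral_exp_substitution R (fun x => phit x * phi (expR y / x))) ?divr_ge0//.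
  by congr fine; apply: eq_integral => x _; rewrite /= expRD expRN.
move=> x x0; have x0' : 0 < x by move: x0; rewrite inE/= in_itv/= andbT.
apply: cvgM; first by apply: slowly_varying_continuous x0; exact: phit_sv.
have c1 : {for (x : R), continuous (fun x : R => expR y / x)}.
  by apply: cvgM; [exact: cvg_cst|apply: cvgV; rewrite ?gt_eqF].
apply: (continuous_comp c1).
apply: slowly_varying_continuous; first exact: phi_sv.
by rewrite inE/= in_itv/= andbT divr_gt0// expR_gt0.
Qed.

End ExpIntegral.

Lemma product_close (R : realFieldType) (d x y a b : R) : 0 < d -> d <= 1 -> 0 < a -> 0 < b ->
  `|x - a| <= d * a -> `|y - b| <= d * b ->
  (1 - 3 * d) * (a * b) <= x * y <= (1 + 3 * d) * (a * b).
Proof.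
move=> d0 d1 a0 b0; rewrite !ler_norml => /andP[h1 h2] /andP[h3 h4].
have dd : d * d <= d by rewrite ler_piMl// ltW.
have d2 : 0 <= 1 - d by rewrite subr_ge0.
have x0 : (1 - d) * a <= x by lra.
have y0 : (1 - d) * b <= y by lra.
have x1 : x <= (1 + d) * a by lra.
have y1 : y <= (1 + d) * b by lra.
have ab := mulr_gt0 a0 b0; have dd0 := mulr_ge0 (ltW d0) (ltW d0).
have xa : 0 <= (1 - d) * a by rewrite mulr_ge0// ltW.
have yb : 0 <= (1 - d) * b by rewrite mulr_ge0// ltW.
apply/andP; split.
  apply: le_trans (ler_pM xa yb x0 y0).
  rewrite mulrACA ler_pM2r// (_ : (1 - d) * (1 - d) = 1 - 2 * d + d * d); last by ring.
  by clear -d0 dd0; lra.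
apply: le_trans (ler_pM (le_trans xa x0) (le_trans yb y0) x1 y1) _.
rewrite mulrACA ler_pM2r// (_ : (1 + d) * (1 + d) = 1 + 2 * d + d * d); last by ring.
by clear -d0 dd; lra.
Qed.

Lemma block_distances (R : realFieldType) (a T x y : R) : 0 <= a -> 0 < T ->
  a + T <= y / 2 -> a <= x <= a + T ->
  [/\ `|x - a| <= T, `|y - x - (y - a)| <= T, a <= y - x & a <= y - a].
Proof.
move=> a0 T0 ay /andP[ax xa].
have -> : y - x - (y - a) = - (x - a) by ring.
rewrite normrN ger0_norm ?subr_ge0// lerBlDl; split => //; lra.
Qed.

Section BlockIntegrals.
Variables (R : realType) (T : R) (f g : R -> R).
Hypotheses (T0 : 0 < T) (fs : log_slow f) (gs : log_slow g).
Hypotheses (f_cont : continuous f) (g_cont : continuous g).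
Local Notation mu := (@lebesgue_measure R).

Lemma Rintegral_bounds (F : R -> R) (a b lo hi : R) : continuous F -> a <= b ->
  (forall x, a <= x <= b -> lo <= F x <= hi) ->
  lo * (b - a) <= \int[mu]_(x in `[a, b]) F x <= hi * (b - a).
Proof.
move=> cF ab h.
have c (z : R) : \int[mu]_(x in `[a, b]) z = z * (b - a).
  rewrite Rintegral_cst; last exact: measurable_itv.
  rewrite [X in fine X]lebesgue_measure_itv/= lte_fin; case: ltP => // ba.
  by rewrite /= (_ : b = a) ?subrr//; apply/eqP; rewrite eq_le ab ba.
have ic (z : R) : mu.-integrable `[a, b] (EFin \o (fun=> z)).
  by apply: continuous_integrable_itv => x; exact: cvg_cst.
rewrite -!c; apply/andP; split; (apply: le_Rintegral;
  [exact: measurable_itv|exact: ic || exact: continuous_integrable_itv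
  |exact: ic || exact: continuous_integrable_itv|]) => x /=; rewrite in_itv/= => /h /andP[] //.
Qed.

Lemma Rintegral_blocks (F : R -> R) (N : nat) (b : R) : continuous F -> N%:R * T <= b ->
  \int[mu]_(x in `[0, b]) F x =
  \sum_(0 <= k < N) \int[mu]_(x in `[k%:R * T, k%:R * T + T]) F x +
  \int[mu]_(x in `[N%:R * T, b]) F x.
Proof.
move=> cF.
have D (x y z : R) : x <= y -> y <= z -> \int[mu]_(t in `[x, z]) F t =
    \int[mu]_(t in `[x, y]) F t + \int[mu]_(t in `[y, z]) F t.
  move=> xy yz; apply/eqP; rewrite addrC -subr_eq; apply/eqP.
  rewrite Rintegral_itvB ?bnd_simp//; last exact: continuous_integrable_itv.
  rewrite Rintegral_itv_obnd_cbnd//.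
  apply: integrableS (continuous_integrable_itv y z cF); [exact: measurable_itv|exact: measurable_itv|].
  by apply: subset_itvr; rewrite bnd_simp.
elim: N b => [|N IH] b hb; first by rewrite big_geq// add0r mul0r.
have NT : N.+1%:R * T = N%:R * T + T by rewrite -natr1 mulrDl mul1r.
have N0 : 0 <= N%:R * T by rewrite mulr_ge0// ltW.
move: hb; rewrite NT => hb.
rewrite (D 0 (N%:R * T + T) b)//; last by rewrite addr_ge0// ltW.
rewrite (IH (N%:R * T + T)); last by rewrite lerDl ltW.
by rewrite big_nat_recr//= NT.
Qed.

(** Far out, slow variation gives the factor 2; on the remaining compact interval the ratio of
    maximum to minimum does. *)
Lemma log_slow_block_le : exists2 C : R, 0 < C & forall (k : nat) x,
  k%:R * T <= x <= k%:R * T + T -> g x <= C * g (k%:R * T).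
Proof.
have [X hX] := log_slow_half gs (ltW T0).
have L0 : 0 <= `|X| + T by rewrite addr_ge0// ltW.
have [M _ hM] := EVT_max L0 (continuous_subspaceT g_cont).
have [m _ hm] := EVT_min L0 (continuous_subspaceT g_cont).
exists (2 + g M / g m); first by rewrite addr_gt0// divr_gt0// gs.1.
have Xn := ler_norm X; have T1 := T0.
move=> k x /andP[kx xk]; have k0 : 0 <= k%:R * T by rewrite mulr_ge0// ltW.
have gk := gs.1 (k%:R * T); have gm := gs.1 m; have gM := gs.1 M.
have q0 : 0 < g M / g m by rewrite divr_gt0.
have [kX|Xk] := leP `|X| (k%:R * T).
  apply: (@le_trans _ _ (2 * g (k%:R * T))); last by rewrite ler_pM2r// lerDl ltW.
  apply: (hX _ _ _ _ _).2; [lra|lra|rewrite ler_norml; apply/andP; split; lra].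
have h1 : g x <= g M by apply: hM; rewrite in_itv/=; apply/andP; split; lra.
have h2 : g m <= g (k%:R * T) by apply: hm; rewrite in_itv/=; apply/andP; split; lra.
apply: le_trans h1 _; apply: (@le_trans _ _ (g M / g m * g (k%:R * T))).
  by rewrite mulrAC ler_pdivlMr// ler_pM2l.
by rewrite ler_pM2r// lerDr.
Qed.

(** On a far block both factors stay within a ratio close to 1 of their values at its left end, so
    its integral is nearly [T] times the corresponding summand, and [block_conv_asymp] applies with
    [c = T]. The incomplete block is at most [4 * T * (f (y / 2) * g (y / 2))]. *)
Lemma conv_integral_asymp :
  (forall B : R, exists K : nat, B <= \sum_(0 <= k < K) g (k%:R * T)) ->
  forall eps, 0 < eps -> exists Y, forall y, Y <= y ->
  `|\int[mu]_(x in `[0, y / 2]) (g x * f (y - x)) - T * block_conv T f g y|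
    <= eps * block_conv T f g y.
Proof.
move=> gdiv eps eps0.
have cF y : continuous (fun x => g x * f (y - x)).
  move=> x; apply: cvgM; first exact: g_cont.
  apply: (@continuous_comp _ _ _ (fun l => y - l) f); last exact: f_cont.
  by apply: cvgB; [exact: cvg_cst|exact: cvg_id].
pose q (k : nat) y := \int[mu]_(x in `[k%:R * T, k%:R * T + T]) (g x * f (y - x)).
pose extra y := \int[mu]_(x in `[(nblocks T y)%:R * T, y / 2]) (g x * f (y - x)).
have [Cg Cg0 hCg] := log_slow_block_le.
have [X1 hX1] := log_slow_half gs (ltW T0).
have [X2 hX2] := log_slow_half fs (ltW T0).
have fgM x y (a b : R) : g x <= a -> f y <= b -> 0 <= g x * f y <= a * b.
  move=> h1 h2; rewrite mulr_ge0 ?(ltW (gs.1 _)) ?(ltW (fs.1 _))//=.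
  by apply: ler_pM => //; [exact: ltW (gs.1 _)|exact: ltW (fs.1 _)].
have arch (z : R) : exists K : nat, z <= K%:R * T.
  exists (Num.truncn (z / T)).+1; rewrite -ler_pdivrMr// ltW//; exact: truncnS_gt.
have T1 := T0; have X1n := ler_norm X1; have X2n := ler_norm X2.
have X1p := normr_ge0 X1; have X2p := normr_ge0 X2.
have [Y1 hY1] : exists Y, forall y, Y <= y ->
    `|\sum_(0 <= k < nblocks T y) q k y + extra y - T * block_conv T f g y|
      <= eps * block_conv T f g y.
  apply: (@block_conv_asymp R T f g T0 fs gs gdiv q extra (fun=> T) (4 * T) T) eps0.
  - clear X1n X2n X1p X2p Cg0 => e e0.
    pose d := Num.min 1 (e / (3 * T)).
    have d0 : 0 < d by rewrite lt_min ltr01 divr_gt0// mulr_gt0.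
    have d1 : d <= 1 by rewrite ge_min lexx.
    have dT : 3 * d * T <= e.
      by rewrite mulrAC mulrC -ler_pdivlMr ?mulr_gt0// ge_min lexx orbT.
    have [Z1 hZ1] := log_slow_close gs (ltW T0) d0.
    have [Z2 hZ2] := log_slow_close fs (ltW T0) d0.
    have [K hK] := arch (`|Z1| + `|Z2|).
    exists K => k y Kk ky.
    have ZkT : `|Z1| + `|Z2| <= k%:R * T.
      by apply: le_trans hK _; rewrite ler_pM2r// ler_nat.
    have Z1k : Z1 <= k%:R * T.
      by apply: le_trans (ler_norm _) (le_trans _ ZkT); rewrite lerDl.
    have Z2k : Z2 <= k%:R * T.
      by apply: le_trans (ler_norm _) (le_trans _ ZkT); rewrite lerDr.
    have kT0 : 0 <= k%:R * T by rewrite mulr_ge0// ltW.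
    clearbody d.
    have bnd x : k%:R * T <= x <= k%:R * T + T ->
        (1 - 3 * d) * (g (k%:R * T) * f (y - k%:R * T)) <= g x * f (y - x) <=
        (1 + 3 * d) * (g (k%:R * T) * f (y - k%:R * T)).
      move=> kx; have [a1 a2 b3 b4] := block_distances kT0 T0 ky kx.
      have b1 := le_trans Z1k (andP kx).1.
      exact: (product_close d0 d1 (gs.1 _) (fs.1 _) (hZ1 _ _ b1 Z1k a1)
        (hZ2 _ _ (le_trans Z2k b3) (le_trans Z2k b4) a2)).
    have kkT : k%:R * T <= k%:R * T + T by rewrite lerDl ltW.
    have /andP[] := Rintegral_bounds (cF y) kkT bnd.
    rewrite -/(q k y) addrAC subrr add0r.
    have P0 : 0 < g (k%:R * T) * f (y - k%:R * T) by rewrite mulr_gt0 ?gs.1 ?fs.1.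
    move: P0; move: (g _ * f _) (q k y) => P Q P0 l u.
    have dTP : 3 * d * T * P <= e * P by rewrite ler_pM2r.
    clear ky kT0 ZkT Z1k Z2k kkT bnd d0 d1 dT e0.
    rewrite ler_norml; apply/andP; split; lra.
  - move=> k; have L0 : 0 <= k%:R * T + T by rewrite addr_ge0// ?mulr_ge0// ltW.
    have [Z hZ] := log_slow_half fs L0.
    exists (Cg * g (k%:R * T) * 2 * T), (`|Z| + (k%:R * T + T)) => y hy.
    have Zn := ler_norm Z.
    have kT0 : 0 <= k%:R * T by rewrite mulr_ge0// ltW.
    have bnd x : k%:R * T <= x <= k%:R * T + T ->
        0 <= g x * f (y - x) <= Cg * g (k%:R * T) * (2 * f y).
      move=> kx; have h1 := hCg _ _ kx; move: kx => /andP[kx xk].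
      apply: (fgM _ _ _ _ h1).
      have b1 : Z <= y - x by lra.
      have b2 : Z <= y by lra.
      have b3 : `|y - x - y| <= k%:R * T + T by rewrite ler_norml; apply/andP; split; lra.
      exact: (hZ _ _ b1 b2 b3).2.
    have kkT : k%:R * T <= k%:R * T + T by rewrite lerDl ltW.
    have /andP[] := Rintegral_bounds (cF y) kkT bnd.
    rewrite -/(q k y) addrAC subrr add0r mul0r => q0 qM; rewrite ger0_norm//.
    by apply: le_trans qM _; rewrite le_eqVlt; apply/orP; left; apply/eqP; ring.
  - by move=> y; rewrite ger0_norm// ltW.
  - exists (2 * (`|X1| + `|X2| + T)) => y hy.
    have y0 : 0 <= y by lra.
    have n1 := nblocks_le T0 y0; have n2 := nblocks_gt T0 y.
    have bnd x : (nblocks T y)%:R * T <= x <= y / 2 ->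
        0 <= g x * f (y - x) <= 2 * g (y / 2) * (2 * f (y / 2)).
      move=> /andP[kx xk]; apply: fgM.
        have b1 : X1 <= x by lra.
        have b2 : X1 <= y / 2 by lra.
        have b3 : `|x - y / 2| <= T by rewrite ler_norml; apply/andP; split; lra.
        exact: (hX1 _ _ b1 b2 b3).2.
      have b1 : X2 <= y - x by lra.
      have b2 : X2 <= y / 2 by lra.
      have b3 : `|y - x - y / 2| <= T by rewrite ler_norml; apply/andP; split; lra.
      exact: (hX2 _ _ b1 b2 b3).2.
    have /andP[] := Rintegral_bounds (cF y) n1 bnd.
    rewrite -/(extra y) mul0r => q0 qM; rewrite ger0_norm//.
    apply: le_trans qM _.
    have P0 : 0 < f (y / 2) * g (y / 2) by rewrite mulr_gt0 ?gs.1 ?fs.1.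
    have fy := fs.1 y.
    apply: (@le_trans _ _ (2 * g (y / 2) * (2 * f (y / 2)) * T)).
      rewrite ler_pM2l; first by lra.
      by rewrite !mulr_gt0 ?gs.1 ?fs.1.
    have -> : 2 * g (y / 2) * (2 * f (y / 2)) * T = 4 * T * (f (y / 2) * g (y / 2)) by ring.
    by rewrite ler_pM2l ?mulr_gt0// lerDr ltW.
exists (Num.max Y1 0) => y; rewrite ge_max => /andP[y1 y0].
have := hY1 _ y1.
by rewrite -(@Rintegral_blocks (fun x => g x * f (y - x)) (nblocks T y) (y / 2))//; exact: nblocks_le.
Qed.

End BlockIntegrals.

Section Divergence.
Variables (R : realType) (T : R) (phi : R -> R).
Hypotheses (T0 : 0 < T) (phi_sv : regular_slowly_varying phi).
Local Notation mu := (@lebesgue_measure R).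
Local Notation g := (phi \o expR).

(** Bounded block sums would bound the integrals over [[1, expR (i%:R * T)]] uniformly in [i], and
    by monotone convergence the whole integral. *)
Lemma block_sum_diverges : (\int[mu]_(x in `[1%R, +oo[) (phi x / x)%:E = +oo)%E ->
  forall B : R, exists K : nat, B <= \sum_(0 <= k < K) g (k%:R * T).
Proof.
move=> int_oo B; apply: contrapT => none.
have gc : continuous g := slowly_varying_exp_continuous phi_sv.
have gs : log_slow g := slowly_varying_log_slow phi_sv.
have [C C0 hC] := log_slow_block_le T0 gs gc.
have bd K : \sum_(0 <= k < K) g (k%:R * T) <= B.
  by rewrite leNgt; apply/negP => h; apply: none; exists K; exact: ltW.
pose F (i : nat) : set R := `[expR 0, expR (i%:R * T)]%classic.
have x0F i x : F i x -> 0 < x.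
  by rewrite /F/= in_itv/= => /andP[h _]; apply: lt_le_trans h; exact: expR_gt0.
have iT0 (i : nat) : 0 <= i%:R * T by rewrite mulr_ge0// ltW.
have FI i : (\int[mu]_(x in F i) (phi x / x)%:E <= (C * T * B)%:E)%E.
  rewrite (integral_exp_substitution (iT0 i) (slowly_varying_continuous phi_sv)).
  have ig := continuous_integrable_itv 0 (i%:R * T) gc.
  have -> : (\int[mu]_(x in `[0%R, (i%:R * T)%R]) (phi (expR x))%:E)%E =
      (\int[mu]_(x in `[0, i%:R * T]) g x)%:E.
    by rewrite /Rintegral fineK//; apply: integrable_fin_num => //; exact: ig.
  rewrite lee_fin (Rintegral_blocks T0 gc (lexx _)) set_itv1 Rintegral_set1 addr0.
  apply: (@le_trans _ _ (\sum_(0 <= k < i) C * T * g (k%:R * T))).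
    apply: ler_sum => k _.
    have kkT : k%:R * T <= k%:R * T + T by rewrite lerDl ltW.
    have bnd x : k%:R * T <= x <= k%:R * T + T -> 0 <= g x <= C * g (k%:R * T).
      by move=> kx; rewrite (ltW (gs.1 _)) hC.
    have /andP[_ h] := Rintegral_bounds gc kkT bnd; apply: le_trans h _.
    by rewrite addrAC subrr add0r mulrAC.
  by rewrite -mulr_sumr ler_wpM2l// mulr_ge0// ltW.
have U : `[1%R, +oo[%classic = \bigcup_i F i.
  apply/seteqP; split => x /=; rewrite in_itv/= andbT.
    move=> x1; have x0 : 0 < x by apply: lt_le_trans x1.
    exists (Num.truncn (ln x / T)).+1 => //; rewrite /F/= in_itv/= expR0 x1/=.
    rewrite -{1}(lnK x0) ler_expR -ler_pdivrMr// ltW//; exact: truncnS_gt.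
  by move=> [i _]; rewrite /F/= in_itv/= expR0 => /andP[].
have ndF : nondecreasing_seq F.
  move=> i j ij; apply/subsetPset; apply: subset_itvl; rewrite bnd_simp ler_expR.
  by rewrite ler_pM2r// ler_nat.
have mF i : measurable (F i) by exact: measurable_itv.
have mf i : measurable_fun (F i) (fun x => (phi x / x)%:E).
  apply/measurable_EFinP; apply: subspace_continuous_measurable_fun => //.
  apply: continuous_in_subspaceT => x /set_mem /x0F x0.
  apply: cvgM; first by apply: (slowly_varying_continuous phi_sv); rewrite inE/= in_itv/= x0.
  by apply: cvgV => //; rewrite gt_eqF.
have f0 i x : F i x -> (0 <= (phi x / x)%:E)%E.
  move=> /x0F x0; rewrite lee_fin divr_ge0 ?(ltW x0)//.
  by case: phi_sv => -[_ + _] _ _ _ => /(_ _ x0)/ltW.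
have := ge0_nondecreasing_set_cvg_integral (mu := mu) ndF mF mf f0.
rewrite -U int_oo => cv.
have : (+oo <= (C * T * B)%:E)%E.
  rewrite -(cvg_lim _ cv)//; apply: lime_le; first by apply/cvg_ex; exists +oo%E.
  by apply: nearW => i; exact: FI.
by rewrite leye_eq.
Qed.

End Divergence.

(** * Counting functions *)

Lemma asymp_equiv_expR (R : realType) (F G : R -> R) :
  (F ~_(0^'+) G) <-> forall eps : R, 0 < eps -> exists X, forall x, X <= x ->
    `|F (expR (- x)) - G (expR (- x))| <= eps * `|G (expR (- x))|.
Proof.
rewrite eqaddoP; split=> [h eps eps0|h eps eps0].
  have /nbhs_ballP[d /= d0 hd] := h _ eps0.
  exists (- ln d + 1) => x hx; apply: hd; last exact: expR_gt0.
  rewrite /ball/= sub0r normrN gtr0_norm ?expR_gt0//.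
  by rewrite -{1}(lnK d0) ltr_expR; lra.
have [X hX] := h _ eps0.
near=> t; have t0 : 0 < t by [].
have -> : t = expR (- (- ln t)) by rewrite opprK lnK.
apply: hX; rewrite lerNr -ler_expR lnK//.
near: t; exact: nbhs_right_le (expR_gt0 _).
Unshelve. all: by end_near.
Qed.

Section CountingFunction.
Variables (R : realType) (H : hilbertType R) (A : {linear H -> H}) (p T : R) (phi s : R -> R).
Hypotheses (A_compact : compact_operator A) (A_sa : selfadjoint A) (A_ge0 : nonnegative_operator A).
Hypotheses (p0 : 0 < p) (T0 : 0 < T) (phi_sv : regular_slowly_varying phi).
Hypotheses (s_cont : continuous s) (sT : periodic s T) (s_gt0 : forall x, 0 < s x).
Hypothesis A_asymp : (fun t => (spectral_count A t)%:R : R)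
     ~_(0^'+) (fun t => (phi (1 / t) * s (ln (1 / t)) / t `^ (1 / p))%R).
Local Notation f := (phi \o expR).
Local Notation n := (fun x : R => spectral_count A (expR (- x))).
Local Notation u := (fun i => - ln (eigenvalues A i)).

Lemma count_asymp : count_equiv p f s n.
Proof.
move=> eps eps0; have [X hX] := (asymp_equiv_expR _ _).1 A_asymp _ eps0.
exists X => x hx; have := hX _ hx.
have -> : phi (1 / expR (- x)) * s (ln (1 / expR (- x))) / expR (- x) `^ (1 / p) =
    f x * exp_weight p s x.
  rewrite div1r expRN invrK expRK /exp_weight /= -expRN -expRM mulNr expRN invrK.
  by rewrite div1r; ring.
rewrite [in leRHS]ger0_norm// ltW// mulr_gt0// ?exp_weight_gt0//.
exact: (slowly_varying_log_slow phi_sv).1.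
Qed.

Lemma count_mono : {homo n : x y / x <= y >-> (x <= y)%N}.
Proof.
have [D [a es]] := compact_eigensystem A_compact A_sa A_ge0.
move=> x y xy; case E : (n x) => [|k]//.
rewrite (spectral_count_gt es)// ?expR_gt0//.
apply: le_lt_trans (_ : expR (- x) < _); first by rewrite ler_expR lerN2.
by rewrite -(spectral_count_gt es) ?expR_gt0// E.
Qed.

(** By slow variation [f] decays at most like [expR (- x / (2 * p))], which cannot offset the growth
    [expR (x / p)]. Hence there are infinitely many positive eigenvalues and no zero padding, and
    the logarithms of the eigenvalues make sense. *)
Lemma count_unbounded i : exists x, (i < n x)%N.
Proof.
have fs := slowly_varying_log_slow phi_sv.
have [c c0 [S hc]] := periodic_bounds T0 s_cont sT s_gt0.
have e0 : 0 < 1 / (2 * p) by rewrite divr_gt0// mulr_gt0.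
have [X1 hX1] := fs.2 _ e0.
have h12 : 0 < 1 / 2 :> R by rewrite divr_gt0.
have [X2 hX2] := count_asymp h12.
pose X := Num.max (Num.max X1 X2) 0.
have X1X : X1 <= X by rewrite /X !le_max lexx.
have X2X : X2 <= X by rewrite /X !le_max lexx orbT.
have X0 : 0 <= X by rewrite /X le_max lexx orbT.
clearbody X; have fX := fs.1 X.
pose M := f X * c / 2; have M0 : 0 < M by rewrite /M divr_gt0// mulr_gt0.
(* Chosen so that [M * expR (d / (2 * p)) >= i%:R + 1], where [M] bounds the count from below up to
   its exponential growth. *)
pose d := Num.max 0 (2 * p * ln ((i%:R + 1) / M)).
have d0 : 0 <= d by rewrite /d le_max lexx.
have hd : 2 * p * ln ((i%:R + 1) / M) <= d by rewrite /d le_max lexx orbT.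
exists (X + d).
have Xd : X <= X + d by rewrite lerDl.
have := hX2 _ (le_trans X2X Xd); rewrite ler_norml => /andP[h2 _].
have : f X <= expR (1 / (2 * p) * `|X - (X + d)|) * f (X + d).
  by apply: hX1 => //; exact: le_trans Xd.
rewrite opprD addrA subrr sub0r normrN ger0_norm//.
move=> h1.
have h3 : (i%:R + 1) / M <= expR (d / (2 * p)).
  have z0 : 0 < (i%:R + 1) / M by rewrite divr_gt0// ltr_wpDl.
  by rewrite -{1}(lnK z0) ler_expR ler_pdivlMr ?mulr_gt0// mulrC.
have h4 : expR ((X + d) / p) >= expR (d / (2 * p)) * expR (d / (2 * p)).
  rewrite -expRD ler_expR; have -> : d / (2 * p) + d / (2 * p) = d / p by field; rewrite gt_eqF.
  by rewrite ler_pM2r ?invr_gt0// lerDr.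
have fd := fs.1 (X + d).
have [sc _] := hc (X + d).
have h5 : i%:R + 1 <= (n (X + d))%:R :> R.
  apply: (@le_trans _ _ (f (X + d) * exp_weight p s (X + d) / 2)); last by lra.
  apply: (@le_trans _ _ (f (X + d) * (expR (d / (2 * p)) * expR (d / (2 * p)) * c) / 2)); last first.
    rewrite ler_pM2r ?invr_gt0// ler_pM2l// /exp_weight.
    by apply: ler_pM => //; rewrite ?mulr_ge0 ?expR_ge0// ltW.
  have e1 : 1 / (2 * p) * d = d / (2 * p) by rewrite div1r mulrC.
  move: h1; rewrite e1 => h1.
  have h6 : M * expR (d / (2 * p)) >= i%:R + 1 by rewrite -ler_pdivrMl// mulrC.
  apply: le_trans h6 _; rewrite /M.
  have -> : f (X + d) * (expR (d / (2 * p)) * expR (d / (2 * p)) * c) / 2 =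
    (expR (d / (2 * p)) * f (X + d)) * (c / 2 * expR (d / (2 * p))) by ring.
  have -> : f X * c / 2 * expR (d / (2 * p)) = f X * (c / 2 * expR (d / (2 * p))) by ring.
  by rewrite ler_pM2r// mulr_gt0 ?expR_gt0// divr_gt0.
by move: h5; rewrite natr1 ler_nat opprD.
Qed.

Lemma eigenvalues_gt0 i : 0 < eigenvalues A i.
Proof.
have [D [a es]] := compact_eigensystem A_compact A_sa A_ge0.
have [x] := count_unbounded i; rewrite (spectral_count_gt es) ?expR_gt0//.
exact: lt_trans (expR_gt0 _).
Qed.

Lemma counting_function_gt x i : (i < n x)%N = (u i < x).
Proof.
have [D [a es]] := compact_eigensystem A_compact A_sa A_ge0.
rewrite (spectral_count_gt es) ?expR_gt0// -[X in _ < X]lnK ?posrE ?eigenvalues_gt0//.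
by rewrite ltr_expR ltrNl.
Qed.

End CountingFunction.

(* [S1], [S2] and [P] are the three terms of [tensor_count_split] divided by
   [expR (y / p)]; [b], [h], [g], [r] and [q] are the values of [block_conv],
   [h_conv phit phi], [phit], [s_tensor] and [s_star]. *)
Lemma combine_errors (R : realType) (T c1 C1 c2 eps : R) : 0 < T -> 0 < c1 -> 0 < C1 -> 0 < c2 ->
  0 < eps -> exists2 e : R, 0 < e & forall S1 S2 P b h g r q : R,
    0 < g -> 0 <= b -> 0 <= P -> c1 <= r -> r <= C1 -> c2 <= q ->
    `|S1 - g * q| <= e * g -> `|S2 - T * r * b| <= e * b -> P <= e * b ->
    `|h - T * b| <= e * b ->
    `|S1 + S2 - P - (h * r + g * q)| <= eps * `|h * r + g * q|.
Proof.
move=> T0 c10 C10 c20 eps0.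
(* The first bound gives [h >= T * b / 2], the second absorbs the error of [S1] into [g * q], and
   the third absorbs the errors of [S2], [P] and [h], in total [(2 + C1) * e * b], into [h * r]. *)
pose e := Num.min (T / 2) (Num.min (eps * c2) (eps * c1 * T / (2 * (2 + C1)))).
have k0 : 0 < 2 * (2 + C1) by rewrite mulr_gt0// addr_gt0.
have e0 : 0 < e.
  by rewrite /e !lt_min divr_gt0//= mulr_gt0//= divr_gt0// !mulr_gt0.
have e1 : e <= T / 2 by rewrite /e ge_min lexx.
have e2 : e <= eps * c2 by rewrite /e !ge_min lexx orbT.
have e3 : 2 * (2 + C1) * e <= eps * c1 * T.
  by rewrite mulrC -ler_pdivlMr// /e !ge_min lexx !orbT.
clearbody e; exists e => // S1 S2 P b h g r q g0 b0 P0 r1 r2 q1.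
rewrite !ler_norml => /andP[a1 a2] /andP[a3 a4] a5 /andP[a6 a7].
have r0 : 0 < r by exact: lt_le_trans r1.
have bT : b * T <= 2 * h.
  by have := ler_wpM2r b0 e1; lra.
have h0 : 0 <= h by have := mulr_ge0 b0 (ltW T0); lra.
have q0 : 0 < q by exact: lt_le_trans q1.
have ge0 : 0 <= h * r + g * q by rewrite addr_ge0// mulr_ge0// ltW.
rewrite (ger0_norm ge0).
have b3 : (2 + C1) * e * b <= eps * (h * r).
  have : (2 + C1) * e * b * (2 * T) <= eps * (h * r) * (2 * T).
    apply: (@le_trans _ _ (eps * c1 * T * (b * T))).
      have := ler_wpM2r (mulr_ge0 b0 (ltW T0)) e3; lra.
    apply: (@le_trans _ _ (eps * c1 * T * (2 * h))).
      by apply: ler_wpM2l bT; rewrite !mulr_ge0// ltW.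
    apply: (@le_trans _ _ (eps * r * T * (2 * h))); last by lra.
    apply: ler_wpM2r; first by rewrite mulr_ge0.
    by rewrite ler_pM2r// ler_pM2l.
  by rewrite ler_pM2r// mulr_gt0.
have b4 : e * g <= eps * (g * q).
  apply: (@le_trans _ _ (eps * c2 * g)); first by rewrite ler_pM2r.
  by rewrite -mulrA ler_pM2l// (mulrC g) ler_pM2r.
have c3 : (h - T * b) * r <= e * b * C1.
  apply: (@le_trans _ _ (e * b * r)); first by rewrite ler_pM2r.
  by rewrite ler_wpM2l// mulr_ge0// ltW.
have c4 : (T * b - h) * r <= e * b * C1.
  apply: (@le_trans _ _ (e * b * r)); first by rewrite ler_pM2r//; lra.
  by rewrite ler_wpM2l// mulr_ge0// ltW.
by apply/andP; split; lra.
Qed.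

Section SStar.
Variables (R : realType) (p St B : R) (st : R -> R) (lam : nat -> R).
Hypotheses (p0 : 0 < p) (st_gt0 : forall x, 0 < st x) (stS : forall x, st x <= St).
Hypothesis lam_gt0 : forall i, 0 < lam i.
Local Notation u := (fun i => - ln (lam i)).
Hypothesis sum1 : forall I : nat, \sum_(0 <= i < I) expR (- u i / p) <= B.

Lemma s_star_seriesE y I : s_star_series p st lam y I =
  \sum_(0 <= i < I) st (y - u i) * expR (- u i / p).
Proof.
rewrite /s_star_series /series/=; apply: eq_bigr => i _.
by rewrite !opprK /powR (gt_eqF (lam_gt0 i)) div1r (mulrC p^-1).
Qed.

Lemma s_star_series_nondecreasing y : nondecreasing_seq (s_star_series p st lam y).
Proof.
apply/nondecreasing_seqP => I; rewrite !s_star_seriesE big_nat_recr//= lerDl.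
by rewrite mulr_ge0 ?expR_ge0// ltW.
Qed.

Lemma s_star_series_cvg y : cvgn (s_star_series p st lam y).
Proof.
apply: nondecreasing_is_cvgn; first exact: s_star_series_nondecreasing.
exists (St * B) => _ [I _ <-]; rewrite s_star_seriesE.
apply: (@le_trans _ _ (\sum_(0 <= i < I) St * expR (- u i / p))).
  by apply: ler_sum => i _; rewrite ler_pM2r ?expR_gt0.
by rewrite -mulr_sumr ler_wpM2l// (le_trans (ltW (st_gt0 0))).
Qed.

Lemma s_star_ge y I : \sum_(0 <= i < I) st (y - u i) * expR (- u i / p) <= s_star p st lam y.
Proof.
rewrite -s_star_seriesE; apply: nondecreasing_cvgn_le.
  exact: s_star_series_nondecreasing.
exact: s_star_series_cvg.
Qed.

Lemma s_star_le y I d :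
  (forall I' : nat, \sum_(I <= i < I') st (y - u i) * expR (- u i / p) <= d) ->
  s_star p st lam y <= \sum_(0 <= i < I) st (y - u i) * expR (- u i / p) + d.
Proof.
move=> h; apply: limr_le; first exact: s_star_series_cvg.
exists I => // I' /= II'; rewrite s_star_seriesE (big_cat_nat (leq0n I) II')//=.
by rewrite lerD2l.
Qed.

End SStar.

(** * Summability over the first spectrum *)

Section EigenvalueSums.
Variables (R : realType) (p S : R) (phi phit s : R -> R) (u : nat -> R) (n : R -> nat).
Hypotheses (p0 : 0 < p) (phi_sv : regular_slowly_varying phi) (phit_sv : regular_slowly_varying phit).
Hypotheses (s_gt0 : forall x, 0 < s x) (sS : forall x, s x <= S).
Local Notation f := (phi \o expR).
Local Notation g := (phit \o expR).
Local Notation mu := (@lebesgue_measure R).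
Hypothesis nf : count_equiv p f s n.
Hypothesis nP : forall x i, (i < n x)%N = (u i < x).
Hypothesis phi_int : (\int[mu]_(tau in `[1%R, +oo[) (phi tau / tau)%:E < +oo)%E.
Hypothesis m_int : (\int[mu]_(sigma in `[1%R, +oo[)
  ((phi sigma / sigma)%:E * m_sup phit sigma) < +oo)%E.

Let fs : log_slow f. Proof. exact: slowly_varying_log_slow. Qed.

Lemma count_le_block : exists2 C : R, 0 < C & exists k1 : nat, forall k, (k1 <= k)%N ->
  (n k.+1%:R)%:R <= C * (f k%:R * expR (k%:R / p)).
Proof.
have [C [Z [C0 hC]]] := count_shift p0 fs s_gt0 sS nf 1.
exists C => //; exists (Num.truncn `|Z|).+1 => k hk; rewrite -natr1; apply: hC.
have : ((Num.truncn `|Z|).+1)%:R <= k%:R :> R by rewrite ler_nat.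
by have := truncnS_gt `|Z|; have := ler_norm Z; lra.
Qed.

(** For [u i = - ln lam_i] these are the partial sums of [lam_i ^ (1 / p)]. The window argument with
    all weights equal to 1 reduces them to the integral of [phi tau / tau]; convergence of [s_star]
    follows. *)
Lemma eigenvalue_sum_bounded : exists B : R, forall I : nat,
  \sum_(0 <= i < I) expR (- u i / p) <= B.
Proof.
have [C C0 [k1 hC]] := count_le_block.
have w0 (x : R) : 1 <= x -> (0 <= (fun=> 1) x :> \bar R)%E by [].
have d0 (k : nat) : 0 <= (fun=> 1) k :> R by [].
have fin : (\int[mu]_(x in `[1%R, +oo[) ((phi x / x)%:E * (fun=> 1) x) < +oo)%E.
  by under eq_integral do rewrite mule1.
have [k2 hk2] := weighted_block_sum_bounded phi_sv w0 d0 fin.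
pose k0 := maxn k1 k2.
have [B B0 hB] := hk2 k0 (leq_maxr _ _) (fun _ _ _ _ => lexx _).
have wsb := @weighted_sum_bounded R p C 1 B f (fun=> 1) u (fun=> 1) n k0 p0 ler01 nP
  (fun _ _ => ler01) (fun k hk => hC k (leq_trans (leq_maxl _ _) hk)).
exists (\sum_(0 <= i < n k0%:R) expR (- u i / p) + C * 1 * B) => I.
have [In|nI] := leqP I (n k0%:R).
  apply: (@le_trans _ _ (\sum_(0 <= i < n k0%:R) expR (- u i / p))).
    by rewrite (big_cat_nat (leq0n I) In)//= lerDl sumr_ge0// => i _; exact: expR_ge0.
  by rewrite lerDl !mulr_ge0// ltW.
rewrite (big_cat_nat (leq0n _) (ltnW nI))//= lerD2l.
under eq_bigr do rewrite -[expR _]mul1r.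
by apply: wsb => //; [move=> *; rewrite mulr1|exact: ltW].
Qed.

(** [G i] is twice the infimum weight of the window numbered by the integer part of [u i], and
    [I0 = n k0%:R] restricts to [u i >= k0], where all window estimates hold. The integral of [phi]
    against [m_sup phit] then bounds the series. *)
Lemma weighted_eigenvalue_sum_bounded : exists (G : nat -> R) (I0 : nat) (B : R),
  [/\ forall i, 0 <= G i,
      forall i y, (I0 <= i)%N -> 2 * u i < y -> g (y - u i) <= G i * g y &
      forall I, \sum_(I0 <= i < I) G i * expR (- u i / p) <= B].
Proof.
have [C C0 [k1 hC]] := count_le_block.
have [k2 hk2] := inf_weight_ratio phi_sv phit_sv m_int.
have d0 k : 0 <= inf_weight phit k by exact: inf_weight_ge0.
have w0 (x : R) : 1 <= x -> (0 <= m_sup phit x)%E.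
  by move=> x1; apply: m_sup_ge0 => //; exact: lt_le_trans x1.
have [k3 hk3] := weighted_block_sum_bounded phi_sv w0 d0 m_int.
pose k0 := maxn (maxn k1 k2) (maxn k3 1).
have k10 : (k1 <= k0)%N by rewrite /k0 !leq_max leqnn.
have k20 : (k2 <= k0)%N by rewrite /k0 !leq_max leqnn orbT.
have k30 : (k3 <= k0)%N by rewrite /k0 !leq_max leqnn !orbT.
have k00 : (0 < k0)%N by rewrite /k0 !leq_max ltnSn !orbT.
clearbody k0.
have [B B0 hB] := hk3 k0 k30 (fun k x hk => inf_weight_le phi_sv phit_sv m_int (leq_trans k00 hk)).
exists (fun i => 2 * inf_weight phit (Num.truncn (u i))), (n k0%:R), (C * 2 * B).
have uk i : (n k0%:R <= i)%N -> k0%:R <= u i by rewrite leqNgt nP -leNgt.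
split.
- by move=> i; rewrite mulr_ge0.
- move=> i y /uk ui uy.
  have ui0 : 0 <= u i by apply: le_trans ui.
  apply: hk2 => //; last by apply/truncn_itv.
  apply: leq_trans k20 _; rewrite -ltnS -(ltr_nat R).
  by apply: le_lt_trans ui _; exact: truncnS_gt.
- move=> I; pose D (x : R) := inf_weight phit (Num.truncn x).
  have D0 (k : nat) : (k0 <= k)%N -> 0 <= D k%:R by move=> _; exact: d0.
  have hC0 k (hk : (k0 <= k)%N) := hC k (leq_trans k10 hk).
  have wD (k : nat) i : (k0 <= k)%N -> k%:R <= u i < k.+1%:R ->
      2 * inf_weight phit (Num.truncn (u i)) <= 2 * D k%:R.
    by move=> hk hu; rewrite /D natrK (truncn_def hu).
  have fD K : \sum_(k0 <= k < K) f k%:R * D k%:R <= B.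
    by under eq_bigr do rewrite /D natrK.
  have w_ge0 i : 0 <= 2 * inf_weight phit (Num.truncn (u i)) by rewrite mulr_ge0.
  exact: (weighted_sum_bounded p0 (ler0n R 2) nP D0 hC0 wD fD I w_ge0 (ltW C0) B0).
Qed.

End EigenvalueSums.

(** * Assembly of the asymptotics *)

Section TensorCount.
Variables (R : realType) (H Ht K : hilbertType R).
Variables (A : {linear H -> H}) (At : {linear Ht -> Ht}).
Variables (tens : {bilinear H -> Ht -> K}) (AAt : {linear K -> K}).
Hypotheses (A_compact : compact_operator A) (A_sa : selfadjoint A).
Hypotheses (A_ge0 : nonnegative_operator A).
Hypotheses (At_compact : compact_operator At) (At_sa : selfadjoint At).
Hypotheses (At_ge0 : nonnegative_operator At).
Hypotheses (tensP : is_tensor_product tens) (AAtP : is_tensor_operator tens A At AAt).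
Hypotheses (A_gt0 : forall i, 0 < eigenvalues A i) (At_gt0 : forall i, 0 < eigenvalues At i).
Local Notation n := (fun x : R => spectral_count A (expR (- x))).
Local Notation m := (fun x : R => spectral_count At (expR (- x))).
Local Notation u := (fun i => - ln (eigenvalues A i)).
Local Notation v := (fun i => - ln (eigenvalues At i)).

Lemma tensor_count_split y : (spectral_count AAt (expR (- y)))%:R =
  first_sum u n m y + second_sum v n m y - (n (y / 2))%:R * (m (y / 2))%:R :> R.
Proof.
have [D [a es]] := compact_eigensystem A_compact A_sa A_ge0.
have [Dt [at_ est]] := compact_eigensystem At_compact At_sa At_ge0.
have e0 := expR_gt0 (- y).
have card := spectral_count_tensor A_compact A_sa A_ge0 At_compact At_sa At_ge0 tensP AAtP e0.
have naP (t : R) i : 0 < t -> (i < spectral_count A t)%N = (t < eigenvalues A i).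
  exact: (spectral_count_gt es).
have nbP (t : R) i : 0 < t -> (i < spectral_count At t)%N = (t < eigenvalues At i).
  exact: (spectral_count_gt est).
have -> := pair_count_split (fun i => ltW (A_gt0 i)) (fun i => ltW (At_gt0 i)) naP nbP e0 card.
have sq : Num.sqrt (expR (- y)) = expR (- (y / 2)).
  have -> : expR (- y) = expR (- (y / 2)) ^+ 2 by rewrite -expRM_natr mulNr divfK.
  by rewrite sqrtr_sqr ger0_norm ?expR_ge0.
have quo (l : R) : 0 < l -> expR (- y) / l = expR (- (y - - ln l)).
  by move=> l0; rewrite opprK opprD expRD (expRN (ln l)) lnK.
rewrite sq natrD /first_sum /second_sum -addrA; congr (_ + _).
  by rewrite big_mkord natr_sum; apply: eq_bigr => i _; rewrite quo.
rewrite natr_sum -(big_mkord xpredT (fun j =>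
  (spectral_count A (expR (- y) / eigenvalues At j) - spectral_count A (expR (- (y / 2))))%:R)).
have -> : (n (y / 2))%:R * (m (y / 2))%:R = \sum_(0 <= j < m (y / 2)) (n (y / 2))%:R :> R.
  by rewrite sumr_const_nat subn0 mulr_natr.
rewrite -sumrB.
(* The subtraction of natural numbers is exact: [v j < y / 2] gives [y / 2 <= y - v j], and [n] is
   nondecreasing. *)
rewrite !big_nat; apply: eq_bigr => j /andP[_ jm]; rewrite quo// natrB//.
move: jm; rewrite nbP ?expR_gt0// => jm.
have le_y : y / 2 <= y - - ln (eigenvalues At j).
  have : expR (- (y / 2)) < expR (ln (eigenvalues At j)) by rewrite lnK// posrE.
  by rewrite ltr_expR; lra.
exact: (count_mono A_compact A_sa A_ge0 le_y).
Qed.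

End TensorCount.

(** The sums with [N = 1] suffice: they are [rho (y - T)] and [rho y] times [rhot T - rhot 0], an
    increment that is positive because a period multiplies [rhot] by [expR (T / p) > 1]. *)
Lemma stieltjes_sum_bounds (R : realType) (p T : R) (s st J : R -> R) :
  0 < p -> 0 < T -> continuous s -> periodic s T -> (forall x, 0 < s x) ->
  periodic st T -> (forall x, 0 < st x) ->
  (forall N y, (0 < N)%N -> rs_lower p T s st N y <= J y <= rs_upper p T s st N y) ->
  exists2 c : R, 0 < c & exists2 C : R, 0 < C &
    forall y, c <= expR (- y / p) * (T^-1 * J y) <= C.
Proof.
move=> p0 T0 s_cont sT s_gt0 stT st_gt0 JE.
have [c c0 [S hc]] := periodic_bounds T0 s_cont sT s_gt0.
pose d := exp_weight p st T - exp_weight p st 0.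
have d0 : 0 < d.
  rewrite /d -{1}[T]add0r (exp_weight_shiftT p stT) subr_gt0 ltr_pMl ?exp_weight_gt0//.
  by rewrite -[ltLHS]expR0 ltr_expR divr_gt0.
have S0 : 0 < S by have := hc 0 => -[h1 h2]; apply: lt_le_trans c0 (le_trans h1 h2).
exists (T^-1 * (expR (- T / p) * c * d)); first by rewrite !mulr_gt0 ?expR_gt0 ?invr_gt0.
exists (T^-1 * (S * d)); first by rewrite !mulr_gt0 ?invr_gt0.
move=> y; have [sl _] := hc (y - T); have [_ su] := hc y.
rewrite [X in _ <= X <= _]mulrCA !ler_pM2l ?invr_gt0//.
have /andP[l h] := JE 1%N y isT.
move: l h; rewrite /rs_lower /rs_upper !big_nat1 !mul1r mul0r !divr1 subr0 -/d => l h.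
have E0 := expR_gt0 (- y / p).
have ey z : expR (- y / p) * (exp_weight p s (y - z) * d) = expR (- z / p) * s (y - z) * d.
  rewrite /exp_weight.
  have -> : expR (- y / p) * (expR ((y - z) / p) * s (y - z) * d) =
    expR (- y / p) * expR ((y - z) / p) * (s (y - z) * d) by ring.
  by rewrite -expRD -mulrDl addrA addNr sub0r mulrA.
apply/andP; split.
  apply: le_trans (ler_wpM2l (ltW E0) l); rewrite ey ler_pM2r// ler_pM2l//; exact: expR_gt0.
apply: le_trans (ler_wpM2l (ltW E0) h) _.
by have := ey 0; rewrite subr0 oppr0 mul0r expR0 mul1r => ->; rewrite ler_pM2r.
Qed.

Theorem theorem6 (R : realType) (H Ht K : hilbertType R)
  (A : {linear H -> H}) (At : {linear Ht -> Ht})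
  (tens : {bilinear H -> Ht -> K}) (AAt : {linear K -> K})
  (p T : R) (phi phit s st : R -> R)
  (A_compact : compact_operator A) (A_sa : selfadjoint A)
  (A_ge0 : nonnegative_operator A)
  (At_compact : compact_operator At) (At_sa : selfadjoint At)
  (At_ge0 : nonnegative_operator At)
  (tensP : is_tensor_product tens)
  (AAtP : is_tensor_operator tens A At AAt)
  (p_gt0 : 0 < p) (T_gt0 : 0 < T)
  (phi_sv : regular_slowly_varying phi)
  (phit_sv : regular_slowly_varying phit)
  (s_cont : continuous s) (st_cont : continuous st)
  (s_periodic : periodic s T) (st_periodic : periodic st T)
  (s_gt0 : forall x, 0 < s x) (st_gt0 : forall x, 0 < st x)
  (rho_mono : nondecreasing (exp_weight p s))
  (rhot_mono : nondecreasing (exp_weight p st))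
  (A_asymp : (fun t => (spectral_count A t)%:R : R)
     ~_(0^'+) (fun t => (phi (1 / t) * s (ln (1 / t)) / t `^ (1 / p))%R))
  (At_asymp : (fun t => (spectral_count At t)%:R : R)
     ~_(0^'+) (fun t => (phit (1 / t) * st (ln (1 / t)) / t `^ (1 / p))%R))
  (phi_int : (\int[lebesgue_measure]_(tau in `[1%R, +oo[)
                (phi tau / tau)%:E < +oo)%E)
  (phit_int : (\int[lebesgue_measure]_(tau in `[1%R, +oo[)
                (phit tau / tau)%:E = +oo)%E)
  (m_int : (\int[lebesgue_measure]_(sigma in `[1%R, +oo[)
                ((phi sigma / sigma)%:E * m_sup phit sigma) < +oo)%E) :
  [/\ (forall eta, derivable (pconv T s st) eta 1) /\
        continuous (derive1 (pconv T s st)),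
      forall eta, s_tensor p T s st eta =
        expR (- eta / p) * (T^-1 *
          \int[lebesgue_stieltjes_measure
                 (exp_weight_cumulative st_cont rhot_mono)]_(sigma in `[0, T])
            exp_weight p s (eta - sigma)),
      forall tau, cvgn (s_star_series p st (eigenvalues A) tau) &
      (fun t => (spectral_count AAt t)%:R : R)
        ~_(0^'+) (fun t =>
          ((h_conv phit phi (1 / t) * s_tensor p T s st (ln (1 / t)) +
            phit (1 / t) * s_star p st (eigenvalues A) (ln (1 / t)))
           / t `^ (1 / p))%R)].
Proof.
have JE := stieltjes_rs T_gt0 s_cont st_cont s_gt0 rho_mono rhot_mono.
have stE := s_tensorE p_gt0 T_gt0 s_cont st_cont s_periodic st_periodic s_gt0
  rho_mono rhot_mono JE.
have fs := slowly_varying_log_slow phi_sv.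
have gs := slowly_varying_log_slow phit_sv.
have nf := count_asymp phi_sv s_gt0 A_asymp.
have mg := count_asymp phit_sv st_gt0 At_asymp.
have nP := counting_function_gt A_compact A_sa A_ge0 p_gt0 T_gt0 phi_sv s_cont s_periodic s_gt0 A_asymp.
have mP := counting_function_gt At_compact At_sa At_ge0 p_gt0 T_gt0 phit_sv st_cont st_periodic st_gt0 At_asymp.
have A_gt0 := eigenvalues_gt0 A_compact A_sa A_ge0 p_gt0 T_gt0 phi_sv s_cont s_periodic s_gt0 A_asymp.
have At_gt0 := eigenvalues_gt0 At_compact At_sa At_ge0 p_gt0 T_gt0 phit_sv st_cont st_periodic st_gt0 At_asymp.
have n_mono := count_mono A_compact A_sa A_ge0.
have gdiv := block_sum_diverges T_gt0 phit_sv phit_int.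
have [c c0 [S hS]] := periodic_bounds T_gt0 s_cont s_periodic s_gt0.
have [ct ct0 [St hSt]] := periodic_bounds T_gt0 st_cont st_periodic st_gt0.
have sS x : s x <= S by case: (hS x).
have stS x : st x <= St by case: (hSt x).
have [B' sum1] := eigenvalue_sum_bounded p_gt0 phi_sv s_gt0 sS nf nP phi_int.
have [G [I0 [B [G_ge0 gG sumG]]]] :=
  weighted_eigenvalue_sum_bounded p_gt0 phi_sv phit_sv s_gt0 sS nf nP m_int.
have sst_ge := s_star_ge st_gt0 stS A_gt0 sum1.
have sst_le := s_star_le st_gt0 stS A_gt0 sum1.
split.
- split=> [eta|].
    exact: (@ex_derive _ _ _ _ _ _ _ (pconv_is_derive p_gt0 T_gt0 s_cont st_cont
      s_periodic st_periodic s_gt0 rho_mono rhot_mono JE eta)).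
  exact: (derive1_pconv_continuous p_gt0 T_gt0 s_cont st_cont
      s_periodic st_periodic s_gt0 rho_mono rhot_mono JE).
- exact: stE.
- exact: (s_star_series_cvg st_gt0 stS A_gt0 sum1).
apply/asymp_equiv_expR => eps eps0.
have [c1 c10 [C1 C10 hst]] := stieltjes_sum_bounds p_gt0 T_gt0 s_cont s_periodic s_gt0
  st_periodic st_gt0 JE.
(* A lower bound for the first term of the series of positive terms defining [s_star]. *)
pose c2 := ct * expR (- - ln (eigenvalues A 0) / p).
have c20 : 0 < c2 by rewrite mulr_gt0 ?expR_gt0.
have hss y : c2 <= s_star p st (eigenvalues A) y.
  apply: le_trans (sst_ge y 1%N); rewrite big_nat1 ler_pM2r ?expR_gt0//.
  by case: (hSt (y - - ln (eigenvalues A 0))).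
have [e e0 combine] := combine_errors T_gt0 c10 C10 c20 eps0.
have [Y1 h1] := first_sum_asymp p_gt0 gs st_gt0 stS mg nP G_ge0 gG sumG sum1 sst_ge sst_le e0.
have [Y2 h2] := second_sum_asymp p_gt0 T_gt0 fs gs gdiv s_cont s_periodic st_periodic
  s_gt0 sS st_gt0 stS rhot_mono nf mg n_mono mP JE e0.
have [Y3 h3] := half_product_small p_gt0 T_gt0 fs gs s_gt0 sS st_gt0 stS nf mg n_mono e0.
have [Y4 h4] := conv_integral_asymp T_gt0 fs gs (slowly_varying_exp_continuous phi_sv)
  (slowly_varying_exp_continuous phit_sv) gdiv e0.
exists (Num.max (Num.max (Num.max Y1 Y2) (Num.max Y3 Y4)) 0) => y.
rewrite !ge_max => /andP[/andP[/andP[y1 y2] /andP[y3 y4]] y0].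
have main := combine _ _ _ (block_conv T (phi \o expR) (phit \o expR) y)
  (h_conv phit phi (expR y)) (phit (expR y)) (s_tensor p T s st y) (s_star p st (eigenvalues A) y).
have {}h1 := h1 _ y1; have {}h2 := h2 _ y2; have {}h3 := h3 _ y3; have {}h4 := h4 _ y4.
have r1 : c1 <= s_tensor p T s st y by rewrite stE; case/andP: (hst y).
have r2 : s_tensor p T s st y <= C1 by rewrite stE; case/andP: (hst y).
rewrite -(h_conv_exp phi_sv phit_sv y0) in h4.
have TJ : T * s_tensor p T s st y = expR (- y / p) * stieltjes_conv T s st_cont rhot_mono y.
  by rewrite stE mulrCA mulVKf// gt_eqF.
rewrite -TJ in h2.
have P0 : 0 <= expR (- y / p) * ((spectral_count A (expR (- (y / 2))))%:R *
    (spectral_count At (expR (- (y / 2))))%:R) :> R.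
  by rewrite !mulr_ge0 ?expR_ge0.
have := main _ _ _ (gs.1 y) (block_conv_ge0 T fs gs y) P0 r1 r2 (hss y) h1 h2 h3 h4.
rewrite (tensor_count_split A_compact A_sa A_ge0 At_compact At_sa At_ge0 tensP AAtP A_gt0 At_gt0).
have -> : 1 / expR (- y) = expR y by rewrite div1r expRN invrK.
rewrite expRK.
have -> : expR (- y) `^ (1 / p) = expR (- y / p) by rewrite -expRM div1r.
set X := h_conv _ _ _ * _ + _.
have E0 := expR_gt0 (- y / p).
(* The error bounds were obtained after multiplication by [expR (- y / p)], that is by
   [t ^ (1 / p)]; the factor is now removed from both sides. *)
rewrite -mulrDr -mulrBr => hm.
have -> Z : Z - X / expR (- y / p) = (expR (- y / p))^-1 * (expR (- y / p) * Z - X).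
  by rewrite mulrBr mulKf ?gt_eqF// mulrC.
have E1 : 0 < (expR (- y / p))^-1 by rewrite invr_gt0.
rewrite normrM (normrM X) (mulrC `|X|) mulrCA (gtr0_norm E1).
by rewrite ler_pM2l.
Qed.
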